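(* Let $d\in\mathbb{N}$, let $n$ be a prime, let $\alpha>1/2$, and let $\boldsymbol{\gamma}=(\gamma_1,\gamma_2,\ldots)$ satisfy $1\ge\gamma_1\ge\gamma_2\ge\cdots>0$. A fast component-by-component algorithm, using the squared worst-case error of a lattice rule in the Korobov space $E_{d,\alpha,\boldsymbol{\gamma}}$ as the search criterion, can be used to obtain in $\mathcal{O}(d\,n\log n)$ operations a generating vector $\boldsymbol{z}\in\{0,1,\ldots,n-1\}^d$ such that $$e^{\mathrm{wor}}(Q_n(\cdot\circ\psi;\boldsymbol{z});C_{d,\alpha,\boldsymbol{\gamma}})\le e^{\mathrm{wor}}(Q_n(\cdot;\boldsymbol{z});E_{d,\alpha,\boldsymbol{\gamma}})\le\left(\frac{1}{n-1}\left(\prod_{j=1}^d\big(1+2\zeta(2\alpha\lambda)\gamma_j^\lambda\big)-1\right)\right)^{1/(2\lambda)}$$ for all $1/(2\alpha)<\lambda\le1$, where $\zeta(x)=\sum_{k=1}^\infty k^{-x}$. Hence, for each such $\lambda$, the convergence rate is $\mathcal{O}(n^{-1/(2\lambda)})$, with implied constant independent of $d$ if $\sum_{j=1}^\infty\gamma_j^\lambda<\infty$. Letting $\lambda\to1/(2\alpha)$, for fixed $d$ the method achieves a rate $\mathcal{O}(n^{-\alpha+\delta})$ for every $\delta>0$, i.e. arbitrarily close to $\mathcal{O}(n^{-\alpha})$, which is the optimal rate for integration in $C_{d,\alpha,\boldsymbol{\gamma}}$ (no sequence of $n$-point linear cubature rules achieves $\mathcal{O}(n^{-\beta})$ with $\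beta>\alpha$).
   Context: Notation. $\mathbb{Z}_+=\{0,1,2,\ldots\}$. For $\boldsymbol{k}\in\mathbb{Z}^d$, $|\boldsymbol{k}|_0$ is the number of non-zero components. The half-period cosine basis of $L_2([0,1]^d)$ is $\phi_{\boldsymbol{k}}(\boldsymbol{x})=(\sqrt2)^{|\boldsymbol{k}|_0}\prod_{j=1}^d\cos(\pi k_jx_j)$, $\boldsymbol{k}\in\mathbb{Z}_+^d$, and $\hat f(\boldsymbol{k})=\int_{[0,1]^d}f\phi_{\boldsymbol{k}}$. Fourier coefficients are $\widetilde f(\boldsymbol{h})=\int_{[0,1]^d}f(\boldsymbol{x})e^{-2\pi\mathrm{i}\boldsymbol{h}\cdot\boldsymbol{x}}d\boldsymbol{x}$, $\boldsymbol{h}\in\mathbb{Z}^d$. For $\boldsymbol{k}\in\mathbb{Z}^d$, $r_{\alpha,\boldsymbol{\gamma}}(\boldsymbol{k})=\prod_{j=1}^d r_{\alpha,\gamma_j}(k_j)$, where $r_{\alpha,\gamma_j}(0)=1$ and $r_{\alpha,\gamma_j}(k)=|k|^{2\alpha}/\gamma_j$ for $k\ne0$. Cosine space: $C_{d,\alpha,\boldsymbol{\gamma}}=\{f\in L_2([0,1]^d):\|f\|^2=\sum_{\boldsymbol{k}\in\mathbb{Z}_+^d}|\hat f(\boldsymbol{k})|^2r_{\alpha,\boldsymbol{\gamma}}(\boldsymbol{k})<\infty\}$. Korobov space: $E_{d,\alpha,\boldsymbol{\gamma}}=\{f\in L_2([0,1]^d):\|f\|^2=\sum_{\boldsymbol{h}\in\mathbb{Z}^d}|\widetilde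 f(\boldsymbol{h})|^2r_{\alpha,\boldsymbol{\gamma}}(\boldsymbol{h})<\infty\}$. Functions are complex-valued; for $\alpha>1/2$ both are reproducing kernel Hilbert spaces, functions being identified with their continuous representatives given by their cosine, respectively Fourier, series. Lattice rule: $Q_n(f;\boldsymbol{z})=\frac1n\sum_{i=1}^nf(\tfrac{i\boldsymbol{z}}n\bmod1)$. Tent transformation: $\psi(x)=1-|2x-1|$ on $[0,1]$, applied componentwise. Tent-transformed lattice rule: $Q_n(f\circ\psi;\boldsymbol{z})=\frac1n\sum_{i=1}^nf(\psi(\tfrac{i\boldsymbol{z}}n\bmod1))$. Worst-case integration error: $e^{\mathrm{wor}}(Q;H)=\sup_{f\in H,\|f\|_H\le1}|\int_{[0,1]^d}f(\boldsymbol{x})\,d\boldsymbol{x}-Q(f)|$. For a lattice rule in the Korobov space it is known that $e^{\mathrm{wor}}(Q_n(\cdot;\boldsymbol{z});E_{d,\alpha,\boldsymbol{\gamma}})^2=\sum_{\boldsymbol{0}\ne\boldsymbol{k}\in\mathbb{Z}^d,\ \boldsymbol{k}\cdot\boldsymbol{z}\equiv0\,(n)}1/r_{\alpha,\boldsymbol{\gamma}}(\boldsymbol{k})$. Component-by-component algorithm: the components of $\boldsymbol{z}$ are chosen successively; for $s=1,\ldots,d$, with $z_1,\ldots,z_{s-1}$ already fixed, $z_s\in\{1,\ldots,n-1\}$ is chosen to minimize the search criterion in dimension $s$, here $e^{\mathrm{wor}}(Q_n(\cdot;(z_1,\ldots,z_s));E_{s,\alpha,\boldsymbol{\gamma}})^2$.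 ''Fast'' refers to an FFT-based implementation of this search with the stated cost. *)

(* Defs.v *)
From HB Require Import structures.
From mathcomp Require Import all_boot all_order all_algebra.
From mathcomp Require Import all_classical all_reals all_analysis.
From mathcomp Require Export complex.

Set Implicit Arguments.
Unset Strict Implicit.
Unset Printing Implicit Defensive.

Import Order.TTheory GRing.Theory Num.Theory.
Import numFieldNormedType.Exports.

Local Open Scope classical_set_scope.
Local Open Scope ring_scope.

Section lebesgue_tuple.
Context (R : realType).
Local Notation TR := (measurableTypeR R).

Definition cons_pair d (p : TR * d.-tuple TR) : d.+1.-tuple TR :=
  [tuple of p.1 :: p.2].

Lemma measurable_cons_pair d : measurable_fun setT (@cons_pair d).
Proof. exact: (measurable_cons measurable_fst measurable_snd). Qed.

Section step.
Context d (m : {sigma_finite_measure set (d.-tuple TR) -> \bar R}).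

(* Lebesgue measure on R^(d+1), given m on R^d: the image of the product
   measure under (x, t) |-> x :: t. *)
Definition lebesgue_step : set (d.+1.-tuple TR) -> \bar R :=
  pushforward (@lebesgue_measure R \x m)%E (@cons_pair d).

Let step0 : lebesgue_step set0 = 0%E.
Proof. by rewrite /lebesgue_step /pushforward preimage_set0 measure0. Qed.

Let step_ge0 A : (0 <= lebesgue_step A)%E.
Proof. by rewrite /lebesgue_step /pushforward; exact: measure_ge0. Qed.

Let step_sigma_additive : semi_sigma_additive lebesgue_step.
Proof.
move=> F mF tF mUF; rewrite /lebesgue_step /pushforward preimage_bigcup.
apply: measure_semi_sigma_additive.
- by move=> n; rewrite -[X in measurable X]setTI; exact: measurable_cons_pair.
- apply/trivIsetP => /= i j _ _ ij; rewrite -preimage_setI.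
  by move/trivIsetP : tF => /(_ _ _ _ _ ij) ->//; rewrite preimage_set0.
- by rewrite -preimage_bigcup -[X in measurable X]setTI;
    exact: measurable_cons_pair.
Qed.

HB.instance Definition _ := isMeasure.Build _ _ _ lebesgue_step
  step0 step_ge0 step_sigma_additive.

Let step_sigma_finite : sigma_finite setT lebesgue_step.
Proof.
have /sigma_finiteP[F [TF ndF Foo]] := sigma_finiteT (@lebesgue_measure R).
have /sigma_finiteP[G [TG ndG Goo]] := sigma_finiteT m.
pose g (t : d.+1.-tuple TR) : TR * d.-tuple TR := (thead t, [tuple of behead t]).
have mg : measurable_fun setT g.
  apply/measurable_fun_pairP; split; first exact: (measurable_tnth ord0).
  exact: measurable_behead.
have gK : cancel (@cons_pair d) g.
  by case=> x t; rewrite /g /cons_pair /=; congr pair; exact/val_inj.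
exists (fun n => g @^-1` (F n `*` G n)).
  apply/esym/seteqP; split=> // t _.
  have [n _ Fn] : (\bigcup_i F i) (g t).1 by rewrite -TF.
  have [k _ Gk] : (\bigcup_i G i) (g t).2 by rewrite -TG.
  exists (maxn n k) => //; split.
    by move: Fn; exact/subsetPset/ndF/leq_maxl.
  by move: Gk; exact/subsetPset/ndG/leq_maxr.
move=> k; have [mF Fk] := Foo k; have [mG Gk] := Goo k.
split; first by rewrite -[X in measurable X]setTI; apply: mg => //; exact: measurableX.
rewrite /lebesgue_step /pushforward.
rewrite (_ : _ @^-1` _ = F k `*` G k); last first.
  apply/funext => p; rewrite -[in RHS](gK p).
  by rewrite /preimage.
by rewrite product_measure1E// lte_mul_pinfty// ge0_fin_numE.
Qed.

HB.instance Definition _ := Measure_isSigmaFinite.Build _ _ _ lebesgue_step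
  step_sigma_finite.

End step.

Fixpoint lebesgue_tuple d : {sigma_finite_measure set (d.-tuple TR) -> \bar R} :=
  if d is d'.+1 then lebesgue_step (lebesgue_tuple d')
  else @dirac _ (0.-tuple TR) [tuple] R.

End lebesgue_tuple.

Section spaces.
Context (R : realType).
Local Notation C := R[i].
Local Notation normc := ComplexField.Normc.normc.
Local Notation pt d := (d.-tuple (measurableTypeR R)).

Definition cube d : set (pt d) := [set x | forall j, 0 <= tnth x j <= 1].

Definition cint d (f : pt d -> C) : C :=
  Complex (\int[lebesgue_tuple R d]_(x in @cube d) complex.Re (f x))
          (\int[lebesgue_tuple R d]_(x in @cube d) complex.Im (f x)).

Definition square_integrable d (f : pt d -> C) : Prop :=
  [/\ measurable_fun (@cube d) (fun x => complex.Re (f x)),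
      measurable_fun (@cube d) (fun x => complex.Im (f x)) &
      (\int[lebesgue_tuple R d]_(x in @cube d)
         ((normc (f x)) ^+ 2)%:E < +oo)%E].

Definition r1 (alpha g : R) (k : int) : R :=
  if k == 0 then 1 else (`|k|%N%:R `^ (2 * alpha)) / g.

(* Weights are sequences indexed from 0: [gamma j] is the weight of the
   coordinate j : 'I_d, i.e. gamma_(j+1) in one-based notation. *)
Definition r (alpha : R) (gamma : nat -> R) d (k : 'I_d -> int) : R :=
  \prod_(j < d) r1 alpha (gamma j) (k j).

Definition phi d (k : {ffun 'I_d -> nat}) (x : pt d) : R :=
  Num.sqrt 2 ^+ #|[pred j | k j != 0%N]| * \prod_(j < d) cos (pi * (k j)%:R * tnth x j).

Definition cos_coef d (f : pt d -> C) (k : {ffun 'I_d -> nat}) : C :=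
  cint (fun x => f x * (phi k x)%:C%C).

Definition expi (t : R) : C := Complex (cos t) (sin t).

Definition dot d (h : {ffun 'I_d -> int}) (x : pt d) : R :=
  \sum_(j < d) (h j)%:~R * tnth x j.

Definition fourier_coef d (f : pt d -> C) (h : {ffun 'I_d -> int}) : C :=
  cint (fun x => f x * expi (- (2 * pi * dot h x))).

Definition cos_sqnorm alpha gamma d (f : pt d -> C) : \bar R :=
  \esum_(k in [set: {ffun 'I_d -> nat}])
    (normc (cos_coef f k) ^+ 2
     * r alpha gamma (fun j => (k j)%:Z))%:E.

Definition korobov_sqnorm alpha gamma d (f : pt d -> C) : \bar R :=
  \esum_(h in [set: {ffun 'I_d -> int}])
    (normc (fourier_coef f h) ^+ 2 * r alpha gamma h)%:E.

(* Partial sums over {0, ..., N-1}^d, resp. {-N, ..., N}^d. For f of finite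
   norm and alpha > 1/2 the full series converge absolutely, so that the order
   of summation is immaterial. *)
Definition cos_psum d (f : pt d -> C) (N : nat) (x : pt d) : C :=
  \sum_(k : {ffun 'I_d -> 'I_N})
    let k' := [ffun j => k j : nat] in cos_coef f k' * (phi k' x)%:C%C.

Definition fourier_psum d (f : pt d -> C) (N : nat) (x : pt d) : C :=
  \sum_(h : {ffun 'I_d -> 'I_(2 * N).+1})
    let h' := [ffun j => (h j : nat)%:Z - N%:Z] in
    fourier_coef f h' * expi (2 * pi * dot h' x).

(* The elements of the spaces are the continuous representatives, i.e. the
   functions which coincide with their series at every point of the cube;
   values outside of the cube are irrelevant. *)
Record fun_space d := FunSpace {
  space_mem : (pt d -> C) -> Prop;
  space_norm : (pt d -> C) -> R }.

Definition cosine_space alpha gamma d : fun_space d := {|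
  space_mem := fun f => [/\ square_integrable f,
    (cos_sqnorm alpha gamma f < +oo)%E &
    forall x, cube x ->
      (fun N => normc (f x - cos_psum f N x)) @ \oo --> (0 : R)];
  space_norm := fun f => Num.sqrt (fine (cos_sqnorm alpha gamma f)) |}.

Definition korobov_space alpha gamma d : fun_space d := {|
  space_mem := fun f => [/\ square_integrable f,
    (korobov_sqnorm alpha gamma f < +oo)%E &
    forall x, cube x ->
      (fun N => normc (f x - fourier_psum f N x)) @ \oo --> (0 : R)];
  space_norm := fun f => Num.sqrt (fine (korobov_sqnorm alpha gamma f)) |}.

Definition wce d (H : fun_space d) (Q : (pt d -> C) -> C) : \bar R :=
  ereal_sup [set (normc (cint f - Q f))%:E |
             f in [set f | space_mem H f /\ space_norm H f <= 1]].

Definition frac_part (x : R) : R := x - (Num.floor x)%:~R.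

(* Generating vectors are given as sequences, of which a rule in dimension d
   uses the first d terms. *)
Definition lattice_point d (n : nat) (z : nat -> nat) (i : nat) : pt d :=
  [tuple frac_part ((i * z j)%N%:R / n%:R) | j < d].

Definition lattice_rule d n (z : nat -> nat) (f : pt d -> C) : C :=
  n%:R^-1 * \sum_(1 <= i < n.+1) f (lattice_point d n z i).

Definition tent1 (x : R) : R := 1 - `|2 * x - 1|.

Definition tent d (x : pt d) : pt d := [tuple tent1 (tnth x j) | j < d].

Definition tent_lattice_rule d n (z : nat -> nat) (f : pt d -> C) : C :=
  lattice_rule n z (f \o @tent d).

Definition linear_rule d n (w : 'I_n -> C) (x : 'I_n -> pt d) (f : pt d -> C) : C :=
  \sum_(i < n) w i * f (x i).

Definition zeta (x : R) : R := limn (series (fun k => k.+1%:R `^ (- x))).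

Definition admissible_weights (gamma : nat -> R) : Prop :=
  [/\ gamma 0%N <= 1, forall j, gamma j.+1 <= gamma j & forall j, 0 < gamma j].

Definition cbc_criterion alpha gamma n s (z : nat -> nat) : \bar R :=
  (wce (korobov_space alpha gamma s) (lattice_rule n z) ^+ 2)%E.

Definition is_cbc alpha gamma n d (z : nat -> nat) : Prop :=
  forall s, (s < d)%N -> (0 < z s < n)%N /\
    forall c, (0 < c < n)%N ->
      (cbc_criterion alpha gamma n s.+1 z <=
       cbc_criterion alpha gamma n s.+1 (fun j => if j == s then c else z j))%E.

(* 1 + g * korobov_kernel alpha (x - y) is the reproducing kernel of the
   one-dimensional Korobov space with weight g, that is,
   korobov_kernel alpha x = \sum_(h <> 0) exp(2 pi i h x) / |h|^(2 alpha). *)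
Definition korobov_kernel (alpha x : R) : R :=
  limn (series (fun h => 2 * cos (2 * pi * h.+1%:R * x) / h.+1%:R `^ (2 * alpha))).

End spaces.

(* The cost model: a real RAM with unit-cost operations, programmed in a
   structured language. The memory consists of arrays of natural numbers and
   arrays of real numbers, both kinds being named by natural numbers; a program
   is a single finite piece of syntax, uniform in all inputs. Its only real
   constants are pi and the natural numbers, and reals act on the control flow
   only through comparisons; the elementary operations on them include cos, sin
   and one unary function K, which will be the one-dimensional Korobov kernel.
   The only loops are counted loops. *)
Inductive iexp :=
| ICst of nat
| IGet of nat & iexp
| IAdd of iexp & iexp
| ISub of iexp & iexp
| IMul of iexp & iexp
| IDiv of iexp & iexp
| IMod of iexp & iexp.

Inductive rexp :=
| RGet of nat & iexp
| RNat of iexp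
| RPi
| RAdd of rexp & rexp
| RSub of rexp & rexp
| RMul of rexp & rexp
| RDiv of rexp & rexp
| RCos of rexp
| RSin of rexp
| RKer of rexp.

Inductive bexp :=
| ILt of iexp & iexp
| RLt of rexp & rexp.

(* [For a e c] evaluates e once, to N, then runs c for cell 0 of the integer
   array a successively set to 0, ..., N-1. *)
Inductive cmd :=
| Skip
| ISet of nat & iexp & iexp
| RSet of nat & iexp & rexp
| Seq of cmd & cmd
| If of bexp & cmd & cmd
| For of nat & iexp & cmd.

Section semantics.
Context (R : realType) (K : R -> R).

Record memory := Memory {
  imem : nat -> nat -> nat;
  rmem : nat -> nat -> R }.

Definition upd (T : Type) (m : nat -> nat -> T) (a i : nat) (v : T) :=
  fun b j => if (b == a) && (j == i) then v else m b j.

Definition iset (s : memory) a i v := Memory (upd (imem s) a i v) (rmem s).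
Definition rset (s : memory) a i v := Memory (imem s) (upd (rmem s) a i v).

Fixpoint ieval (s : memory) (e : iexp) : nat :=
  match e with
  | ICst k => k
  | IGet a e1 => imem s a (ieval s e1)
  | IAdd e1 e2 => ieval s e1 + ieval s e2
  | ISub e1 e2 => ieval s e1 - ieval s e2
  | IMul e1 e2 => ieval s e1 * ieval s e2
  | IDiv e1 e2 => ieval s e1 %/ ieval s e2
  | IMod e1 e2 => ieval s e1 %% ieval s e2
  end%N.

Fixpoint reval (s : memory) (e : rexp) : R :=
  match e with
  | RGet a e1 => rmem s a (ieval s e1)
  | RNat e1 => (ieval s e1)%:R
  | RPi => pi
  | RAdd e1 e2 => reval s e1 + reval s e2
  | RSub e1 e2 => reval s e1 - reval s e2
  | RMul e1 e2 => reval s e1 * reval s e2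
  | RDiv e1 e2 => reval s e1 / reval s e2
  | RCos e1 => cos (reval s e1)
  | RSin e1 => sin (reval s e1)
  | RKer e1 => K (reval s e1)
  end.

Definition beval (s : memory) (b : bexp) : bool :=
  match b with
  | ILt e1 e2 => (ieval s e1 < ieval s e2)%N
  | RLt e1 e2 => reval s e1 < reval s e2
  end.

Fixpoint run (c : cmd) (s : memory) : memory :=
  match c with
  | Skip => s
  | ISet a i e => iset s a (ieval s i) (ieval s e)
  | RSet a i e => rset s a (ieval s i) (reval s e)
  | Seq c1 c2 => run c2 (run c1 s)
  | If b c1 c2 => if beval s b then run c1 s else run c2 s
  | For a e c1 => iteri (ieval s e) (fun k t => run c1 (iset t a 0 k)) s
  end.

Fixpoint icost (e : iexp) : nat :=
  match e with
  | ICst _ => 1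
  | IGet _ e1 => (icost e1).+1
  | IAdd e1 e2 | ISub e1 e2 | IMul e1 e2 | IDiv e1 e2 | IMod e1 e2 =>
      (icost e1 + icost e2).+1
  end%N.

Fixpoint rcost (e : rexp) : nat :=
  match e with
  | RGet _ e1 => (icost e1).+1
  | RNat e1 => (icost e1).+1
  | RPi => 1
  | RAdd e1 e2 | RSub e1 e2 | RMul e1 e2 | RDiv e1 e2 =>
      (rcost e1 + rcost e2).+1
  | RCos e1 | RSin e1 | RKer e1 => (rcost e1).+1
  end%N.

Definition bcost (b : bexp) : nat :=
  match b with
  | ILt e1 e2 => (icost e1 + icost e2).+1
  | RLt e1 e2 => (rcost e1 + rcost e2).+1
  end%N.

(* Number of elementary operations performed by [run c s]; each iteration of a
   loop costs one operation on top of those of its body. *)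
Fixpoint cost (c : cmd) (s : memory) : nat :=
  match c with
  | Skip => 1
  | ISet _ i e => (icost i + icost e).+1
  | RSet _ i e => (icost i + rcost e).+1
  | Seq c1 c2 => cost c1 s + cost c2 (run c1 s)
  | If b c1 c2 => bcost b + (if beval s b then cost c1 s else cost c2 s)
  | For a e c1 => (icost e).+1 +
      \sum_(k < ieval s e)
        (cost c1 (iset (iteri k (fun l t => run c1 (iset t a 0 l)) s) a 0 k)).+1
  end%N.

End semantics.

(* Inputs: d and n in cells 0 and 1 of the integer array 0, and the first d
   weights in the real array 0; all other cells hold 0. The smoothness alpha is
   passed through the primitive K. Output: the integer array 1. *)
Section cbc_program.
Context (R : realType).

Definition cbc_input (gamma : nat -> R) (d n : nat) : memory R := {|
  imem := fun a i => (if a == 0 then if i == 0 then d else if i == 1 then n else 0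
                      else 0)%N;
  rmem := fun a j => if (a == 0%N) && (j < d)%N then gamma j else 0 |}.

Definition cbc_output (p : cmd) (alpha : R) gamma (n d : nat) : nat -> nat :=
  imem (run (korobov_kernel alpha) p (cbc_input gamma d n)) 1.

Definition cbc_cost (p : cmd) (alpha : R) gamma (n d : nat) : nat :=
  cost (korobov_kernel alpha) p (cbc_input gamma d n).

End cbc_program.

(* Main.v *)
(* Let S(z) be the sum of 1/r(h) over the non-zero h with h.z = 0 mod n. By
   Cauchy-Schwarz, with near-extremal functions sum_h e_h / r(h) over boxes, S(z)
   is the squared error of the lattice rule in the Korobov space, and
   1 + S(z) = n^-1 sum_i prod_j (1 + gamma_j K(i z_j / n)). The tent transform
   turns the cosine phi_k into the sum of the characters e_h, |h_j| = k_j, up to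
   normalization, and Cauchy-Schwarz gives the bound S(z) in the cosine space too.

   The increment of S when z_s is appended, once raised to the power lambda, has
   over z_s = 1, ..., n-1 an average at most that of the asserted bound, since
   (sum a)^lambda <= sum a^lambda; the minimizer does at least as well.

   For a primitive root g mod n, that increment at z_s = g^b is, up to constants,
   the correlation sum_a P(g^a) K(g^(a+b) / n), which two FFTs of length O(n)
   produce for all b at once. A primitive root is found in O(n log n) operations
   by traversing the cyclic subgroups.

   For the optimality, the trigonometric polynomials of degree less than 4n in
   the first variable contain a non-negative one that vanishes at the n nodes,
   has integral at least n, and has norm O(n^(1 + alpha)) in the cosine space. *)
Require Import Defs.
From HB Require Import structures.
From mathcomp Require Import all_boot all_order all_algebra fingroup cyclic.
From mathcomp Require Import all_classical all_reals all_analysis.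
From mathcomp Require Import measurable_realfun ring lra zify.

Set Implicit Arguments.
Unset Strict Implicit.
Unset Printing Implicit Defensive.

Import Order.TTheory GRing.Theory Num.Theory.
Import numFieldNormedType.Exports.
Local Open Scope classical_set_scope.
Local Open Scope ring_scope.

Local Notation normc := ComplexField.Normc.normc.

(** * Trigonometric sums and elementary inequalities *)

(** No infinite sum over Z^d is manipulated directly. On a box {-N, ..., N}^d the sum over the dual
    lattice is, by character orthogonality, an average over the nodes of products of one-dimensional
    kernel sums; [dual_sum] is the limit of this finite identity. Positivity, the power lambda and
    Cauchy-Schwarz are handled on boxes and carried to the limit, whereas comparisons between
    candidates use the closed form. The pointwise convergence built into the spaces allows f to be
    replaced by its partial sums at the finitely many nodes.

    The divisor n - 1 is the number of candidates: the value z_s = 0 is excluded, and its share is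
    subtracted from the sum over all residues.

    With counted loops only, a search runs for a number of rounds fixed in advance and idles after
    its success; in return costs can be bounded without following the data. The FFT length is a
    power of two that is at least 2n rather than n - 1, so that zero-padding rules out wrap-around.

    In the lower bound, twice as many cosines as nodes leave a projection of trace at least n; the
    values of its quadratic form stay below 4n, so Parseval and the largest frequency control the
    norm. *)

Section expi_theory.
Context {R : realType}.
Implicit Types (t x y : R) (n : nat) (k : int).

Lemma expi0 : expi 0 = 1 :> R[i].
Proof. by rewrite /expi cos0 sin0. Qed.

Lemma expiD x y : expi (x + y) = expi x * expi y.
Proof.
by apply/eqP; rewrite eq_complex /= cosD sinD addrC eqxx addrC mulrC addrC eqxx.
Qed.

Lemma expiN x : expi (- x) = conjc (expi x).
Proof. by rewrite /expi cosN sinN. Qed.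

Lemma expi_sum (I : Type) (r : seq I) (P : pred I) (F : I -> R) :
  expi (\sum_(i <- r | P i) F i) = \prod_(i <- r | P i) expi (F i).
Proof. by apply: big_morph; [exact: expiD | exact: expi0]. Qed.

Lemma expiX x n : expi x ^+ n = expi (n%:R * x).
Proof.
elim: n => [|n IH]; first by rewrite mul0r expi0.
by rewrite exprS IH -expiD -{1}(mul1r x) -mulrDl -natr1 addrC.
Qed.

Lemma expi2pi : expi (2 * pi) = 1 :> R[i].
Proof. by rewrite /expi mulr_natl cos2pi sin2pi. Qed.

Lemma expi_2pi_int k : expi (2 * pi * k%:~R) = 1 :> R[i].
Proof.
case: k => k; first by rewrite mulrC pmulrn -expiX expi2pi expr1n.
by rewrite NegzE mulrC mulrNz mulNr expiN pmulrn -expiX expi2pi expr1n rmorph1.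
Qed.

Lemma expi_2piD_int x k : expi (2 * pi * (x + k%:~R)) = expi (2 * pi * x).
Proof. by rewrite mulrDr expiD expi_2pi_int mulr1. Qed.

Lemma expi_neq1 x : 0 < x < 1 -> expi (2 * pi * x) != 1.
Proof.
move=> /andP[x0 x1]; apply/eqP => -[+ _].
have -> : 2 * pi * x = (pi * x) *+ 2 by rewrite -mulrA mulr_natl.
rewrite cos_mulr2n cos2sin2 => h.
have : 0 < sin (pi * x).
  by apply: sin_gt0_pi; rewrite mulr_gt0 ?pi_gt0// gtr_pMr ?pi_gt0.
move=> s0; have := mulr_gt0 s0 s0; rewrite -expr2.
by move: h; lra.
Qed.

Lemma expi_intr_div_neq1 n k : (0 < n)%N -> ~~ (n%:Z %| k)%Z ->
  expi (2 * pi * (k%:~R / n%:R)) != 1 :> R[i].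
Proof.
move=> n0 nk; rewrite (divz_eq k n%:Z) intrD [(_ + _) / _]mulrDl intrM -pmulrn.
rewrite mulfK ?pnatr_eq0 -?lt0n// addrC expi_2piD_int; apply: expi_neq1.
have n0Z : n%:Z != 0 by rewrite eqz_nat -lt0n.
have := modz_ge0 k n0Z; rewrite le_eqVlt => /orP[/eqP h|h].
  by case/negP: nk; apply/dvdz_mod0P; rewrite -h.
rewrite divr_gt0 ?ltr0n ?ltr0z//= ltr_pdivrMr ?ltr0n// mul1r.
by rewrite [n%:R]pmulrn ltr_int ltz_pmod// ltz_nat.
Qed.

Lemma sum_expi_div n k : (0 < n)%N ->
  \sum_(i < n) expi (2 * pi * (k%:~R * i%:R / n%:R)) =
    (if (n%:Z %| k)%Z then n%:R else 0) :> R[i].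
Proof.
move=> n0; pose w : R[i] := expi (2 * pi * (k%:~R / n%:R)).
have wE i : expi (2 * pi * (k%:~R * i%:R / n%:R)) = w ^+ i.
  by rewrite /w expiX; congr expi; ring.
rewrite (eq_bigr (fun i : 'I_n => w ^+ i)) => [|i _]; last exact: wE.
have wn : w ^+ n = 1.
  by rewrite -wE mulfK ?pnatr_eq0 -?lt0n// expi_2pi_int.
case: ifPn => [/dvdzP[q kE] | nk].
  rewrite (eq_bigr (fun=> 1)) ?sumr_const ?card_ord// => i _.
  rewrite /w kE intrM -pmulrn mulfK ?pnatr_eq0 -?lt0n//.
  by rewrite expi_2pi_int expr1n.
have := subrX1 w n; rewrite wn subrr => /esym/eqP.
by rewrite mulf_eq0 subr_eq0 (negbTE (expi_intr_div_neq1 n0 nk)) => /eqP.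
Qed.

End expi_theory.

Lemma Re_sum (R : realType) (I : Type) (r : seq I) (P : pred I) (F : I -> R[i]) :
  complex.Re (\sum_(i <- r | P i) F i) = \sum_(i <- r | P i) complex.Re (F i).
Proof. by apply: (big_morph (@complex.Re R)) => // -[a b] [c d]. Qed.

(** Lattice rules run over i = 1, ..., n, character sums over i = 0, ..., n - 1; periodicity
    identifies the two end terms. *)
Lemma sum_shift_periodic (V : zmodType) (G : nat -> V) n : G n = G 0%N ->
  \sum_(1 <= i < n.+1) G i = \sum_(i < n) G i.
Proof.
move=> Gn; rewrite big_add1 /= big_mkord.
case: n Gn => [|n] Gn; first by rewrite !big_ord0.
by rewrite big_ord_recr /= Gn big_ord_recl addrC.
Qed.

(** Frequencies are coded as ordinals shifted by N; pairing k with -k is what turns exponentials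
    into cosines. *)
Lemma sum_ord_sym (V : zmodType) (F : int -> V) N :
  \sum_(h < (2 * N).+1) F ((h : nat)%:Z - N%:Z) =
  F 0 + \sum_(k < N) (F k.+1%:Z + F (- k.+1%:Z)).
Proof.
rewrite -(big_mkord xpredT (fun h => F (h%:Z - N%:Z))).
rewrite (@big_cat_nat _ _ _ N) //=; last by lia.
rewrite [X in _ + X]big_ltn; last by lia.
rewrite subrr addrCA; congr (_ + _); rewrite big_split /= addrC; congr (_ + _).
  rewrite -{1}[N.+1]add0n big_addn (_ : (_ - _ = N)%N); last by lia.
  by rewrite big_mkord; apply: eq_bigr => i _; congr F; lia.
rewrite big_nat_rev /= big_mkord; apply: eq_bigr => i _; congr F.
by have := ltn_ord i; lia.
Qed.

Section inequalities.
Context {R : realType}.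

Lemma cauchy_schwarz (I : finType) (P : pred I) (a b : I -> R) :
  (\sum_(i | P i) a i * b i) ^+ 2 <=
  (\sum_(i | P i) a i ^+ 2) * (\sum_(i | P i) b i ^+ 2).
Proof.
set A := \sum_(i | P i) a i ^+ 2; set B := \sum_(i | P i) b i ^+ 2.
set S := \sum_(i | P i) a i * b i.
have A0 : 0 <= A by apply: sumr_ge0 => i _; exact: sqr_ge0.
have Q t : 0 <= A * t ^+ 2 + 2 * S * t + B.
  rewrite (_ : _ + _ = \sum_(i | P i) (a i * t + b i) ^+ 2).
    by apply: sumr_ge0 => i _; exact: sqr_ge0.
  rewrite /A /B /S mulr_suml mulr_sumr mulr_suml -!big_split /=.
  by apply: eq_bigr => i _; ring.
move: A0; rewrite le_eqVlt => /orP[/eqP/esym A0|A0].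
  rewrite A0 mul0r; suff -> : S = 0 by rewrite expr0n.
  rewrite /S big1// => i Pi.
  move: A0 => /eqP; rewrite /A.
  rewrite psumr_eq0 => [/allP/(_ i)|j _]; last exact: sqr_ge0.
  by rewrite mem_index_enum Pi /= sqrf_eq0 => /(_ isT)/eqP ->; rewrite mul0r.
(* The non-negative quadratic polynomial is evaluated at its vertex. *)
have := Q (- S / A).
have -> : A * (- S / A) ^+ 2 + 2 * S * (- S / A) + B = B - S ^+ 2 / A.
  by field; rewrite gt_eqF.
by rewrite subr_ge0 ler_pdivrMr// mulrC.
Qed.

(** A number u of [0, 1] satisfies u <= u^l; this is applied to x / (x + y) and y / (x + y), whose
    sum is 1. *)
Lemma powRD_le (x y l : R) : 0 <= x -> 0 <= y -> 0 < l -> l <= 1 ->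
  (x + y) `^ l <= x `^ l + y `^ l.
Proof.
move=> x0 y0 l0 l1.
have [s0|] := ltP 0 (x + y); last first.
  move=> s0; have -> : x + y = 0 by lra.
  by rewrite powR0 ?gt_eqF// addr_ge0 ?powR_ge0.
have H z : 0 <= z -> z <= x + y -> z / (x + y) * (x + y) `^ l <= z `^ l.
  move=> z0 zs; have [z00|zp] := eqVneq z 0.
    by rewrite z00 !mul0r powR_ge0.
  have zp0 : 0 < z by rewrite lt_def zp.
  have zE : z = z / (x + y) * (x + y) by rewrite divfK// gt_eqF.
  rewrite {2}zE powRM ?divr_ge0 ?(ltW s0)//.
  rewrite ler_wpM2r ?powR_ge0// ger1_powR//.
  by rewrite divr_gt0//= ler_pdivrMr// mul1r.
have := lerD (H x x0 _) (H y y0 _).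
rewrite -!mulrDl divff ?gt_eqF// mul1r; apply; lra.
Qed.

Lemma powR_sum_le (I : Type) (r : seq I) (P : pred I) (a : I -> R) l :
  (forall i, P i -> 0 <= a i) -> 0 < l -> l <= 1 ->
  (\sum_(i <- r | P i) a i) `^ l <= \sum_(i <- r | P i) a i `^ l.
Proof.
move=> a0 l0 l1.
suff : 0 <= \sum_(i <- r | P i) a i /\
  (\sum_(i <- r | P i) a i) `^ l <= \sum_(i <- r | P i) a i `^ l by case.
elim/big_rec2 : _ => [|i x y Pi [y0 yx]]; first by rewrite powR0 ?gt_eqF.
split; first by rewrite addr_ge0// a0.
by rewrite (le_trans (powRD_le (a0 i Pi) y0 l0 l1))// lerD.
Qed.

End inequalities.

(** * Sums over the dual lattice and the component-by-component bound *)

Section kernel.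
Context {R : realType}.
Implicit Types (alpha a x : R) (n N : nat).

(** Condensation: the terms of index 2m and 2m + 1 are both at most (2m)^-a, together 2^(1 - a)
    m^-a. Hence f(N) <= f(2N + 1) <= 1 + 2^(1 - a) f(N), which is solved for f(N). *)
Lemma sum_powRN_le a N : 1 < a ->
  \sum_(k < N) k.+1%:R `^ (- a) <= (1 - 2 `^ (1 - a))^-1 :> R.
Proof.
move=> a1; pose f M : R := \sum_(k < M) k.+1%:R `^ (- a).
have q1 : 2 `^ (1 - a) < 1 :> R.
  rewrite /powR pnatr_eq0 /= expR_lt1 nmulr_rlt0 ?subr_lt0//.
  by rewrite ln_gt0// ltr1n.
have f0 k : 0 <= k.+1%:R `^ (- a) :> R by exact: powR_ge0.
have double M : f (2 * M).+1 <= 1 + 2 `^ (1 - a) * f M.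
  elim: M => [|M IH].
    by rewrite /f muln0 big_ord_recl !big_ord0 powR1 mulr0.
  rewrite (_ : (2 * M.+1).+1 = (2 * M).+3); last by lia.
  rewrite {1}/f 2!big_ord_recr /= -/(f _).
  rewrite [f M.+1]big_ord_recr /= -/(f M) mulrDr addrA -addrA lerD//.
  have -> : 2 `^ (1 - a) * M.+1%:R `^ (- a) =
            (2 * M).+2%:R `^ (- a) + (2 * M).+2%:R `^ (- a) :> R.
    have -> : (2 * M).+2%:R = 2 * M.+1%:R :> R by rewrite -natrM; congr _%:R; lia.
    by rewrite powRM// powRD ?pnatr_eq0 ?implybT// powRr1//; ring.
  rewrite lerD// 2!powRN lef_pV2 ?posrE ?powR_gt0// ge0_ler_powR//.
  - lra.
  - by rewrite nnegrE ler0n.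
  - by rewrite nnegrE ler0n.
  - by rewrite ler_nat.
have mono : f N <= f (2 * N).+1.
  rewrite /f (_ : (2 * N).+1 = N + N.+1)%N; last by lia.
  by rewrite big_split_ord /= lerDl sumr_ge0.
rewrite -/(f N) -[leRHS]div1r ler_pdivlMr ?subr_gt0//.
have := le_trans mono (double N); rewrite mulrBr mulr1 [f N * _]mulrC; lra.
Qed.

Lemma is_cvg_zeta a : 1 < a -> cvgn (series (fun k => k.+1%:R `^ (- a) : R)).
Proof.
move=> a1; apply: nondecreasing_is_cvgn.
  by apply: nondecreasing_series => k _ _; exact: powR_ge0.
exists (1 - 2 `^ (1 - a))^-1 => _ [N _ <-].
by rewrite /series /= big_mkord; exact: sum_powRN_le.
Qed.

Definition kernel_psum alpha x N : R :=
  \sum_(h < N) 2 * cos (2 * pi * h.+1%:R * x) / h.+1%:R `^ (2 * alpha).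

Lemma kernel_psum_cvg alpha x : 1 / 2 < alpha ->
  kernel_psum alpha x @ \oo --> korobov_kernel alpha x.
Proof.
move=> al; have a1 : 1 < 2 * alpha by lra.
rewrite (_ : kernel_psum alpha x =
  series (fun h => 2 * cos (2 * pi * h.+1%:R * x) / h.+1%:R `^ (2 * alpha))).
  2: by apply/funext => N; rewrite /series /kernel_psum /= big_mkord.
apply: normed_cvg.
apply: (@series_le_cvg _ _ (fun h => 2 * h.+1%:R `^ (- (2 * alpha)))).
- by move=> h; exact: normr_ge0.
- by move=> h; rewrite mulr_ge0 ?powR_ge0.
- move=> h /=; rewrite powRN normrM normfV (ger0_norm (powR_ge0 _ _)).
  rewrite ler_wpM2r ?invr_ge0 ?powR_ge0// normrM ger0_norm//.
  by rewrite ler_piMr// cos_max.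
- exact: (is_cvg_seriesZ (is_cvg_zeta a1)).
Qed.

Lemma korobov_kernelE0 alpha : 1 / 2 < alpha ->
  korobov_kernel alpha 0 = 2 * zeta (2 * alpha).
Proof.
move=> al; have a1 : 1 < 2 * alpha by lra.
rewrite /korobov_kernel /zeta -[RHS](lim_seriesZ (2 : R) (is_cvg_zeta a1)).
congr (limn (series _)); apply/funext => h.
by rewrite mulr0 cos0 mulr1 -powRN.
Qed.

Lemma korobov_kernelD_int alpha x (k : int) :
  korobov_kernel alpha (x + k%:~R) = korobov_kernel alpha x.
Proof.
rewrite /korobov_kernel; congr (limn (series _)); apply/funext => h.
congr (2 * _ / _); rewrite -!mulrA mulrDr [_ * k%:~R]mulrC.
rewrite -(intrM _ k h.+1%:Z) !(mulrA 2 pi).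
exact: (congr1 (@complex.Re R) (expi_2piD_int _ _)).
Qed.

Lemma korobov_kernel_modn alpha n i : (0 < n)%N ->
  korobov_kernel alpha ((i %% n)%:R / n%:R) = korobov_kernel alpha (i%:R / n%:R).
Proof.
move=> n0; rewrite [in RHS](divn_eq i n) natrD natrM mulrDl mulfK ?pnatr_eq0 -?lt0n//.
by rewrite addrC [(_ %/ _)%:R]pmulrn korobov_kernelD_int.
Qed.

Lemma r1_gt0 alpha (g : R) (k : int) : 0 < g -> 0 < r1 alpha g k.
Proof.
move=> g0; rewrite /r1; case: eqP => // /eqP k0.
by rewrite divr_gt0// powR_gt0// ltr0n absz_gt0.
Qed.

Lemma r1N alpha (g : R) (k : int) : r1 alpha g (- k) = r1 alpha g k.
Proof. by rewrite /r1 oppr_eq0 abszN. Qed.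

Lemma r1_powR alpha (g : R) (k : int) l : 0 < g ->
  r1 alpha g k `^ l = r1 (alpha * l) (g `^ l) k.
Proof.
move=> g0; rewrite /r1; case: ifP => _; first by rewrite powR1.
rewrite powRM ?powR_ge0 ?invr_ge0 ?ltW// -powRrM mulrA.
by rewrite -(powR_inv1 (ltW g0)) powRAC powR_inv1 ?powR_ge0.
Qed.

(** The flag [e] removes the frequency 0, whose term is 1; the pairs h, -h give the kernel. *)
Lemma kernel_psum_sum_expi alpha (g : R) x (e : bool) N : 0 < g ->
  \sum_(h < (2 * N).+1) (e ==> ((h : nat)%:Z - N%:Z != 0))%:R *
    (expi (2 * pi * (((h : nat)%:Z - N%:Z)%:~R * x)) /
      (r1 alpha g ((h : nat)%:Z - N%:Z))%:C%C) =
  ((~~ e)%:R + g * kernel_psum alpha x N)%:C%C.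
Proof.
move=> g0.
rewrite (sum_ord_sym (fun k : int => (e ==> (k != 0))%:R *
  (expi (2 * pi * (k%:~R * x)) / (r1 alpha g k)%:C%C))) rmorphD /=; congr (_ + _).
  rewrite mul0r mulr0 expi0 /r1 eqxx rmorph1 divr1 mulr1 implybF.
  by rewrite rmorph_nat.
rewrite /kernel_psum mulr_sumr rmorph_sum; apply: eq_bigr => k _.
rewrite r1N /= implybT !mul1r mulrNz mulNr mulrN expiN -mulrDl addcJ /=.
rewrite -(rmorph_nat (real_complex R) 2) -fmorphV -!rmorphM /=.
congr (_%:C%C); rewrite /r1 /= invf_div mulrC -!mulrA; congr (_ * _); rewrite mulrA.
by rewrite mulrC -pmulrn !mulrA.
Qed.

End kernel.

Section dual_lattice.
Context {R : realType}.
Implicit Types (alpha : R) (gamma : nat -> R) (z : nat -> nat) (n d N : nat).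

Definition box d N (h : {ffun 'I_d -> 'I_(2 * N).+1}) : {ffun 'I_d -> int} :=
  [ffun j => (h j : nat)%:Z - N%:Z].

Definition dual n z d (h : {ffun 'I_d -> int}) : bool :=
  (n%:Z %| (\sum_(j < d) h j * (z j)%:Z)%R)%Z.

Lemma sum_expi_dual n z d (h : {ffun 'I_d -> int}) : (0 < n)%N ->
  \sum_(i < n) expi (2 * pi * \sum_(j < d) (h j)%:~R * ((i * z j)%:R / n%:R)) =
  (dual n z h)%:R * n%:R :> R[i].
Proof.
move=> n0; transitivity (\sum_(i < n)
    expi (2 * pi * ((\sum_(j < d) h j * (z j)%:Z)%:~R * i%:R / n%:R)) : R[i]).
  apply: eq_bigr => i _; congr (expi (_ * _)).
  rewrite rmorph_sum !mulr_suml; apply: eq_bigr => j _.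
  by rewrite rmorphM natrM /= -pmulrn; ring.
by rewrite sum_expi_div// /dual; case: ifP; rewrite ?mul1r ?mul0r.
Qed.

(* The coordinates in [e] are required to be non-zero: [e = pred0] gives the
   whole dual lattice, [e = pred1 d] the terms which appear when z_d is
   appended to (z_0, ..., z_(d-1)). *)
Definition dual_psum alpha gamma n z d (e : nat -> bool) N : R :=
  \sum_(h : {ffun 'I_d -> 'I_(2 * N).+1})
    (dual n z (box h))%:R *
    \prod_(j < d) ((e j ==> (box h j != 0))%:R / r1 alpha (gamma j) (box h j)).

(** A finite expression for the limit of [dual_psum]: averaging over the nodes detects the dual
    lattice, and the sum over h factors over the coordinates. A coordinate in [e] lacks the 1
    contributed by the frequency 0. *)
Definition dual_sum alpha gamma n z d (e : nat -> bool) : R :=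
  n%:R^-1 * \sum_(i < n) \prod_(j < d)
    ((~~ e j)%:R + gamma j * korobov_kernel alpha ((i * z j)%:R / n%:R)).

Lemma dual_psumE alpha gamma n z d e N : (0 < n)%N -> (forall j, 0 < gamma j) ->
  dual_psum alpha gamma n z d e N =
  n%:R^-1 * \sum_(i < n) \prod_(j < d)
    ((~~ e j)%:R + gamma j * kernel_psum alpha ((i * z j)%:R / n%:R) N).
Proof.
move=> n0 g0; apply: complexI; rewrite rmorphM fmorphV rmorph_sum rmorph_nat /=.
pose c (h : {ffun 'I_d -> 'I_(2 * N).+1}) : R := \prod_(j < d)
  ((e j ==> (box h j != 0))%:R / r1 alpha (gamma j) (box h j)).
have nC : n%:R != 0 :> R[i] by rewrite pnatr_eq0 -lt0n.
transitivity (n%:R^-1 * \sum_(i < n) \sum_(h : {ffun 'I_d -> 'I_(2 * N).+1})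
    (c h)%:C%C * expi (2 * pi * \sum_(j < d) (box h j)%:~R * ((i * z j)%:R / n%:R))).
  rewrite exchange_big /= mulr_sumr; apply: eq_bigr => h _ /=.
  rewrite -mulr_sumr sum_expi_dual// rmorphM rmorph_nat /= -/(c h).
  by rewrite [(_)%:R * n%:R]mulrC !mulrA [_ * _ * n%:R]mulrAC mulVf// mul1r mulrC.
rewrite rmorph_sum; congr (_ * _); apply: eq_bigr => i _.
rewrite rmorph_prod /=.
rewrite [RHS](eq_bigr (fun j : 'I_d => \sum_(h < (2 * N).+1)
   (e j ==> ((h : nat)%:Z - N%:Z != 0))%:R *
    (expi (2 * pi * (((h : nat)%:Z - N%:Z)%:~R * ((i * z j)%:R / n%:R))) /
      (r1 alpha (gamma j) ((h : nat)%:Z - N%:Z))%:C%C))) => [|j _]; last first.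
  by rewrite kernel_psum_sum_expi.
rewrite bigA_distr_bigA /=; apply: eq_bigr => h _.
rewrite mulr_sumr expi_sum /c rmorph_prod -big_split /=; apply: eq_bigr => j _.
by rewrite /box ffunE rmorphM rmorph_nat fmorphV /=; ring.
Qed.

Lemma cvg_sum_fin (I : Type) (r : seq I) (F : I -> nat -> R) (l : I -> R) :
  (forall i, F i @ \oo --> l i) ->
  (fun N => \sum_(i <- r) F i N) @ \oo --> \sum_(i <- r) l i.
Proof.
move=> Fl; elim: r => [|i r IH].
  rewrite big_nil (_ : (fun _ => _) = fun=> 0); first exact: cvg_cst.
  by apply/funext => N; rewrite big_nil.
rewrite big_cons (_ : (fun _ => _) = fun N => F i N + \sum_(j <- r) F j N).
  exact: cvgD.
by apply/funext => N; rewrite big_cons.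
Qed.

Lemma cvg_prod_fin (I : Type) (r : seq I) (F : I -> nat -> R) (l : I -> R) :
  (forall i, F i @ \oo --> l i) ->
  (fun N => \prod_(i <- r) F i N) @ \oo --> \prod_(i <- r) l i.
Proof.
move=> Fl; elim: r => [|i r IH].
  rewrite big_nil (_ : (fun _ => _) = fun=> 1); first exact: cvg_cst.
  by apply/funext => N; rewrite big_nil.
rewrite big_cons (_ : (fun _ => _) = fun N => F i N * \prod_(j <- r) F j N).
  exact: cvgM.
by apply/funext => N; rewrite big_cons.
Qed.

Lemma dual_psum_cvg alpha gamma n z d e : 1 / 2 < alpha -> (0 < n)%N ->
  (forall j, 0 < gamma j) ->
  dual_psum alpha gamma n z d e @ \oo --> dual_sum alpha gamma n z d e.
Proof.
move=> al n0 g0; rewrite (_ : dual_psum _ _ _ _ _ _ = fun N => n%:R^-1 *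
    \sum_(i < n) \prod_(j < d)
      ((~~ e j)%:R + gamma j * kernel_psum alpha ((i * z j)%:R / n%:R) N)).
  2: by apply/funext => N; rewrite dual_psumE.
apply: cvgZr; apply: cvg_sum_fin => i; apply: cvg_prod_fin => j.
by apply: cvgD; [exact: cvg_cst | apply: cvgZr; exact: kernel_psum_cvg].
Qed.

Lemma dual_psum_ge0 alpha gamma n z d e N : (forall j, 0 < gamma j) ->
  0 <= dual_psum alpha gamma n z d e N.
Proof.
move=> g0; apply: sumr_ge0 => h _; rewrite mulr_ge0//.
by apply: prodr_ge0 => j _; rewrite divr_ge0// ltW// r1_gt0.
Qed.

(** Kernel values can be negative, so the sign is visible on the partial sums and not on the closed
    form. *)
Lemma dual_sum_ge0 alpha gamma n z d e : 1 / 2 < alpha -> (0 < n)%N ->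
  (forall j, 0 < gamma j) -> 0 <= dual_sum alpha gamma n z d e.
Proof.
move=> al n0 g0; have cs := dual_psum_cvg (z := z) (d := d) (e := e) al n0 g0.
rewrite -(cvg_lim (@Rhausdorff R) cs); apply: limr_ge; first exact: cvgP cs.
by apply: nearW => N; exact: dual_psum_ge0.
Qed.

Lemma dual_psum_powR alpha gamma n z d e N l : (forall j, 0 < gamma j) ->
  0 < l -> l <= 1 ->
  dual_psum alpha gamma n z d e N `^ l <=
  dual_psum (alpha * l) (fun j => gamma j `^ l) n z d e N.
Proof.
move=> g0 l0 l1; rewrite /dual_psum; apply: le_trans (powR_sum_le _ _ l0 l1) _.
  move=> h _; rewrite mulr_ge0//.
  by apply: prodr_ge0 => j _; rewrite divr_ge0// ltW// r1_gt0.
apply: ler_sum => h _.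
have nat_pow (b : bool) : b%:R `^ l = b%:R :> R.
  by case: b; rewrite ?powR1 ?powR0 ?gt_eqF.
have prod_pow (I : finType) (F : I -> R) : (forall i, 0 <= F i) ->
    (\prod_i F i) `^ l = \prod_i F i `^ l.
  move=> F0; suff : 0 <= \prod_i F i /\ (\prod_i F i) `^ l = \prod_i F i `^ l by case.
  elim/big_rec2 : _ => [|i x y _ [y0 yx]]; first by rewrite powR1.
  by rewrite mulr_ge0// powRM// yx.
have term0 (j : 'I_d) : 0 <= (e j ==> (box h j != 0))%:R / r1 alpha (gamma j) (box h j).
  by rewrite divr_ge0// ltW// r1_gt0.
rewrite powRM ?prodr_ge0// nat_pow prod_pow//.
rewrite le_eqVlt; apply/orP; left; apply/eqP; congr (_ * _).
apply: eq_bigr => j _.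
have r0 := ltW (r1_gt0 alpha (box h j) (g0 j)).
rewrite (powRM _ (ler0n _ _)) ?invr_ge0// (nat_pow (_ ==> _)).
rewrite -r1_powR// -(powR_inv1 (ltW (r1_gt0 _ _ (g0 j)))) powRAC.
by rewrite powR_inv1 ?powR_ge0.
Qed.

Lemma powR_continuous_gt0 (a l : R) : 0 < a -> {for a, continuous (fun x => x `^ l)}.
Proof.
move=> a0; apply: differentiable_continuous; apply/derivable1_diffP.
by apply: derivable_powR; rewrite in_itv /= a0.
Qed.

(* Jensen's inequality (sum a)^l <= sum a^l for l <= 1 raises every term 1/r to
   the power l, which amounts to changing the parameters of r. *)
Lemma dual_sum_powR alpha gamma n z d e l : 1 / (2 * alpha) < l -> l <= 1 ->
  1 / 2 < alpha -> (0 < n)%N -> (forall j, 0 < gamma j) ->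
  dual_sum alpha gamma n z d e `^ l <=
  dual_sum (alpha * l) (fun j => gamma j `^ l) n z d e.
Proof.
move=> l0 l1 al n0 g0.
have al2 : 1 / 2 < alpha * l.
  by move: l0; rewrite !ltr_pdivrMr; [nra | lra | lra].
have gl j : 0 < gamma j `^ l by exact: powR_gt0.
have lp : 0 < l by apply: lt_trans l0; rewrite divr_gt0//; lra.
have /= := dual_sum_ge0 z d e al n0 g0.
(* The limit passes through the power by continuity at a positive argument; a vanishing sum is
   treated apart. *)
rewrite le_eqVlt => /orP[/eqP <-|s0].
  by rewrite powR0 ?gt_eqF// dual_sum_ge0.
have cl := dual_psum_cvg (z := z) (d := d) (e := e) al2 n0 gl.
have cs := dual_psum_cvg (z := z) (d := d) (e := e) al n0 g0.
have cp : (fun N => dual_psum alpha gamma n z d e N `^ l) @ \oo -->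
    dual_sum alpha gamma n z d e `^ l.
  exact: (continuous_cvg _ (powR_continuous_gt0 s0) cs).
rewrite -(cvg_lim (@Rhausdorff R) cl) -(cvg_lim (@Rhausdorff R) cp).
apply: ler_lim.
- by apply: cvgP cp.
- by apply: cvgP cl.
- by apply: nearW => N /=; exact: dual_psum_powR.
Qed.

End dual_lattice.

(** * Averaging over the candidates for a component *)

Section cbc_bound.
Context {R : realType}.
Implicit Types (alpha : R) (gamma : nat -> R) (z : nat -> nat) (n d N : nat).

Lemma sum_kernel_psum_div alpha n N : (0 < n)%N ->
  \sum_(c < n) kernel_psum alpha (c%:R / n%:R) N =
  \sum_(h < N) 2 * ((n %| h.+1)%:R * n%:R / h.+1%:R `^ (2 * alpha)).
Proof.
move=> n0; rewrite exchange_big /=; apply: eq_bigr => h _.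
rewrite -mulr_suml -mulr_sumr -mulrA; congr (_ * (_ / _)).
transitivity (complex.Re (\sum_(c < n)
    expi (2 * pi * (h.+1%:Z%:~R * c%:R / n%:R) : R))).
  by rewrite Re_sum; apply: eq_bigr => c _ /=; congr cos; rewrite -pmulrn; ring.
rewrite sum_expi_div// dvdzE /=; case: ifP => _; rewrite ?mul1r ?mul0r//.
by rewrite -(rmorph_nat (real_complex R)).
Qed.

(** The surviving frequencies are the multiples n q, and n (n q)^(-2 alpha) = n^(1 - 2 alpha) q^(-2
    alpha) <= q^(-2 alpha) because 2 alpha > 1. *)
Lemma sum_dvdn_powRN_le alpha n N : 1 / 2 < alpha -> (0 < n)%N ->
  \sum_(h < N) ((n %| h.+1)%:R * n%:R / h.+1%:R `^ (2 * alpha)) <=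
  \sum_(h < N %/ n) (h.+1%:R `^ (2 * alpha))^-1 :> R.
Proof.
move=> al n0; elim: N => [|N IH]; first by rewrite div0n !big_ord0.
rewrite [leLHS]big_ord_recr /= divnS//; case: (boolP (n %| N.+1)%N) => nN; last first.
  by rewrite !mul0r addr0.
rewrite add1n big_ord_recr /= lerD// mul1r.
have -> : N.+1 = (n * (N %/ n).+1)%N.
  by rewrite -[LHS](divnK nN) divnS// nN add1n mulnC.
rewrite natrM powRM//.
set q := (N %/ n).+1%:R; have q0 : 0 < q `^ (2 * alpha) by rewrite powR_gt0// ltr0n.
rewrite invfM mulrA ler_piMl ?invr_ge0 ?(ltW q0)//.
rewrite ler_pdivrMr ?powR_gt0 ?ltr0n// mul1r -{1}[n%:R]powRr1//.
by rewrite ler_powR ?ler1n//; lra.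
Qed.

Lemma sum_kernel_div_ge0_le alpha n : 1 / 2 < alpha -> (0 < n)%N ->
  0 <= \sum_(c < n) korobov_kernel alpha (c%:R / n%:R) <= korobov_kernel alpha 0.
Proof.
move=> al n0.
have cs : (fun N => \sum_(c < n) kernel_psum alpha (c%:R / n%:R) N) @ \oo -->
    \sum_(c < n) korobov_kernel alpha (c%:R / n%:R).
  by apply: cvg_sum_fin => c; exact: kernel_psum_cvg.
have c0 := kernel_psum_cvg (x := 0) al.
rewrite -(cvg_lim (@Rhausdorff R) cs); apply/andP; split.
  apply: limr_ge; first exact: cvgP cs.
  apply: nearW => N; rewrite sum_kernel_psum_div//; apply: sumr_ge0 => h _.
  by rewrite !mulr_ge0// invr_ge0 powR_ge0.
rewrite -(cvg_lim (@Rhausdorff R) c0); apply: ler_lim; [exact: cvgP cs|exact: cvgP c0|].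
apply: nearW => N; rewrite sum_kernel_psum_div// -mulr_sumr.
rewrite (le_trans (ler_wpM2l _ (sum_dvdn_powRN_le N al n0)))//.
rewrite /kernel_psum [leRHS](_ : _ = 2 * \sum_(h < N) (h.+1%:R `^ (2 * alpha))^-1).
  2: by rewrite mulr_sumr; apply: eq_bigr => h _; rewrite mulr0 cos0 mulr1.
rewrite ler_wpM2l// -!(big_mkord xpredT (fun h => (h.+1%:R `^ (2 * alpha))^-1)).
rewrite [leRHS](@big_cat_nat _ _ _ (N %/ n)%N) ?leq_div//= lerDl sumr_ge0//.
Qed.

(** The h with h_d = 0 form the dual lattice of (z_0, ..., z_(d-1)); the others give the increment,
    the only part that depends on z_d. *)
Lemma dual_sum_recr alpha gamma n z d :
  dual_sum alpha gamma n z d.+1 pred0 =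
  dual_sum alpha gamma n z d pred0 + dual_sum alpha gamma n z d.+1 (pred1 d).
Proof.
rewrite /dual_sum -mulrDr -big_split /=; congr (_ * _); apply: eq_bigr => i _.
rewrite !big_ord_recr /= eqxx add0r mulrDr mulr1; congr (_ + _ * _).
by apply: eq_bigr => j _; rewrite ltn_eqF ?ltn_ord.
Qed.

Lemma eq_dual_sum alpha gamma n z z' d e :
  (forall j, (j < d)%N -> z j = z' j) ->
  dual_sum alpha gamma n z d e = dual_sum alpha gamma n z' d e.
Proof.
move=> zz; congr (_ * _); apply: eq_bigr => i _; apply: eq_bigr => j _.
by rewrite zz.
Qed.

(* Modulo a prime, c |-> i c permutes the non-zero residues when i <> 0, and the
   kernel sums over all residues to at most its value at 0. *)
Lemma sum_dual_sum_last alpha gamma n z d : 1 / 2 < alpha -> prime n ->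
  (forall j, 0 < gamma j) ->
  \sum_(1 <= c < n)
    dual_sum alpha gamma n (fun j => if j == d then c else z j) d.+1 (pred1 d) <=
  gamma d * korobov_kernel alpha 0 *
    \prod_(j < d) (1 + gamma j * korobov_kernel alpha 0).
Proof.
move=> al pn g0; have n0 := prime_gt0 pn.
set K0 := korobov_kernel alpha 0.
pose P i := \prod_(j < d) (1 + gamma j * korobov_kernel alpha ((i * z j)%:R / n%:R)).
pose th c := dual_sum alpha gamma n (fun j => if j == d then c else z j) d.+1 (pred1 d).
pose k := \sum_(c < n) korobov_kernel alpha (c%:R / n%:R).
have /andP[k0 kK] : 0 <= k <= K0 := sum_kernel_div_ge0_le al n0.
have thE c : th c = n%:R^-1 * (gamma d *
    \sum_(i < n) P i * korobov_kernel alpha ((i * c)%:R / n%:R)).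
  rewrite /th /dual_sum [gamma d * _]mulr_sumr; congr (_ * _); apply: eq_bigr => i _.
  rewrite big_ord_recr /= eqxx add0r mulrCA; congr (_ * (_ * _)).
  by apply: eq_bigr => j _; rewrite ltn_eqF ?ltn_ord.
have P0E : P 0%N = \prod_(j < d) (1 + gamma j * K0).
  by apply: eq_bigr => j _; rewrite mul0n mul0r.
have sumP : 0 <= \sum_(i < n) P i.
  have := dual_sum_ge0 z d pred0 al n0 g0.
  by rewrite pmulr_rge0 ?invr_gt0 ?ltr0n.
have perm (i : 'I_n) : (0 < i)%N ->
    \sum_(c < n) korobov_kernel alpha ((i * c)%:R / n%:R) = k.
  move=> i0; pose f (c : 'I_n) : 'I_n := Ordinal (ltn_pmod (i * c) n0).
  have finj : injective f.
    have cin : coprime n i by rewrite prime_coprime// gtnNdvd.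
    suff le_inj (a b : 'I_n) : (a <= b)%N -> f a = f b -> a = b.
      by move=> a b fab; have [/le_inj->//|/ltnW/le_inj->] := leqP a b.
    move=> ab [] /esym/eqP; rewrite eqn_mod_dvd ?leq_mul//.
    rewrite -mulnBr Gauss_dvdr// => /eqP.
    rewrite modn_small ?(leq_ltn_trans (leq_subr _ _))// => /eqP.
    by rewrite subn_eq0 => ba; apply/val_inj/eqP; rewrite eqn_leq ab.
  rewrite /k [RHS](reindex_inj finj) /=; apply: eq_bigr => c _.
  by rewrite korobov_kernel_modn.
(* The node i = 0 contributes K(0) for each c; for every other i the products i c run through all
   residues, which gives k. *)
have total : \sum_(c < n) th c =
    n%:R^-1 * (gamma d * (P 0%N * (n%:R * K0) + k * (\sum_(i < n) P i - P 0%N))).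
  under eq_bigr => c _ do rewrite thE.
  rewrite -!mulr_sumr exchange_big /=; congr (_ * (_ * _)).
  under eq_bigr => i _ do rewrite -mulr_sumr.
  rewrite (bigD1 (Ordinal n0)) //= [X in k * (X - _)](bigD1 (Ordinal n0)) //=.
  rewrite [P 0%N + _]addrC addrK; congr (_ * _ + _).
    under eq_bigr => c _ do rewrite mul0n mul0r.
    by rewrite sumr_const card_ord mulr_natl.
  rewrite mulr_sumr; apply: eq_bigr => i i0; rewrite perm ?[k * _]mulrC//.
  by rewrite lt0n; apply: contra i0 => /eqP i0; apply/eqP/val_inj.
have split0 : \sum_(c < n) th c = th 0%N + \sum_(1 <= c < n) th c.
  by rewrite -(big_mkord xpredT th) big_ltn.
have th0 : th 0%N = n%:R^-1 * (gamma d * (K0 * \sum_(i < n) P i)).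
  rewrite thE [K0 * _]mulr_sumr; congr (_ * (_ * _)); apply: eq_bigr => i _.
  by rewrite muln0 mul0r mulrC.
have -> : \sum_(1 <= c < n) th c = n%:R^-1 * (gamma d *
   (P 0%N * (n%:R * K0) + k * (\sum_(i < n) P i - P 0%N) - K0 * \sum_(i < n) P i)).
  have -> : \sum_(1 <= c < n) th c = \sum_(c < n) th c - th 0%N.
    by rewrite split0 addrC addKr.
  by rewrite total th0; ring.
rewrite -P0E -[leRHS](@mulKf _ n%:R) ?pnatr_eq0 -?lt0n//.
rewrite ler_pM2l ?invr_gt0 ?ltr0n//.
have -> : n%:R * (gamma d * K0 * P 0%N) = gamma d * (P 0%N * (n%:R * K0)) by ring.
rewrite ler_pM2l// -addrA gerDl.
(* What is left is (k - K0) sum P - k P(0) <= 0, where 0 <= k <= K0, and sum P and P(0) are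
   non-negative. *)
have P0 : 0 <= P 0%N.
  rewrite P0E; apply: prodr_ge0 => j _; rewrite addr_ge0// mulr_ge0 ?(ltW (g0 _))//.
  exact: le_trans k0 kK.
by nra.
Qed.

Lemma korobov_kernel0_ge0 alpha : 1 / 2 < alpha -> 0 <= korobov_kernel alpha 0 :> R.
Proof.
by move=> al; have /andP[] := sum_kernel_div_ge0_le al (ltn0Sn 0); apply: le_trans.
Qed.

(** The minimality in [is_cbc], expressed by the closed form: the squared error is [dual_sum] minus
    1. *)
Definition cbc_minimal alpha gamma n d z : Prop := forall s, (s < d)%N ->
  (0 < z s < n)%N /\ forall c, (0 < c < n)%N ->
    dual_sum alpha gamma n z s.+1 pred0 <=
    dual_sum alpha gamma n (fun j => if j == s then c else z j) s.+1 pred0.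

(** The minimal increment, raised to the power l, is at most the average over the n - 1 candidates,
    which is bounded at the parameters alpha l and gamma^l. With p_d the product in the bound, the
    induction closes because (p_d - 1) + 2 zeta(2 alpha l) gamma_d^l p_d = p_(d+1) - 1. *)
Lemma cbc_minimal_bound alpha gamma n d z l :
  1 / 2 < alpha -> prime n -> (forall j, 0 < gamma j) ->
  1 / (2 * alpha) < l -> l <= 1 -> cbc_minimal alpha gamma n d z ->
  (dual_sum alpha gamma n z d pred0 - 1) `^ l <=
  n.-1%:R^-1 * (\prod_(j < d) (1 + 2 * zeta (2 * alpha * l) * gamma j `^ l) - 1).
Proof.
move=> al pn g0 l0 l1; have n0 := prime_gt0 pn; have n1 := prime_gt1 pn.
have lp : 0 < l by apply: lt_trans l0; rewrite divr_gt0//; lra.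
have al2 : 1 / 2 < alpha * l.
  by move: l0; rewrite !ltr_pdivrMr; [nra | lra | lra].
have gl j : 0 < gamma j `^ l by exact: powR_gt0.
elim: d => [|d IH] min.
  rewrite /dual_sum !big_ord0 subrr mulr0.
  under eq_bigr => i _ do rewrite big_ord0.
  rewrite sumr_const card_ord mulVf ?subrr ?powR0 ?gt_eqF//.
  by rewrite ltr0n.
have {}IH := IH (fun s sd => min s (leq_trans sd (leqnSn d))).
have [_ zmin] := min d (ltnSn d).
pose th c := dual_sum alpha gamma n (fun j => if j == d then c else z j) d.+1 (pred1 d).
pose th' c := dual_sum (alpha * l) (fun j => gamma j `^ l) n
  (fun j => if j == d then c else z j) d.+1 (pred1 d).
pose S := dual_sum alpha gamma n z d pred0.
have zE : forall j, (if j == d then z d else z j) = z j.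
  by move=> j; case: eqP => // ->.
have thz : dual_sum alpha gamma n z d.+1 (pred1 d) = th (z d).
  by apply: eq_dual_sum => j _; rewrite zE.
(* The share of the first d components is common to all candidates and cancels. *)
have th_le c : (0 < c < n)%N -> th (z d) <= th c.
  move=> cn; have := zmin c cn; rewrite !dual_sum_recr thz -/(th c).
  rewrite (@eq_dual_sum _ _ _ (fun j => if j == d then c else z j) z) ?lerD2l//.
  by move=> j jd; rewrite ltn_eqF.
have th0 c : 0 <= th c by exact: dual_sum_ge0.
have avg : n.-1%:R * th (z d) `^ l <= \sum_(1 <= c < n) th' c.
  rewrite -subn1 mulr_natl -sumr_const_nat; apply: ler_sum_nat => c cn.
  apply: le_trans (dual_sum_powR _ _ _ l0 l1 al n0 g0).
  exact: (ge0_ler_powR (ltW lp) (th0 (z d) : _ \in Num.nneg) (th0 c) (th_le c cn)).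
have S1 : 0 <= S - 1.
  rewrite subr_ge0; have cs := dual_psum_cvg (z := z) (d := d) (e := pred0) al n0 g0.
  rewrite /S -(cvg_lim (@Rhausdorff R) cs); apply: limr_ge; first exact: cvgP cs.
  apply: nearW => N; rewrite /dual_psum.
  pose h0 : {ffun 'I_d -> 'I_(2 * N).+1} :=
    [ffun=> Ordinal (leq_pmull N (isT : (0 < 2)%N) : (N < (2 * N).+1)%N)].
  have h00 j : box h0 j = 0 by rewrite !ffunE subrr.
  rewrite (bigD1 h0) //= [X in X * _](_ : _ = 1); last first.
    by rewrite /dual big1 ?dvdz0// => j _; rewrite h00 mul0r.
  rewrite mul1r big1 ?lerDl; last by move=> j _; rewrite h00 /r1 eqxx divr1.
  apply: sumr_ge0 => h _; rewrite mulr_ge0//.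
  by apply: prodr_ge0 => j _; rewrite divr_ge0// ltW// r1_gt0.
have n1R : 0 < n.-1%:R :> R by rewrite ltr0n -ltnS prednK.
rewrite dual_sum_recr thz -/S addrAC.
apply: le_trans (powRD_le S1 (th0 _) lp l1) _.
rewrite big_ord_recr /=; set Pr := \prod_(j < d) _.
have K0E : korobov_kernel (alpha * l) 0 = 2 * zeta (2 * alpha * l) :> R.
  by rewrite korobov_kernelE0// mulrA.
have thB : th (z d) `^ l <=
    n.-1%:R^-1 * (gamma d `^ l * (2 * zeta (2 * alpha * l)) * Pr).
  rewrite ler_pdivlMl// (le_trans avg)// (le_trans (sum_dual_sum_last _ _ al2 pn gl))//.
  rewrite K0E le_eqVlt; apply/orP; left; apply/eqP; congr (_ * _).
  by apply: eq_bigr => j _; rewrite [_ `^ _ * _]mulrC.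
apply: le_trans (lerD IH thB) _; rewrite -mulrDr -/Pr.
rewrite le_eqVlt; apply/orP; left; apply/eqP; congr (_ * _); ring.
Qed.

End cbc_bound.

(** * Integration over the cube *)

Section cube_integral.
Context {R : realType}.
Local Notation C := R[i].
Local Notation TR := (measurableTypeR R).
Local Notation pt d := (d.-tuple TR).
Local Notation mu d := (lebesgue_tuple R d).
Local Notation leb := (@lebesgue_measure R).

Lemma preimage_cons_cube d :
  @cons_pair R d @^-1` @cube R d.+1 = `[0, 1]%classic `*` @cube R d.
Proof.
apply/seteqP; split => [[t x] /= tx|[t x] [/= t01 x01] j].
  split; first by have /= := tx ord0; rewrite (tnth_nth 0) /= in_itv.
  by move=> j; have := tx (lift ord0 j); rewrite !(tnth_nth 0).
rewrite /cons_pair /= (tnth_nth 0) /=; case: (unliftP ord0 j) => [k ->|->] /=.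
  by have := x01 k; rewrite (tnth_nth 0).
by move: t01; rewrite in_itv.
Qed.

Lemma measurable_cube d : measurable (@cube R d).
Proof.
rewrite (_ : @cube R d =
    \bigcap_(j in [set: 'I_d]) ((fun x : pt d => tnth x j) @^-1` `[0, 1])).
  apply: fin_bigcap_measurable => // j _.
  by rewrite -[X in measurable X]setTI; exact: measurable_tnth.
apply/seteqP; split => x xc j; first by move=> _; rewrite /= in_itv /=; exact: xc.
by have := xc j I; rewrite /= in_itv.
Qed.

Lemma lebesgue_measure01 : leb `[0, 1]%classic = 1%E.
Proof. by rewrite lebesgue_measure_itv /= lte_fin ltr01 oppr0 adde0. Qed.

Lemma cube_measure1 d : mu d (@cube R d) = 1%E.
Proof.
elim: d => [|d IH].
  by rewrite /= diracE mem_set// => -[].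
rewrite /= /lebesgue_step /pushforward preimage_cons_cube product_measure1E//.
  by rewrite -[RHS]mule1; congr mule; [exact: lebesgue_measure01 | exact: IH].
exact: measurable_cube.
Qed.

(** The parameter [re] is a real part, an imaginary part or, for real functions, the identity. The
    bound holds on the whole space and not only on the cube, so that the class is stable under
    products and under composition with measurable maps. *)
Definition bounded_mfun T (d : measure_display) (X : measurableType d)
    (f : X -> T) (re : T -> R) : Prop :=
  measurable_fun setT (re \o f) /\ exists M : R, forall x, `|re (f x)| <= M.

Definition nice (d : measure_display) (X : measurableType d) (f : X -> C) : Prop :=
  bounded_mfun f (@complex.Re R) /\ bounded_mfun f (@complex.Im R).

Lemma bounded_integrable (d : measure_display) (X : measurableType d)
    (m : {measure set X -> \bar R}) (A : set X) (f : X -> R) :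
  measurable A -> (m A < +oo)%E -> bounded_mfun f id ->
  m.-integrable A (EFin \o f).
Proof.
move=> mA Afin [mf [M fM]]; apply: measurable_bounded_integrable => //.
  exact: measurable_funTS.
exists M; split; first exact: num_real.
by move=> K MK x _; exact: le_trans (fM x) (ltW MK).
Qed.

Lemma cube_integrable d (f : pt d -> R) : bounded_mfun f id ->
  (mu d).-integrable (@cube R d) (EFin \o f).
Proof.
move=> fb; apply: bounded_integrable => //; first exact: measurable_cube.
by apply: le_lt_trans (ltry 1); rewrite -(cube_measure1 d).
Qed.

Lemma itv_integrable (f : TR -> R) : bounded_mfun f id ->
  leb.-integrable `[0, 1] (EFin \o f).
Proof.
move=> fb; apply: bounded_integrable => //.
by apply: le_lt_trans (ltry 1); rewrite -lebesgue_measure01.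
Qed.

(** Fubini's theorem, after transport to the product space along [cons_pair]; the integrand is
    extended by 0 outside of the preimage of the cube, which is a product set. *)
Lemma Rintegral_cons d (u : TR -> R) (v : pt d -> R) :
  bounded_mfun u id -> bounded_mfun v id ->
  \int[mu d.+1]_(x in @cube R d.+1) (u (thead x) * v [tuple of behead x]) =
  (\int[leb]_(t in `[0, 1]) u t) * \int[mu d]_(x in @cube R d) v x.
Proof.
move=> ub vb; have iu := itv_integrable ub; have iv := cube_integrable vb.
have [mu_ [Mu uM]] := ub; have [mv [Mv vM]] := vb.
pose A : set (TR * pt d) := `[0, 1]%classic `*` @cube R d.
have mA : measurable A.
  by apply: measurableX; [exact: measurable_itv | exact: measurable_cube].
pose G (p : TR * pt d) : R := u p.1 * v p.2.
have bG : bounded_mfun G id.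
  split; first by apply: measurable_funM; [apply: (measurableT_comp mu_)|
    apply: (measurableT_comp mv)].
  exists (Mu * Mv) => p; rewrite /G normrM.
  by rewrite ler_pM.
have prodA : (leb \x mu d)%E A = 1%E.
  rewrite product_measure1E//; last exact: measurable_cube.
  rewrite -[RHS]mule1; congr mule; first exact: lebesgue_measure01.
  exact: cube_measure1.
have iG : (leb \x mu d)%E.-integrable A (EFin \o G).
  apply: bounded_integrable => //; by apply: le_lt_trans (ltry 1); rewrite -prodA.
pose F (x : pt d.+1) : R := u (thead x) * v [tuple of behead x].
have FG p : F (cons_pair p) = G p.
  rewrite /F /G theadE; congr (_ * v _); exact: val_inj.
have mF : measurable_fun setT F.
  apply: measurable_funM.
    apply: (measurableT_comp (f := u)) => //; exact: (measurable_tnth ord0).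
  apply: (measurableT_comp (f := v)) => //; exact: measurable_behead.
have step1 : (\int[mu d.+1]_(x in @cube R d.+1) (F x)%:E =
    \int[(leb \x mu d)%E]_(p in A) (G p)%:E)%E.
  rewrite /= /lebesgue_step integral_pushforward.
  - by rewrite preimage_cons_cube; apply: eq_integral => p _ /=; rewrite FG.
  - exact: measurable_cons_pair.
  - exact/measurable_EFinP.
  - rewrite preimage_cons_cube.
    by rewrite (_ : _ \o _ = EFin \o G)//; apply/funext => p /=; rewrite FG.
  - exact: measurable_cube.
have Vfin : (\int[mu d]_(x in @cube R d) (v x)%:E =
    (\int[mu d]_(x in @cube R d) v x)%:E)%E.
  by rewrite /Rintegral fineK// integrable_fin_num//; exact: measurable_cube.
have Ufin : (\int[leb]_(x in `[0%R, 1%R]) (u x)%:E =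
    (\int[leb]_(x in `[0%R, 1%R]) u x)%:E)%E.
  by rewrite /Rintegral fineK// integrable_fin_num//; exact: measurable_itv.
set V := \int[mu d]_(x in @cube R d) v x in Vfin *.
set U := \int[leb]_(x in `[0, 1]) u x in Ufin *.
rewrite {1}/Rintegral -/(F _) step1 integral_mkcond -integral12_prod_meas1; last first.
  exact: (integrable_mkcond _ mA).1.
suff -> : fubini_F (mu d) ((EFin \o G) \_ A) =
    (fun x => (u x * V)%:E) \_ `[0, 1]%classic.
  rewrite -integral_mkcond.
  under eq_integral do rewrite EFinM.
  by rewrite integralZr//= Ufin -EFinM.
apply/funext => x; rewrite /fubini_F patchE; case: ifPn => [xi|xi].
  rewrite (eq_integral ((fun y => (u x)%:E * (v y)%:E)%E \_ @cube R d)).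
    rewrite -integral_mkcond integralZl//; last exact: measurable_cube.
    by rewrite Vfin EFinM.
  move=> y _; rewrite !patchE /= /A.
  by rewrite (_ : (x, y) \in _ = (y \in @cube R d))// in_setX xi.
rewrite integral0_eq// => y _; rewrite patchE.
by rewrite (_ : (x, y) \in _ = false)// in_setX (negbTE xi).
Qed.

Definition cint1 (u : TR -> C) : C :=
  Complex (\int[leb]_(t in `[0, 1]) complex.Re (u t))
          (\int[leb]_(t in `[0, 1]) complex.Im (u t)).

Section nice_closure.
Context (d : measure_display) (X : measurableType d).
Implicit Types f g : X -> C.

Lemma bounded_mfunM (f g : X -> R) : bounded_mfun f id -> bounded_mfun g id ->
  bounded_mfun (fun x => f x * g x) id.
Proof.
move=> [mf [M fM]] [mg [N gN]]; split; first exact: measurable_funM.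
by exists (M * N) => x; rewrite normrM ler_pM ?normr_ge0.
Qed.

Lemma bounded_mfunD (f g : X -> R) : bounded_mfun f id -> bounded_mfun g id ->
  bounded_mfun (fun x => f x + g x) id.
Proof.
move=> [mf [M fM]] [mg [N gN]]; split; first exact: measurable_funD.
by exists (M + N) => x; rewrite (le_trans (ler_normD _ _))// lerD.
Qed.

Lemma bounded_mfunN (f : X -> R) : bounded_mfun f id ->
  bounded_mfun (fun x => - f x) id.
Proof.
move=> [mf [M fM]]; split; first exact: measurable_funN.
by exists M => x; rewrite normrN.
Qed.

Lemma bounded_mfun_cst (c : R) : bounded_mfun (fun _ : X => c) id.
Proof. by split; [exact: measurable_cst | exists `|c|]. Qed.

Lemma niceP f : nice f <-> bounded_mfun (fun x => complex.Re (f x)) id /\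
  bounded_mfun (fun x => complex.Im (f x)) id.
Proof. by []. Qed.

Lemma nice_cst (c : C) : nice (fun _ : X => c).
Proof. by split; exact: bounded_mfun_cst. Qed.

Lemma niceD f g : nice f -> nice g -> nice (fun x => f x + g x).
Proof.
move=> /niceP[rf jf] /niceP[rg jg]; apply/niceP; split.
  rewrite (_ : (fun x => _) = fun x => complex.Re (f x) + complex.Re (g x)).
    exact: bounded_mfunD.
  by apply/funext => x; case: (f x) (g x) => [a b] [a' b'].
rewrite (_ : (fun x => _) = fun x => complex.Im (f x) + complex.Im (g x)).
  exact: bounded_mfunD.
by apply/funext => x; case: (f x) (g x) => [a b] [a' b'].
Qed.

Lemma niceM f g : nice f -> nice g -> nice (fun x => f x * g x).
Proof.
move=> /niceP[rf jf] /niceP[rg jg]; apply/niceP; split.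
  rewrite (_ : (fun x => _) = fun x => complex.Re (f x) * complex.Re (g x) +
      - (complex.Im (f x) * complex.Im (g x))).
    by apply: bounded_mfunD; [|apply: bounded_mfunN]; exact: bounded_mfunM.
  by apply/funext => x; case: (f x) (g x) => [a b] [a' b'].
rewrite (_ : (fun x => _) = fun x => complex.Re (f x) * complex.Im (g x) +
    complex.Im (f x) * complex.Re (g x)).
  by apply: bounded_mfunD; exact: bounded_mfunM.
by apply/funext => x; case: (f x) (g x) => [a b] [a' b'].
Qed.

Lemma nice_sum (I : Type) (r : seq I) (P : pred I) (F : I -> X -> C) :
  (forall i, P i -> nice (F i)) -> nice (fun x => \sum_(i <- r | P i) F i x).
Proof.
move=> nF; elim: r => [|i r IH].
  rewrite (_ : (fun x => _) = fun=> 0); first exact: nice_cst.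
  by apply/funext => x; rewrite big_nil.
rewrite (_ : (fun x => _) = fun x => (if P i then F i x else 0) +
    \sum_(j <- r | P j) F j x).
  apply: niceD => //; case: (boolP (P i)) => Pi; [exact: nF | exact: nice_cst].
by apply/funext => x; rewrite big_cons; case: ifP => //; rewrite add0r.
Qed.

Lemma nice_prod (I : Type) (r : seq I) (P : pred I) (F : I -> X -> C) :
  (forall i, P i -> nice (F i)) -> nice (fun x => \prod_(i <- r | P i) F i x).
Proof.
move=> nF; elim: r => [|i r IH].
  rewrite (_ : (fun x => _) = fun=> 1); first exact: nice_cst.
  by apply/funext => x; rewrite big_nil.
rewrite (_ : (fun x => _) = fun x => (if P i then F i x else 1) *
    \prod_(j <- r | P j) F j x).
  apply: niceM => //; case: (boolP (P i)) => Pi; [exact: nF | exact: nice_cst].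
by apply/funext => x; rewrite big_cons; case: ifP => //; rewrite mul1r.
Qed.

Lemma nice_real (f : X -> R) : bounded_mfun f id -> nice (fun x => (f x)%:C%C).
Proof. by move=> bf; split=> //; exact: bounded_mfun_cst. Qed.

End nice_closure.

Lemma nice_comp (d d' : measure_display) (X : measurableType d)
    (Y : measurableType d') (g : X -> Y) (f : Y -> C) :
  measurable_fun setT g -> nice f -> nice (f \o g).
Proof.
move=> mg [[mr [M rM]] [mi [N iN]]]; split; split.
- exact: (measurableT_comp mr).
- by exists M => x; exact: rM.
- exact: (measurableT_comp mi).
- by exists N => x; exact: iN.
Qed.

Lemma cint_cons d (u : TR -> C) (V : pt d -> C) : nice u -> nice V ->
  cint (fun x : pt d.+1 => u (thead x) * V [tuple of behead x]) = cint1 u * cint V.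
Proof.
move=> nu nV; have [ur ui] := nu; have [vr vi] := nV.
have mC := @measurable_cube d.+1.
have bh (w : TR -> R) (W : pt d -> R) : bounded_mfun w id -> bounded_mfun W id ->
    bounded_mfun (fun x : pt d.+1 => w (thead x) * W [tuple of behead x]) id.
  move=> [mw [M wM]] [mW [N WN]]; apply: bounded_mfunM; split.
  - apply: (measurableT_comp (f := w)) => //; exact: (measurable_tnth ord0).
  - by exists M => x; exact: wM.
  - apply: (measurableT_comp (f := W)) => //; exact: measurable_behead.
  - by exists N => x; exact: WN.
apply/eqP; rewrite eq_complex; apply/andP; split; apply/eqP => /=.
  transitivity (\int[mu d.+1]_(x in @cube R d.+1)
     (complex.Re (u (thead x)) * complex.Re (V [tuple of behead x]) -
      complex.Im (u (thead x)) * complex.Im (V [tuple of behead x]))).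
    apply: eq_Rintegral => x _.
    by case: (u (thead x)) (V _) => [a b] [a' b'].
  rewrite RintegralB//; first last.
  - exact: cube_integrable (bh _ _ ui vi).
  - exact: cube_integrable (bh _ _ ur vr).
  by rewrite (Rintegral_cons ur vr) (Rintegral_cons ui vi).
transitivity (\int[mu d.+1]_(x in @cube R d.+1)
   (complex.Re (u (thead x)) * complex.Im (V [tuple of behead x]) +
    complex.Im (u (thead x)) * complex.Re (V [tuple of behead x]))).
  apply: eq_Rintegral => x _.
  by case: (u (thead x)) (V _) => [a b] [a' b'].
rewrite RintegralD//; first last.
- exact: cube_integrable (bh _ _ ui vr).
- exact: cube_integrable (bh _ _ ur vi).
by rewrite (Rintegral_cons ur vi) (Rintegral_cons ui vr).
Qed.

Lemma cint_cst d (c : C) : cint (fun _ : pt d => c) = c.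
Proof.
case: c => a b; rewrite /cint /=; have mC := @measurable_cube d.
have E t : \int[mu d]_(_ in @cube R d) t = t.
  rewrite Rintegral_cst// -[RHS]mulr1; congr (_ * _).
  by rewrite -[RHS]/(fine 1%E); congr fine; exact: cube_measure1.
by rewrite !E.
Qed.

Lemma cint_prod d (E : 'I_d -> TR -> C) : (forall j, nice (E j)) ->
  cint (fun x : pt d => \prod_(j < d) E j (tnth x j)) = \prod_(j < d) cint1 (E j).
Proof.
elim: d E => [|d IH] E nE.
  rewrite big_ord0 -[RHS](cint_cst 0); congr cint.
  by apply/funext => x; rewrite big_ord0.
rewrite big_ord_recl -IH// -cint_cons//; last first.
  apply: nice_prod => j _; apply: (nice_comp (f := E (lift ord0 j))) => //.
  exact: measurable_tnth.
congr cint; apply/funext => x; rewrite big_ord_recl; congr (_ * _).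
apply: eq_bigr => j _; congr (E _ _).
by rewrite !(tnth_nth 0) nth_behead.
Qed.

Lemma cintD d (f g : pt d -> C) : nice f -> nice g ->
  cint (fun x => f x + g x) = cint f + cint g.
Proof.
move=> [rf jf] [rg jg]; have mC := @measurable_cube d.
apply/eqP; rewrite eq_complex; apply/andP; split; apply/eqP => /=.
  rewrite -RintegralD//; try exact: cube_integrable.
  by apply: eq_Rintegral => x _; case: (f x) (g x) => [a b] [a' b'].
rewrite -RintegralD//; try exact: cube_integrable.
by apply: eq_Rintegral => x _; case: (f x) (g x) => [a b] [a' b'].
Qed.

Lemma cintZ d (c : C) (f : pt d -> C) : nice f ->
  cint (fun x => c * f x) = c * cint f.
Proof.
move=> [rf jf]; case: c => a b; have mC := @measurable_cube d.
have ib (w : pt d -> R) e : bounded_mfun w id ->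
    (mu d).-integrable (@cube R d) (EFin \o (fun x => e * w x)).
  by move=> bw; apply/cube_integrable/bounded_mfunM => //; exact: bounded_mfun_cst.
apply/eqP; rewrite eq_complex; apply/andP; split; apply/eqP => /=.
  rewrite -!RintegralZl//; try exact: cube_integrable.
  rewrite -RintegralB//; try exact: ib.
  by apply: eq_Rintegral => x _; case: (f x) => [a' b'].
rewrite -!RintegralZl//; try exact: cube_integrable.
rewrite -RintegralD//; try exact: ib.
by apply: eq_Rintegral => x _; case: (f x) => [a' b'].
Qed.

Lemma cint_sum d (I : Type) (r : seq I) (P : pred I) (c : I -> C)
    (F : I -> pt d -> C) : (forall i, nice (F i)) ->
  cint (fun x => \sum_(i <- r | P i) c i * F i x) =
  \sum_(i <- r | P i) c i * cint (F i).
Proof.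
move=> nF; elim: r => [|i r IH].
  rewrite big_nil -[RHS](cint_cst d 0); congr cint.
  by apply/funext => x; rewrite big_nil.
have nZ j : nice (fun x => c j * F j x) by apply: niceM => //; exact: nice_cst.
rewrite big_cons -IH -(cintZ _ (nF i)).
case: ifP => Pi; last first.
  by congr cint; apply/funext => x; rewrite big_cons Pi.
rewrite -cintD//; last by apply: nice_sum.
by congr cint; apply/funext => x; rewrite big_cons Pi.
Qed.

Lemma nice_square_integrable d (f : pt d -> C) : nice f -> square_integrable f.
Proof.
move=> nf; have [[mr [M rM]] [mi [N iN]]] := nf; split.
- exact: measurable_funTS.
- exact: measurable_funTS.
have b2 : bounded_mfun (fun x => normc (f x) ^+ 2) id.
  rewrite (_ : (fun x => _) = fun x => complex.Re (f x) * complex.Re (f x) +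
     complex.Im (f x) * complex.Im (f x)).
    by apply: bounded_mfunD; apply: bounded_mfunM; case: nf.
  apply/funext => x; case: (f x) => [a b] /=.
  by rewrite sqr_sqrtr ?addr_ge0 ?sqr_ge0// !expr2.
have := cube_integrable b2 => /integrableP[_]; apply: le_lt_trans.
apply: ge0_le_integral => //=.
- exact: measurable_cube.
- by move=> x _; rewrite lee_fin sqr_ge0.
- by case: b2 => mb _; apply/measurable_EFinP/measurable_funTS.
- by case: b2 => mb _; apply/measurable_EFinP/measurable_funTS/measurableT_comp.
- by move=> x _; rewrite lee_fin ler_norm.
Qed.

End cube_integral.

(** * Orthonormality of the characters and of the cosines *)

Section orthonormality.
Context {R : realType}.
Local Notation C := R[i].
Local Notation TR := (measurableTypeR R).
Local Notation pt d := (d.-tuple TR).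
Local Notation leb := (@lebesgue_measure R).

Lemma Rintegral_FTC (f F : R -> R) : continuous f ->
  (forall t, is_derive t (1 : R) F (f t)) ->
  \int[leb]_(t in `[0, 1]) f t = F 1 - F 0.
Proof.
move=> cf dF; have cF : continuous F.
  by move=> t; apply/differentiable_continuous/derivable1_diffP; case: (dF t).
rewrite /Rintegral (continuous_FTC2 (F := F))//.
- exact: continuous_subspaceT.
- split; first by move=> t _; case: (dF t).
    by apply: cvg_at_right_filter; exact: cF.
  by apply: cvg_at_left_filter; exact: cF.
- by move=> t _; rewrite derive1E derive_val.
Qed.

Lemma Rintegral_cos (a : R) : a != 0 ->
  \int[leb]_(t in `[0, 1]) cos (a * t) = sin a / a.
Proof.
move=> a0.
have cf : continuous (fun t : R => cos (a * t)).
  move=> t; apply: continuous_comp; last exact: continuous_cos.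
  by apply: cvgM; [exact: cvg_cst | exact: cvg_id].
have dF (t : R) : is_derive t (1 : R) (fun t => a^-1 * sin (a * t)) (cos (a * t)).
  by apply: is_derive_eq; rewrite /GRing.scale /= mulr1; field.
by rewrite (Rintegral_FTC cf dF) mulr1 mulr0 sin0 mulr0 subr0 mulrC.
Qed.

Lemma Rintegral_sin (a : R) : a != 0 ->
  \int[leb]_(t in `[0, 1]) sin (a * t) = (1 - cos a) / a.
Proof.
move=> a0.
have cf : continuous (fun t : R => sin (a * t)).
  move=> t; apply: continuous_comp; last exact: continuous_sin.
  by apply: cvgM; [exact: cvg_cst | exact: cvg_id].
have dF (t : R) : is_derive t (1 : R) (fun t => - (a^-1 * cos (a * t))) (sin (a * t)).
  by apply: is_derive_eq; rewrite /GRing.scale /= mulr1; field.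
by rewrite (Rintegral_FTC cf dF) mulr1 mulr0 cos0 mulr1 opprK; field.
Qed.

Lemma sin_pi_int (m : int) : sin (pi * m%:~R) = 0 :> R.
Proof.
have sin_nat k : sin (pi * k%:R) = 0 :> R.
  elim: k => [|k IH]; first by rewrite mulr0 sin0.
  by rewrite -natr1 mulrDr mulr1 sinDpi IH oppr0.
by case: m => k; rewrite ?NegzE ?mulrNz ?mulrN ?sinN -pmulrn sin_nat ?oppr0.
Qed.

Lemma cos_2pi_int (m : int) : cos (2 * pi * m%:~R) = 1 :> R.
Proof. by have [] := expi_2pi_int (R := R) m. Qed.

Lemma Rintegral_1 : \int[leb]_(t in `[0, 1]) 1 = 1 :> R.
Proof.
by rewrite Rintegral_cst// mul1r -[RHS]/(fine 1%E); congr fine; exact: lebesgue_measure01.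
Qed.

Lemma Rintegral_cos_int (m : int) :
  \int[leb]_(t in `[0, 1]) cos (pi * m%:~R * t) = (m == 0)%:R :> R.
Proof.
have [->|m0] := eqVneq m 0.
  rewrite -[RHS]Rintegral_1; apply: eq_Rintegral => t _.
  by rewrite mulr0 mul0r cos0.
by rewrite Rintegral_cos ?sin_pi_int ?mul0r// mulf_neq0 ?intr_eq0// gt_eqF ?pi_gt0.
Qed.

Lemma continuous_bounded_mfun (f : R -> R) M : continuous f ->
  (forall t, `|f t| <= M) -> bounded_mfun (f : TR -> R) id.
Proof.
move=> cf fM; split; last by exists M.
exact: continuous_measurable_fun.
Qed.

Lemma bounded_mfun_cos (a : R) : bounded_mfun (fun t : TR => cos (a * t)) id.
Proof.
apply: (@continuous_bounded_mfun _ 1) => t; last exact: cos_max.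
apply: continuous_comp; last exact: continuous_cos.
by apply: cvgM; [exact: cvg_cst | exact: cvg_id].
Qed.

Lemma bounded_mfun_sin (a : R) : bounded_mfun (fun t : TR => sin (a * t)) id.
Proof.
apply: (@continuous_bounded_mfun _ 1) => t; last exact: sin_max.
apply: continuous_comp; last exact: continuous_sin.
by apply: cvgM; [exact: cvg_cst | exact: cvg_id].
Qed.

Lemma nice_expi (a : R) : nice (fun t : TR => expi (a * t)).
Proof. by split; [exact: bounded_mfun_cos | exact: bounded_mfun_sin]. Qed.

Lemma cint1_expi (m : int) :
  cint1 (fun t : TR => expi (2 * pi * m%:~R * t)) = (m == 0)%:R :> C.
Proof.
rewrite /cint1 /=.
have [->|m0] := eqVneq m 0.
  have E1 : \int[leb]_(t in `[0, 1]) cos (2 * pi * 0 * t) = 1.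
    by rewrite -[RHS]Rintegral_1; apply: eq_Rintegral => t _; rewrite mulr0 mul0r cos0.
  have E2 : \int[leb]_(t in `[0, 1]) sin (2 * pi * 0 * t) = 0.
    rewrite (_ : (fun t => _) = fun=> 0) ?Rintegral_cst ?mul0r//.
    by apply/funext => t; rewrite mulr0 mul0r sin0.
  by rewrite E1 E2.
have a0 : 2 * pi * m%:~R != 0 :> R by rewrite !mulf_neq0 ?intr_eq0// gt_eqF ?pi_gt0.
rewrite Rintegral_cos// Rintegral_sin// cos_2pi_int subrr mul0r.
have -> : 2 * pi * m%:~R = pi * (2 * m)%:~R :> R.
  by rewrite intrM -pmulrn; ring.
by rewrite sin_pi_int mul0r.
Qed.

Definition echar d (h : {ffun 'I_d -> int}) (x : pt d) : C :=
  expi (2 * pi * dot h x).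

Lemma echarE d (h : {ffun 'I_d -> int}) (x : pt d) :
  echar h x = \prod_(j < d) expi (2 * pi * (h j)%:~R * tnth x j).
Proof.
rewrite /echar /dot mulr_sumr expi_sum; apply: eq_bigr => j _.
by rewrite mulrA.
Qed.

Lemma nice_prod_coord d (E : 'I_d -> TR -> C) : (forall j, nice (E j)) ->
  nice (fun x : pt d => \prod_(j < d) E j (tnth x j)).
Proof.
move=> nE; apply: nice_prod => j _; apply: (nice_comp (f := E j)) => //.
exact: measurable_tnth.
Qed.

Lemma nice_echar d (h : {ffun 'I_d -> int}) : nice (echar h).
Proof.
rewrite (_ : echar h = fun x : pt d => \prod_(j < d) expi (2 * pi * (h j)%:~R * tnth x j)).
  apply: (@nice_prod_coord d (fun j t => expi (2 * pi * (h j)%:~R * t))) => j.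
  exact: nice_expi.
by apply/funext => x; rewrite echarE.
Qed.

Lemma nice_echarN d (h : {ffun 'I_d -> int}) :
  nice (fun x : pt d => expi (- (2 * pi * dot h x))).
Proof.
rewrite (_ : (fun x => _) = fun x => conjc (echar h x)).
  2: by apply/funext => x; rewrite expiN.
have [re [mi [M iM]]] := nice_echar h; split; first exact: re.
split; last by exists M => x /=; rewrite normrN; exact: iM.
exact: (measurable_funN mi).
Qed.

Lemma prod_nat_eq (d : nat) (T : eqType) (h k : {ffun 'I_d -> T}) :
  \prod_(j < d) (h j == k j)%:R = (h == k)%:R :> C.
Proof.
have [->|hk] := eqVneq h k; first by rewrite big1// => j _; rewrite eqxx.
have /existsP[j hj] : [exists j, h j != k j].
  apply: contraR hk; rewrite negb_exists => /forallP H.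
  by apply/eqP/ffunP => j; have := H j; rewrite negbK => /eqP.
by rewrite (bigD1 j) //= (negbTE hj) mul0r.
Qed.

Lemma cint_echar d (h k : {ffun 'I_d -> int}) :
  cint (fun x : pt d => echar h x * expi (- (2 * pi * dot k x))) = (h == k)%:R :> C.
Proof.
transitivity (cint (fun x : pt d =>
    \prod_(j < d) expi (2 * pi * (h j - k j)%:~R * tnth x j))).
  congr cint; apply/funext => x.
  rewrite /echar -expiD -expi_sum; congr expi.
  rewrite -mulrBr /dot -sumrB mulr_sumr; apply: eq_bigr => j _.
  by rewrite intrB; ring.
rewrite (@cint_prod R d (fun j t => expi (2 * pi * (h j - k j)%:~R * t))).
  rewrite -prod_nat_eq; apply: eq_bigr => j _.
  by rewrite cint1_expi subr_eq0.
by move=> j; exact: nice_expi.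
Qed.

Definition cos1 (k : nat) (t : R) : R :=
  Num.sqrt 2 ^+ (k != 0%N) * cos (pi * k%:R * t).

Lemma phiE d (k : {ffun 'I_d -> nat}) (x : pt d) :
  phi k x = \prod_(j < d) cos1 (k j) (tnth x j).
Proof.
rewrite /phi big_split /=; congr (_ * _).
rewrite -prodr_const big_mkcond; apply: eq_bigr => j _.
by rewrite inE; case: ifP.
Qed.

Lemma bounded_mfun_cos1 (k : nat) : bounded_mfun (cos1 k : TR -> R) id.
Proof. by apply: bounded_mfunM; [exact: bounded_mfun_cst | exact: bounded_mfun_cos]. Qed.

Lemma nice_phi d (k : {ffun 'I_d -> nat}) : nice (fun x : pt d => (phi k x)%:C%C : C).
Proof.
rewrite (_ : (fun x => _) = fun x : pt d =>
    \prod_(j < d) (cos1 (k j) (tnth x j))%:C%C).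
  apply: (@nice_prod_coord d (fun j t => (cos1 (k j) t)%:C%C)) => j.
  exact: nice_real (bounded_mfun_cos1 _).
by apply/funext => x; rewrite phiE rmorph_prod.
Qed.

Lemma Rintegral_cos1 (k l : nat) :
  \int[leb]_(t in `[0, 1]) (cos1 k t * cos1 l t) = (k == l)%:R.
Proof.
(* The product formula for cosines brings a factor 1/2; for k = l it is balanced by the squared sqrt
   2 if k is non-zero, and by two equal cosines if k = 0. *)
pose s : R := Num.sqrt 2 ^+ (k != 0%N) * Num.sqrt 2 ^+ (l != 0%N) / 2.
transitivity (\int[leb]_(t in `[0, 1])
  (s * (cos (pi * (k%:Z + l%:Z)%:~R * t) + cos (pi * (k%:Z - l%:Z)%:~R * t)))).
  apply: eq_Rintegral => t _; rewrite /cos1 /s intrD intrB -!pmulrn.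
  rewrite (_ : pi * (k%:R + l%:R) * t = pi * k%:R * t + pi * l%:R * t); last by ring.
  rewrite (_ : pi * (k%:R - l%:R) * t = pi * k%:R * t - pi * l%:R * t); last by ring.
  by rewrite cosD cosB; field.
have ic (a : R) : leb.-integrable `[0, 1] (EFin \o (fun t => cos (a * t))).
  exact: itv_integrable (bounded_mfun_cos a).
rewrite RintegralZl//; last first.
  exact: itv_integrable (bounded_mfunD (bounded_mfun_cos _) (bounded_mfun_cos _)).
rewrite RintegralD// !Rintegral_cos_int subr_eq0 !eqz_nat addn_eq0.
rewrite /s {s ic}; have [<-{l}|kl] := eqVneq k l.
  case: k => [|k] /=; first by rewrite !expr0 /=; field.
  by rewrite !expr1 -expr2 sqr_sqrtr//=; field.
rewrite (_ : _ && _ = false) ?addr0 ?mulr0//.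
by apply/negbTE; apply: contra kl => /andP[/eqP-> /eqP->].
Qed.

Lemma cint_phi d (k l : {ffun 'I_d -> nat}) :
  cint (fun x : pt d => (phi k x)%:C%C * (phi l x)%:C%C) = (k == l)%:R :> C.
Proof.
transitivity (cint (fun x : pt d =>
    \prod_(j < d) (cos1 (k j) (tnth x j) * cos1 (l j) (tnth x j))%:C%C : C)).
  congr cint; apply/funext => x.
  by rewrite -rmorphM !phiE -big_split rmorph_prod.
rewrite (@cint_prod R d (fun j t => (cos1 (k j) t * cos1 (l j) t)%:C%C)).
  rewrite -prod_nat_eq; apply: eq_bigr => j _.
  rewrite /cint1 /= Rintegral_cos1 Rintegral_cst// mul0r.
  by rewrite -(rmorph_nat (real_complex R)).
by move=> j; apply: nice_real; apply: bounded_mfunM; exact: bounded_mfun_cos1.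
Qed.

End orthonormality.

(** * Trigonometric polynomials: coefficients, norms, partial sums *)

Section finite_expansions.
Context {R : realType}.
Local Notation C := R[i].
Local Notation TR := (measurableTypeR R).
Local Notation pt d := (d.-tuple TR).

Lemma esum_finType (K : choiceType) (I : finType) (F : I -> K) (a : K -> R) :
  injective F -> \sum_(k \in range F) (a k)%:E = (\sum_i a (F i))%:E.
Proof.
move=> injF; rewrite fsbig_image; last by move=> i j _ _; exact: injF.
rewrite -sumEFin [RHS](@bigfs _ _ _ _ (index_enum I) xpredT) ?index_enum_uniq//.
  by apply: eq_fsbigl; rewrite set_true.
by move=> i _; rewrite mem_index_enum.
Qed.

Lemma esum_ge_finite (K : choiceType) (I : finType) (F : I -> K) (a : K -> R) :
  injective F -> (forall k, 0 <= a k) ->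
  ((\sum_i a (F i))%:E <= \esum_(k in [set: K]) (a k)%:E)%E.
Proof.
move=> injF a0; apply: esum_ge; exists (range F); last by rewrite esum_finType.
by split=> //; exact: finite_image.
Qed.

Lemma esum_eq_finite (K : choiceType) (I : finType) (F : I -> K) (a : K -> R) :
  injective F -> (forall k, 0 <= a k) -> (forall k, ~ range F k -> a k = 0) ->
  \esum_(k in [set: K]) (a k)%:E = (\sum_i a (F i))%:E.
Proof.
move=> injF a0 aF; rewrite -esum_finType// -esum_fset//; first last.
- by move=> k _; rewrite lee_fin.
- exact: finite_image.
rewrite [RHS]esum_mkcond; apply: eq_esum => k _.
by case: ifPn => // /negP; rewrite inE => /aF ->.
Qed.

(** One argument for both bases: [b'] is the conjugate of [b] for the characters, and [b] itself for
    the cosines. *)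
Lemma cint_expansion (K : choiceType) d (b b' : K -> pt d -> C) :
  (forall k, nice (b k)) -> (forall k, nice (b' k)) ->
  (forall k l, cint (fun x => b k x * b' l x) = (k == l)%:R) ->
  forall (I : finType) (F : I -> K) (c : I -> C) (l : K),
  cint (fun x => (\sum_i c i * b (F i) x) * b' l x) = \sum_i c i * (F i == l)%:R.
Proof.
move=> nb nb' ob I F c l.
transitivity (cint (fun x => \sum_i c i * (b (F i) x * b' l x))).
  by congr cint; apply/funext => x; rewrite mulr_suml; apply: eq_bigr => i _; rewrite mulrA.
rewrite (cint_sum _ _ _ (F := fun i x => b (F i) x * b' l x)).
  by apply: eq_bigr => i _; rewrite ob.
by move=> i; exact: niceM.
Qed.

Lemma sum_delta (I : finType) (K : eqType) (F : I -> K) (c : I -> C) i :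
  injective F -> \sum_j c j * (F j == F i)%:R = c i.
Proof.
move=> injF; rewrite (bigD1 i) //= eqxx mulr1 big1 ?addr0// => j ji.
by rewrite (inj_eq injF) (negbTE ji) mulr0.
Qed.

Lemma fourier_coef_expansion d (I : finType) (F : I -> {ffun 'I_d -> int})
    (c : I -> C) (l : {ffun 'I_d -> int}) :
  fourier_coef (fun x : pt d => \sum_i c i * echar (F i) x) l =
  \sum_i c i * (F i == l)%:R.
Proof.
apply: (@cint_expansion _ d (@echar R d) (fun k x => expi (- (2 * pi * dot k x)))).
- exact: nice_echar.
- exact: nice_echarN.
- exact: cint_echar.
Qed.

Lemma cos_coef_expansion d (I : finType) (F : I -> {ffun 'I_d -> nat})
    (c : I -> C) (l : {ffun 'I_d -> nat}) :
  cos_coef (fun x : pt d => \sum_i c i * (phi (F i) x)%:C%C) l =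
  \sum_i c i * (F i == l)%:R.
Proof.
apply: (@cint_expansion _ d (fun k x => (phi k x)%:C%C) (fun k x => (phi k x)%:C%C)).
- exact: nice_phi.
- exact: nice_phi.
- exact: cint_phi.
Qed.

Lemma sum_delta0 (I : finType) (K : eqType) (F : I -> K) (c : I -> C) l :
  (forall i, F i != l) -> \sum_j c j * (F j == l)%:R = 0.
Proof. by move=> Fl; rewrite big1// => j _; rewrite (negbTE (Fl j)) mulr0. Qed.

Lemma r_gt0 alpha (gamma : nat -> R) d (k : 'I_d -> int) :
  (forall j, 0 < gamma j) -> 0 < r alpha gamma k.
Proof. by move=> g0; apply: prodr_gt0 => j _; exact: r1_gt0. Qed.

Lemma korobov_sqnorm_expansion alpha gamma d (I : finType)
    (F : I -> {ffun 'I_d -> int}) (c : I -> C) : injective F ->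
  (forall j, 0 < gamma j) ->
  korobov_sqnorm alpha gamma (fun x : pt d => \sum_i c i * echar (F i) x) =
  (\sum_i normc (c i) ^+ 2 * r alpha gamma (F i))%:E.
Proof.
move=> injF g0; rewrite /korobov_sqnorm (esum_eq_finite injF).
- by congr EFin; apply: eq_bigr => i _; rewrite fourier_coef_expansion sum_delta.
- by move=> k; rewrite mulr_ge0 ?sqr_ge0// ltW// r_gt0.
- move=> k kF; rewrite fourier_coef_expansion sum_delta0.
    by rewrite ComplexField.Normc.normc0 expr0n mul0r.
  by move=> i; apply/eqP => Fik; apply: kF; exists i.
Qed.

Lemma cos_sqnorm_expansion alpha gamma d (I : finType)
    (F : I -> {ffun 'I_d -> nat}) (c : I -> C) : injective F ->
  (forall j, 0 < gamma j) ->
  cos_sqnorm alpha gamma (fun x : pt d => \sum_i c i * (phi (F i) x)%:C%C) =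
  (\sum_i normc (c i) ^+ 2 * r alpha gamma (fun j => (F i j)%:Z))%:E.
Proof.
move=> injF g0; rewrite /cos_sqnorm
  (@esum_eq_finite _ _ F (fun k => normc (cos_coef _ k) ^+ 2 * _) injF).
- by congr EFin; apply: eq_bigr => i _; rewrite cos_coef_expansion sum_delta.
- by move=> k; rewrite mulr_ge0 ?sqr_ge0// ltW// r_gt0.
- move=> k kF; rewrite cos_coef_expansion sum_delta0.
    by rewrite ComplexField.Normc.normc0 expr0n mul0r.
  by move=> i; apply/eqP => Fik; apply: kF; exists i.
Qed.

Lemma nice_echar_expansion d (I : finType) (F : I -> {ffun 'I_d -> int}) (c : I -> C) :
  nice (fun x : pt d => \sum_i c i * echar (F i) x).
Proof.
by apply: nice_sum => i _; apply: niceM; [exact: nice_cst | exact: nice_echar].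
Qed.

Lemma nice_phi_expansion d (I : finType) (F : I -> {ffun 'I_d -> nat}) (c : I -> C) :
  nice (fun x : pt d => \sum_i c i * (phi (F i) x)%:C%C).
Proof.
by apply: nice_sum => i _; apply: niceM; [exact: nice_cst | exact: nice_phi].
Qed.

Lemma box_inj d N : injective (@box d N).
Proof.
move=> h k /ffunP hk; apply/ffunP => j; have := hk j; rewrite !ffunE.
by move=> /(congr1 (fun m => m + N%:Z)); rewrite !subrK => -[] /val_inj.
Qed.

(** Membership in the space asks for pointwise convergence of the partial sums; for a trigonometric
    polynomial they are eventually constant. *)
Lemma fourier_psum_expansion d (I : finType) (F : I -> {ffun 'I_d -> int})
    (c : I -> C) N (x : pt d) : (forall i j, `|F i j| <= N%:Z) ->
  fourier_psum (fun x : pt d => \sum_i c i * echar (F i) x) N x =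
  \sum_i c i * echar (F i) x.
Proof.
move=> FN; rewrite /fourier_psum.
under eq_bigr => h _ do rewrite fourier_coef_expansion mulr_suml.
rewrite exchange_big /=; apply: eq_bigr => i _.
pose h0 : {ffun 'I_d -> 'I_(2 * N).+1} := [ffun j => inord (absz (F i j + N%:Z))].
have boxh0 : box h0 = F i.
  apply/ffunP => j; rewrite !ffunE inordK; have := FN i j;
    rewrite ler_norml; move: (F i j) => t; lia.
rewrite (bigD1 h0) //= -/(box h0) boxh0 eqxx mulr1 big1 ?addr0// => h hh0.
rewrite -/(box h) -boxh0 (inj_eq (@box_inj _ _)) eq_sym (negbTE hh0).
by rewrite mulr0 mul0r.
Qed.

Lemma cos_psum_expansion d (I : finType) (F : I -> {ffun 'I_d -> nat})
    (c : I -> C) N (x : pt d) : (forall i j, (F i j < N)%N) ->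
  cos_psum (fun x : pt d => \sum_i c i * (phi (F i) x)%:C%C) N x =
  \sum_i c i * (phi (F i) x)%:C%C.
Proof.
move=> FN; rewrite /cos_psum.
under eq_bigr => h _ do rewrite cos_coef_expansion mulr_suml.
rewrite exchange_big /=; apply: eq_bigr => i _.
pose h0 : {ffun 'I_d -> 'I_N} := [ffun j => Ordinal (FN i j)].
have h0E : [ffun j => h0 j : nat] = F i by apply/ffunP => j; rewrite !ffunE.
rewrite (bigD1 h0) //= h0E eqxx mulr1 big1 ?addr0// => h hh0.
rewrite (_ : (F i == _) = false) ?mulr0 ?mul0r//; apply/negbTE.
apply: contra hh0 => /eqP/ffunP Fh; apply/eqP/ffunP => j; apply/val_inj.
by rewrite !ffunE /= Fh ffunE.
Qed.

End finite_expansions.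

(** * Worst-case errors *)

Section worst_case_errors.
Context {R : realType}.
Local Notation C := R[i].
Local Notation TR := (measurableTypeR R).
Local Notation pt d := (d.-tuple TR).
Implicit Types (alpha : R) (gamma : nat -> R) (z : nat -> nat) (n d N : nat).

Lemma normc_ge0 (c : C) : 0 <= normc c.
Proof. by case: c => a b; exact: sqrtr_ge0. Qed.

Lemma normc_real (t : R) : normc t%:C%C = `|t|.
Proof. by rewrite /= expr0n addr0 sqrtr_sqr. Qed.

Lemma normc_nat (k : nat) : normc (k%:R : C) = k%:R.
Proof. by rewrite -(rmorph_nat (real_complex R)) normc_real ger0_norm. Qed.

Lemma normc_sum (I : Type) (s : seq I) (P : pred I) (F : I -> C) :
  normc (\sum_(i <- s | P i) F i) <= \sum_(i <- s | P i) normc (F i).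
Proof.
elim/big_rec2 : _ => [|i x y Pi h]; first by rewrite ComplexField.Normc.normc0.
by rewrite (le_trans (le_normcD _ _))// lerD2l.
Qed.

Lemma normc_sum_cauchy_schwarz (I : finType) (P : pred I) (a : I -> C) (t w : I -> R) :
  (forall i, 0 < w i) ->
  normc (\sum_(i | P i) a i * (t i)%:C%C) ^+ 2 <=
  (\sum_(i | P i) normc (a i) ^+ 2 * w i) * (\sum_(i | P i) t i ^+ 2 / w i).
Proof.
move=> w0; have sw i : 0 < Num.sqrt (w i) by rewrite sqrtr_gt0.
have := cauchy_schwarz P (fun i => normc (a i) * Num.sqrt (w i))
  (fun i => `|t i| / Num.sqrt (w i)).
under eq_bigr => i _ do rewrite mulrACA divff ?gt_eqF// mulr1.
under [in leRHS]eq_bigr => i _ do rewrite exprMn sqr_sqrtr ?ltW//.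
under [X in _ * X]eq_bigr => i _ do rewrite expr_div_n sqr_sqrtr ?ltW// real_normK ?num_real//.
apply: le_trans; rewrite ler_pXn2r ?nnegrE ?normc_ge0//; last first.
  by apply: sumr_ge0 => i _; rewrite mulr_ge0// normc_ge0.
apply: le_trans (normc_sum _ _ _) _; apply: ler_sum => i _.
by rewrite ComplexField.Normc.normcM normc_real.
Qed.

(** The shape of both upper bounds: an error is at most the truncation error [u N] of the rule plus
    a Cauchy-Schwarz bound over a finite box. *)
Lemma le_sqrt_limit (e S : R) (u v : nat -> R) :
  u @ \oo --> (0 : R) -> v @ \oo --> S ->
  (\forall N \near \oo, e <= u N + Num.sqrt (v N)) -> e <= Num.sqrt S.
Proof.
move=> u0 vS le.
have cs : (fun N => u N + Num.sqrt (v N)) @ \oo --> 0 + Num.sqrt S.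
  by apply: cvgD => //; apply: continuous_cvg => //; exact: sqrt_continuous.
rewrite -[leRHS]add0r -(cvg_lim (@Rhausdorff R) cs).
by apply: limr_ge => //; exact: cvgP cs.
Qed.

Lemma lattice_rule_sum d n z (I : Type) (s : seq I) (P : pred I) (c : I -> C)
    (F : I -> pt d -> C) :
  lattice_rule n z (fun x => \sum_(i <- s | P i) c i * F i x) =
  \sum_(i <- s | P i) c i * lattice_rule n z (F i).
Proof.
rewrite /lattice_rule exchange_big /= mulr_sumr; apply: eq_bigr => i _.
by rewrite -mulr_sumr mulrCA.
Qed.

Lemma frac_part_itv (y : R) : 0 <= frac_part y < 1.
Proof.
rewrite /frac_part subr_ge0 floor_le_tmp /= ltrBlDr addrC.
by rewrite -[1](mulr1z 1) -intrD floorD1_gt.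
Qed.

Lemma lattice_point_cube d n z i : cube (@lattice_point R d n z i).
Proof.
move=> j; rewrite tnth_mktuple.
by have /andP[-> /ltW ->] := frac_part_itv ((i * z j)%:R / n%:R).
Qed.

Lemma echar_lattice_point d n z i (h : {ffun 'I_d -> int}) :
  echar h (@lattice_point R d n z i) =
  expi (2 * pi * \sum_(j < d) (h j)%:~R * ((i * z j)%:R / n%:R)).
Proof.
rewrite echarE mulr_sumr expi_sum; apply: eq_bigr => j _.
rewrite tnth_mktuple /frac_part; set y := _ / n%:R.
rewrite -[RHS](expi_2piD_int _ (- (h j * Num.floor y))); congr expi.
by rewrite intrN intrM; ring.
Qed.

Lemma lattice_rule_echar d n z (h : {ffun 'I_d -> int}) : (0 < n)%N ->
  lattice_rule n z (@echar R d h) = (dual n z h)%:R.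
Proof.
move=> n0; rewrite /lattice_rule.
under eq_bigr => i _ do rewrite echar_lattice_point.
rewrite (sum_shift_periodic (G := fun i =>
  expi (2 * pi * \sum_(j < d) (h j)%:~R * ((i * z j)%:R / n%:R)))).
  by rewrite sum_expi_dual// mulrCA mulVf ?mulr1// pnatr_eq0 -lt0n.
rewrite (_ : \sum_(j < d) _ = (\sum_(j < d) h j * (z j)%:Z)%:~R); last first.
  rewrite rmorph_sum; apply: eq_bigr => j _ /=.
  by rewrite intrM natrM -pmulrn mulrAC divff ?mul1r// pnatr_eq0 -lt0n.
rewrite expi_2pi_int big1 ?mulr0 ?expi0// => j _.
by rewrite mul0n mul0r mulr0.
Qed.

(** A rule has finitely many nodes, so pointwise convergence suffices. The map [t] is the identity
    for the lattice rule and the tent for the transformed one. *)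
Lemma lattice_rule_cvg d n z (g : pt d -> C) (G : nat -> pt d -> C) :
  (forall x, cube x -> (fun N => normc (g x - G N x)) @ \oo --> (0 : R)) ->
  forall t : pt d -> pt d, (forall x, cube x -> cube (t x)) ->
  (fun N => normc (lattice_rule n z (G N \o t) - lattice_rule n z (g \o t)))
    @ \oo --> (0 : R).
Proof.
move=> gG t tc.
pose b N := n%:R^-1 * \sum_(1 <= i < n.+1)
   normc (g (t (@lattice_point R d n z i)) - G N (t (@lattice_point R d n z i))) : R.
have b0 : b @ \oo --> (0 : R).
  rewrite -(mulr0 n%:R^-1); apply: cvgZr.
  have := @cvg_sum_fin R _ (index_iota 1 n.+1) (fun i N =>
      normc (g (t (@lattice_point R d n z i)) - G N (t (@lattice_point R d n z i))))
    (fun=> 0) (fun i => gG _ (tc _ (@lattice_point_cube d n z i))).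
  by rewrite big1.
apply: (squeeze_cvgr _ (cvg_cst 0) b0); apply: nearW => N.
rewrite normc_ge0 /b /lattice_rule -mulrBr ComplexField.Normc.normcM.
rewrite ComplexField.Normc.normcV normc_nat ler_wpM2l ?invr_ge0//.
rewrite -sumrB; apply: le_trans (normc_sum _ _ _) _; apply: ler_sum => i _.
by rewrite -normcN opprB.
Qed.

Lemma dual_psum_pred0 alpha gamma n z d N :
  dual_psum alpha gamma n z d pred0 N =
  1 + \sum_(h : {ffun 'I_d -> 'I_(2 * N).+1} | box h != 0)
    (dual n z (box h))%:R / r alpha gamma (box h).
Proof.
rewrite /dual_psum.
pose h0 : {ffun 'I_d -> 'I_(2 * N).+1} :=
  [ffun=> Ordinal (leq_pmull N (isT : (0 < 2)%N) : (N < (2 * N).+1)%N)].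
have h00 : box h0 = 0 by apply/ffunP => j; rewrite !ffunE subrr.
rewrite (bigD1 h0) //=; congr (_ + _).
  rewrite h00 big1 ?mulr1.
    by rewrite /dual big1 ?dvdz0// => j _; rewrite ffunE mul0r.
  by move=> j _; rewrite ffunE /r1 eqxx divr1.
rewrite -h00; under eq_bigl => h do rewrite -(inj_eq (@box_inj _ _)).
apply: eq_bigr => h _; congr (_ * _).
by rewrite /r -prodfV; apply: eq_bigr => j _; rewrite div1r.
Qed.

Lemma cint_fourier_coef0 d (f : pt d -> C) : cint f = fourier_coef f 0.
Proof.
congr cint; apply/funext => x; rewrite /dot big1 ?mulr0 ?oppr0 ?expi0 ?mulr1//.
by move=> j _; rewrite ffunE mul0r.
Qed.

(** As [fine] sends +oo to 0, a bound on the norm carries information only together with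
    finiteness. *)
Lemma sqrt_fine_le1 (I : finType) (K : choiceType) (F : I -> K) (a : K -> R)
    (P : pred I) : injective F -> (forall k, 0 <= a k) ->
  (\esum_(k in [set: K]) (a k)%:E < +oo)%E ->
  Num.sqrt (fine (\esum_(k in [set: K]) (a k)%:E)) <= 1 ->
  \sum_(i | P i) a (F i) <= 1.
Proof.
move=> injF a0 fin.
have e0 : (0 <= \esum_(k in [set: K]) (a k)%:E)%E.
  by apply: esum_ge0 => k _; rewrite lee_fin.
rewrite -[leRHS]sqrtr1 ler_sqrt// => le1.
have := esum_ge_finite injF a0.
rewrite -[leRHS]fineK ?ge0_fin_numE// lee_fin => h.
apply: le_trans le1; apply: le_trans h.
by rewrite [leRHS](bigID P) /= lerDl sumr_ge0.
Qed.

Lemma wce_korobov_le alpha gamma n z d : 1 / 2 < alpha -> (0 < n)%N ->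
  (forall j, 0 < gamma j) ->
  (wce (korobov_space alpha gamma d) (lattice_rule n z) <=
   (Num.sqrt (dual_sum alpha gamma n z d pred0 - 1))%:E)%E.
Proof.
move=> al n0 g0; apply: ge_ereal_sup => _ [f [[_ fin fcvg] fle1] <-].
rewrite lee_fin.
apply: (le_sqrt_limit (lattice_rule_cvg n z fcvg (t := id) (fun _ => id))
  (v := fun N => dual_psum alpha gamma n z d pred0 N - 1)).
  apply: cvgB; [exact: dual_psum_cvg | exact: cvg_cst].
apply: nearW => N.
set Q := lattice_rule n z f; pose QN := lattice_rule n z (fourier_psum f N).
(* The first difference tends to 0; the second is a finite sum over the non-zero part of the dual
   lattice. *)
have -> : cint f - Q = (QN - Q) + (cint f - QN) by ring.
apply: le_trans (le_normcD _ _) _; rewrite lerD2l.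
have QNE : QN = \sum_(h : {ffun 'I_d -> 'I_(2 * N).+1})
    fourier_coef f (box h) * (dual n z (box h))%:R.
  rewrite /QN (lattice_rule_sum n z _ xpredT (fun h => fourier_coef f (box h))
    (fun h => echar (box h))).
  by apply: eq_bigr => h _; rewrite lattice_rule_echar.
pose h0 : {ffun 'I_d -> 'I_(2 * N).+1} :=
  [ffun=> Ordinal (leq_pmull N (isT : (0 < 2)%N) : (N < (2 * N).+1)%N)].
have h00 : box h0 = 0 by apply/ffunP => j; rewrite !ffunE subrr.
have -> : cint f - QN = - \sum_(h : {ffun 'I_d -> 'I_(2 * N).+1} | box h != 0)
    fourier_coef f (box h) * ((dual n z (box h))%:R : R)%:C%C.
  rewrite QNE (bigD1 h0) //= h00 cint_fourier_coef0 (_ : dual n z 0 = true).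
    rewrite mulr1 opprD addrA subrr sub0r; congr (- _).
    under eq_bigl => h do rewrite -(inj_eq (@box_inj _ _)) h00.
    by apply: eq_bigr => h _; rewrite rmorph_nat.
  by rewrite /dual big1 ?dvdz0// => j _; rewrite ffunE mul0r.
rewrite normcN -[leLHS]ger0_norm ?normc_ge0// -sqrtr_sqr ler_wsqrtr//.
rewrite (le_trans (normc_sum_cauchy_schwarz _ _ _
  (w := fun h => r alpha gamma (box h)) _))//.
  by move=> h; exact: r_gt0.
rewrite dual_psum_pred0 addrC addKr.
under [X in _ * X]eq_bigr => h _ do rewrite expr2 -natrM mulnb andbb.
rewrite ler_piMl//.
  by apply: sumr_ge0 => h _; rewrite divr_ge0// ltW// r_gt0.
apply: (@sqrt_fine_le1 _ _ (@box d N) (fun k => normc (fourier_coef f k) ^+ 2 * r alpha gamma k)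
   (fun h => box h != 0)) => //.
  exact: box_inj.
by move=> k; rewrite mulr_ge0 ?sqr_ge0// ltW// r_gt0.
Qed.

Lemma wce_korobov_ge alpha gamma n z d : 1 / 2 < alpha -> (0 < n)%N ->
  (forall j, 0 < gamma j) ->
  ((Num.sqrt (dual_sum alpha gamma n z d pred0 - 1))%:E <=
   wce (korobov_space alpha gamma d) (lattice_rule n z))%E.
Proof.
move=> al n0 g0.
have lower N : ((Num.sqrt (dual_psum alpha gamma n z d pred0 N - 1))%:E <=
   wce (korobov_space alpha gamma d) (lattice_rule n z))%E.
  rewrite dual_psum_pred0 addrC addKr; set S := \sum_(h | _) _.
  (* The case of equality of Cauchy-Schwarz in the box, scaled to norm at most 1. If S = 0, the
     division by 0 makes it the zero function, consistently with a lower bound equal to 0. *)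
  pose c (h : {ffun 'I_d -> 'I_(2 * N).+1}) : R :=
    (if box h != 0 then (dual n z (box h))%:R / r alpha gamma (box h) else 0) / Num.sqrt S.
  pose f (x : pt d) : C := \sum_h (c h)%:C%C * echar (box h) x.
  have S0 : 0 <= S by apply: sumr_ge0 => h _; rewrite divr_ge0// ltW// r_gt0.
  have sqf : korobov_sqnorm alpha gamma f =
      (\sum_(h : {ffun 'I_d -> 'I_(2 * N).+1}) c h ^+ 2 * r alpha gamma (box h))%:E.
    rewrite /f (korobov_sqnorm_expansion _ _ (@box_inj d N))//; congr EFin.
    by apply: eq_bigr => h _; rewrite normc_real real_normK ?num_real.
  have sq1 : \sum_(h : {ffun 'I_d -> 'I_(2 * N).+1}) c h ^+ 2 * r alpha gamma (box h) <= 1.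
    rewrite (_ : \sum_h _ = S / S).
      have [->|S1] := eqVneq S 0; first by rewrite mul0r.
      by rewrite divff.
    rewrite {1}/S [X in _ = X / _]big_mkcond [RHS]mulr_suml; apply: eq_bigr => h _.
    rewrite /c; case: ifP => _; last by rewrite !mul0r expr0n mul0r.
    have rh := r_gt0 alpha (box h) g0.
    rewrite !exprMn !exprVn sqr_sqrtr// [_%:R ^+ 2]expr2 -natrM mulnb andbb.
    rewrite [_^-2](_ : _ = (r alpha gamma (box h))^-1 * (r alpha gamma (box h))^-1).
      by rewrite -!mulrA [S^-1 * _]mulrC mulKf ?gt_eqF.
    by rewrite expr2 invfM.
  apply: le_trans (ereal_sup_ubound _); last first.
    exists f; last reflexivity.
    split; last by rewrite /= sqf /= -[leRHS]sqrtr1 ler_sqrt.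
    split.
    - by apply: nice_square_integrable; exact: nice_echar_expansion.
    - by rewrite sqf ltry.
    - move=> x _; apply: cvg_near_cst; near=> M.
      rewrite /f fourier_psum_expansion ?subrr ?ComplexField.Normc.normc0// => h j.
      have NM : (N <= M)%N by near: M; exists N.
      have hj := ltn_ord (h j); rewrite ffunE ler_norml.
      by move: (nat_of_ord (h j)) hj => m hj; clear -hj NM; lia.
  rewrite lee_fin (_ : cint f - _ = - (Num.sqrt S)%:C%C).
    by rewrite normcN normc_real ler_norm.
  rewrite cint_fourier_coef0 /f fourier_coef_expansion (lattice_rule_sum n z _ xpredT).
  rewrite big1 ?sub0r; last first.
    move=> h _; rewrite /c; case: (eqVneq (box h) 0) => [_|_]; last by rewrite mulr0.
    by rewrite mul0r rmorph0 mul0r.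
  congr (- _); rewrite (_ : Num.sqrt S = S / Num.sqrt S); last first.
    have [->|S1] := eqVneq S 0; first by rewrite sqrtr0 mul0r.
    by rewrite -{2}(sqr_sqrtr S0) expr2 mulfK// sqrtr_eq0 -ltNge lt_def S1.
  rewrite {1}/S [X in _ = (X / _)%:C%C]big_mkcond mulr_suml rmorph_sum; apply: eq_bigr => h _ /=.
  rewrite lattice_rule_echar// -(rmorph_nat (real_complex R)) -rmorphM /=.
  congr (_%:C%C); rewrite /c; case: ifP => _; last by rewrite !mul0r.
  by case: (dual _ _ _); rewrite ?mulr1// ?mulr0 !mul0r.
(* The upper bound makes the worst-case error a real number, so that the lower bounds on boxes pass
   to the limit in the reals. *)
have wfin : (wce (korobov_space alpha gamma d) (lattice_rule n z) \is a fin_num).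
  rewrite ge0_fin_numE.
    by apply: le_lt_trans (wce_korobov_le z d al n0 g0) _; rewrite ltry.
  by apply: le_trans (lower 0%N); rewrite lee_fin sqrtr_ge0.
rewrite -(fineK wfin) lee_fin.
have cs : (fun N => Num.sqrt (dual_psum alpha gamma n z d pred0 N - 1)) @ \oo -->
    Num.sqrt (dual_sum alpha gamma n z d pred0 - 1).
  apply: continuous_cvg; first exact: sqrt_continuous.
  by apply: cvgB; [exact: dual_psum_cvg | exact: cvg_cst].
rewrite -(cvg_lim (@Rhausdorff R) cs); apply: limr_le; first exact: cvgP cs.
by apply: nearW => N; rewrite -lee_fin fineK.
Unshelve. all: by end_near. Qed.

Lemma wce_korobov alpha gamma n z d : 1 / 2 < alpha -> (0 < n)%N ->
  (forall j, 0 < gamma j) ->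
  wce (korobov_space alpha gamma d) (lattice_rule n z) =
  (Num.sqrt (dual_sum alpha gamma n z d pred0 - 1))%:E.
Proof.
by move=> al n0 g0; apply/le_anti; rewrite wce_korobov_le// wce_korobov_ge.
Qed.

Lemma dual_sum_ge1 alpha gamma n z d : 1 / 2 < alpha -> (0 < n)%N ->
  (forall j, 0 < gamma j) -> 1 <= dual_sum alpha gamma n z d pred0.
Proof.
move=> al n0 g0; have cs := dual_psum_cvg (z := z) (d := d) (e := pred0) al n0 g0.
rewrite -(cvg_lim (@Rhausdorff R) cs); apply: limr_ge; first exact: cvgP cs.
apply: nearW => N; rewrite dual_psum_pred0 lerDl.
by apply: sumr_ge0 => h _; rewrite divr_ge0// ltW// r_gt0.
Qed.

End worst_case_errors.

(** * The tent transform in the cosine space *)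

Section tent_transform.
Context {R : realType}.
Local Notation C := R[i].
Local Notation TR := (measurableTypeR R).
Local Notation pt d := (d.-tuple TR).
Implicit Types (alpha : R) (gamma : nat -> R) (z : nat -> nat) (n d N : nat).

Lemma tent_cube d (x : pt d) : cube x -> cube (tent x).
Proof.
move=> xc j; rewrite tnth_mktuple /tent1; have /andP[x0 x1] := xc j.
by rewrite subr_ge0 gerBl normr_ge0 andbT ler_norml; apply/andP; split; lra.
Qed.

(** On the right half the tent is 2 - 2x, and the cosine absorbs the sign and the shift by 2 pi
    k. *)
Lemma cos_tent (k : nat) (x : R) : 0 <= x <= 1 ->
  cos (pi * k%:R * tent1 x) = cos (2 * pi * (k%:R * x)).
Proof.
move=> /andP[x0 x1]; rewrite /tent1; have [x2|x2] := leP (2 * x) 1.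
  rewrite ler0_norm; last by lra.
  by congr cos; ring.
rewrite gtr0_norm; last by lra.
rewrite (_ : _ * _ = - (2 * pi * (k%:R * x)) + 2 * pi * k%:R); last by ring.
rewrite -[RHS]cosN.
have [+ _] := expi_2piD_int (R := R) (- (k%:R * x)) k.
by rewrite -pmulrn mulrDr mulrN.
Qed.

Definition same_abs d N (h : {ffun 'I_d -> 'I_(2 * N).+1}) (k : 'I_d -> nat) : bool :=
  [forall j, absz (box h j) == k j].

(** The normalization of [phi k]; its square 2^|k|_0 is the number of integer vectors with absolute
    values k. *)
Definition sqrt2_support d (k : 'I_d -> nat) : R :=
  \prod_(j < d) Num.sqrt 2 ^+ (k j != 0%N).

Lemma same_absE d N (h : {ffun 'I_d -> 'I_(2 * N).+1}) (k : 'I_d -> nat) :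
  (same_abs h k)%:R = \prod_(j < d) (absz (box h j) == k j)%:R :> C.
Proof.
case: (boolP (same_abs h k)) => [/forallP H|].
  by rewrite big1// => j _; rewrite H.
by rewrite negb_forall => /existsP[j /negbTE hj]; rewrite (bigD1 j) //= hj mul0r.
Qed.

Lemma sum_same_abs1 N (k : nat) (y : R) : (k <= N)%N ->
  \sum_(h < (2 * N).+1) (absz ((h : nat)%:Z - N%:Z) == k)%:R *
     expi (2 * pi * (((h : nat)%:Z - N%:Z)%:~R * y)) =
  (Num.sqrt 2 ^+ (k != 0%N) * Num.sqrt 2 ^+ (k != 0%N) *
     cos (2 * pi * (k%:R * y)))%:C%C.
Proof.
move=> kN; rewrite (sum_ord_sym (fun m : int => (absz m == k)%:R *
     expi (2 * pi * (m%:~R * y)))) absz0.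
case: k kN => [|k] kN.
  rewrite eqxx mul1r !mul0r !mulr0 expi0 cos0 !mulr1 big1 ?addr0 ?rmorph1// => i _.
  by rewrite abszN /= !mul0r addr0.
rewrite [(0 == _)%N]eq_sym /= mul0r add0r (bigD1 (Ordinal kN)) //= !eqxx !mul1r.
rewrite big1 ?addr0; last first.
  move=> i ik; rewrite /= eqSS (_ : (i == k :> nat) = false) ?mul0r ?addr0//.
  by apply/negbTE; apply: contra ik => /eqP ik; apply/eqP/val_inj.
rewrite mulrNz mulNr mulrN expiN addcJ /= !expr1 -expr2 sqr_sqrtr//.
by rewrite -pmulrn rmorphM rmorph_nat.
Qed.

Lemma sum_same_abs d N (k : {ffun 'I_d -> nat}) (x : pt d) :
  (forall j, (k j <= N)%N) -> cube x ->
  \sum_(h : {ffun 'I_d -> 'I_(2 * N).+1}) (same_abs h k)%:R * echar (box h) x =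
  (sqrt2_support k * phi k (tent x))%:C%C.
Proof.
move=> kN xc; rewrite phiE /sqrt2_support -big_split rmorph_prod /=.
rewrite (eq_bigr (fun j : 'I_d => \sum_(h < (2 * N).+1)
    (absz ((h : nat)%:Z - N%:Z) == k j)%:R *
     expi (2 * pi * (((h : nat)%:Z - N%:Z)%:~R * tnth x j)))); last first.
  move=> j _; rewrite sum_same_abs1// /cos1 tnth_mktuple cos_tent; last exact: xc.
  by rewrite !mulrA.
rewrite bigA_distr_bigA /=; apply: eq_bigr => h _.
rewrite same_absE echarE -big_split; apply: eq_bigr => j _.
by rewrite /= /box ffunE mulrA.
Qed.

Lemma sqrt2_support_gt0 d (k : 'I_d -> nat) : 0 < sqrt2_support k.
Proof. by apply: prodr_gt0 => j _; rewrite exprn_gt0// sqrtr_gt0. Qed.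

(** Evaluation of [sum_same_abs] at the origin, a fixed point of the tent, where all characters and
    all unnormalized cosines are 1. *)
Lemma card_same_abs d N (k : {ffun 'I_d -> nat}) : (forall j, (k j <= N)%N) ->
  \sum_(h : {ffun 'I_d -> 'I_(2 * N).+1}) (same_abs h k)%:R = sqrt2_support k ^+ 2.
Proof.
move=> kN; apply: complexI; rewrite rmorph_sum.
pose x0 : pt d := [tuple of nseq d (0 : R)].
have x0E j : tnth x0 j = 0 by rewrite tnth_nseq.
have x0c : cube x0 by move=> j; rewrite x0E lexx ler01.
have phi0 : phi k (tent x0) = sqrt2_support k.
  rewrite phiE; apply: eq_bigr => j _; rewrite tnth_mktuple x0E /cos1 /tent1.
  by rewrite mulr0 add0r normrN1 subrr mulr0 cos0 mulr1.
rewrite expr2 -{2}phi0 -(sum_same_abs kN x0c); apply: eq_bigr => h _.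
rewrite rmorph_nat /echar /dot big1 ?mulr0 ?expi0 ?mulr1// => j _.
by rewrite x0E mulr0.
Qed.

Lemma lattice_rule_tent d N n z (k : {ffun 'I_d -> nat}) : (0 < n)%N ->
  (forall j, (k j <= N)%N) ->
  lattice_rule n z ((fun x : pt d => (phi k x)%:C%C : C) \o @tent R d) =
  ((sqrt2_support k)^-1 *
    \sum_(h : {ffun 'I_d -> 'I_(2 * N).+1}) (same_abs h k && dual n z (box h))%:R)%:C%C.
Proof.
move=> n0 kN; have s0 := sqrt2_support_gt0 k.
transitivity (lattice_rule n z (fun x : pt d =>
  \sum_(h : {ffun 'I_d -> 'I_(2 * N).+1})
    ((sqrt2_support k)^-1 * (same_abs h k)%:R)%:C%C * echar (box h) x)).
  congr (_ * _); apply: eq_bigr => i _ /=.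
  under eq_bigr => h _ do rewrite rmorphM rmorph_nat -mulrA.
  rewrite -mulr_sumr sum_same_abs//; last exact: lattice_point_cube.
  by rewrite -rmorphM /= mulKf ?gt_eqF.
rewrite (lattice_rule_sum n z _ xpredT _ (fun h => echar (box h))).
rewrite mulr_sumr rmorph_sum; apply: eq_bigr => h _.
by rewrite lattice_rule_echar// -(rmorph_nat (real_complex R)) -rmorphM /= -mulrA -natrM mulnb.
Qed.

Lemma r_same_abs alpha gamma d N (h : {ffun 'I_d -> 'I_(2 * N).+1}) (k : 'I_d -> nat) :
  same_abs h k -> r alpha gamma (fun j => (k j)%:Z) = r alpha gamma (box h).
Proof.
move=> /forallP hk; apply: eq_bigr => j _; rewrite /r1 -(eqP (hk j)).
by rewrite eqz_nat absz_eq0.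
Qed.

Lemma cint_cos_coef0 d (f : pt d -> C) (k : {ffun 'I_d -> nat}) :
  (forall j, k j = 0%N) -> cint f = cos_coef f k.
Proof.
move=> k0; congr cint; apply/funext => x; rewrite phiE big1 ?mulr1// => j _.
by rewrite /cos1 k0 mulr0 mul0r cos0 mulr1.
Qed.

Lemma sum_unique_le1 (I : finType) (P b : pred I) :
  (forall i j, b i -> b j -> i = j) -> \sum_(i | P i) (b i)%:R <= 1 :> R.
Proof.
move=> b1; case: (pickP (fun i => P i && b i)) => [i /andP[Pi bi]|Pb].
  rewrite (bigD1 i) //= bi big1 ?addr0// => j /andP[_ ji].
  by case: (boolP (b j)) => // bj; rewrite (b1 j i) ?eqxx in ji.
by rewrite big1// => i Pi; have := Pb i; rewrite Pi /= => ->.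
Qed.

(** Of the s^2 vectors h with absolute values k, let D lie in the dual lattice. Then (D / s)^2 <= D
    because D <= s^2, and D / r(k) is the sum of 1 / r(h) over these h. Each h serves at most one
    k. *)
Lemma tent_sum_le alpha gamma n z d N M : (0 < n)%N -> (forall j, 0 < gamma j) ->
  (N <= M)%N ->
  \sum_(k : {ffun 'I_d -> 'I_N.+1} | [exists j, k j != ord0])
    ((sqrt2_support (fun j => k j))^-1 * \sum_(h : {ffun 'I_d -> 'I_(2 * M).+1})
       (same_abs h (fun j => k j) && dual n z (box h))%:R) ^+ 2 /
    r alpha gamma (fun j => (k j : nat)%:Z) <=
  \sum_(h : {ffun 'I_d -> 'I_(2 * M).+1} | box h != 0)
    (dual n z (box h))%:R / r alpha gamma (box h).
Proof.
move=> n0 g0 NM.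
apply: (@le_trans _ _ (\sum_(k : {ffun 'I_d -> 'I_N.+1} | [exists j, k j != ord0])
    \sum_(h : {ffun 'I_d -> 'I_(2 * M).+1})
      (same_abs h (fun j => k j))%:R * ((dual n z (box h))%:R / r alpha gamma (box h)))).
  apply: ler_sum => k _; set D := \sum_h _; set s := sqrt2_support _.
  have s0 : 0 < s by exact: sqrt2_support_gt0.
  have D0 : 0 <= D by apply: sumr_ge0.
  have Ds : D <= s ^+ 2.
    rewrite (_ : s = sqrt2_support [ffun j => k j : nat]); last first.
      by apply: eq_bigr => j _; rewrite ffunE.
    rewrite -(@card_same_abs d M) => [|j]; last by rewrite ffunE (leq_trans _ NM)// -ltnS.
    apply: ler_sum => h _; rewrite (_ : same_abs h [ffun j => k j : nat] =
      same_abs h (fun j => k j)).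
      by case: (same_abs _ _); case: (dual _ _ _).
    by apply: eq_forallb => j; rewrite ffunE.
  apply: (@le_trans _ _ (D / r alpha gamma (fun j => (k j : nat)%:Z))).
    rewrite ler_wpM2r ?invr_ge0 ?(ltW (r_gt0 _ _ g0))//.
    rewrite exprMn exprVn expr2 mulrA ler_piMl//.
    by rewrite ler_pdivrMl ?mulr_gt0// mulr1 -expr2.
  rewrite /D mulr_suml; apply: ler_sum => h _.
  case: (boolP (same_abs h _)) => [sh|_]; last by rewrite !mul0r.
  by rewrite mul1r (r_same_abs _ _ sh).
rewrite exchange_big [leRHS]big_mkcond /=; apply: ler_sum => h _.
rewrite -mulr_suml.
have w0 : 0 <= (dual n z (box h))%:R / r alpha gamma (box h).
  by rewrite divr_ge0// ltW// r_gt0.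
case: ifPn => [_|]; last first.
  rewrite negbK => /eqP h0; rewrite big1 ?mul0r// => k /existsP[j kj].
  apply/eqP; rewrite pnatr_eq0 eqb0; apply: contra kj => /forallP/(_ j).
  by rewrite h0 ffunE absz0 eq_sym => /eqP kj; apply/eqP/val_inj.
rewrite ler_piMl//; apply: sum_unique_le1 => k l /forallP hk /forallP hl.
by apply/ffunP => j; apply/val_inj; rewrite /= -(eqP (hk j)) -(eqP (hl j)).
Qed.

Lemma wce_tent_le alpha gamma n z d : 1 / 2 < alpha -> (0 < n)%N ->
  (forall j, 0 < gamma j) ->
  (wce (cosine_space alpha gamma d) (tent_lattice_rule n z) <=
   (Num.sqrt (dual_sum alpha gamma n z d pred0 - 1))%:E)%E.
Proof.
move=> al n0 g0; apply: ge_ereal_sup => _ [f [[_ fin fcvg] fle1] <-].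
rewrite lee_fin.
apply: (le_sqrt_limit (lattice_rule_cvg n z fcvg (@tent_cube d))
  (v := fun N => dual_psum alpha gamma n z d pred0 N - 1)).
  apply: cvgB; [exact: dual_psum_cvg | exact: cvg_cst].
(* For N = 0 and d > 0 the partial sum is empty and lacks the term k = 0 that cancels the
   integral. *)
exists 1%N => // -[//|N] _ /=.
set Q := lattice_rule n z (f \o _); pose QN := lattice_rule n z (cos_psum f N.+1 \o @tent R d).
have -> : cint f - tent_lattice_rule n z f = (QN - Q) + (cint f - QN).
  by rewrite /tent_lattice_rule -/Q; ring.
apply: le_trans (le_normcD _ _) _; rewrite lerD2l.
pose T (k : {ffun 'I_d -> 'I_N.+1}) : R := (sqrt2_support (fun j => k j))^-1 *
  \sum_(h : {ffun 'I_d -> 'I_(2 * N.+1).+1})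
    (same_abs h (fun j => k j) && dual n z (box h))%:R.
pose k' (k : {ffun 'I_d -> 'I_N.+1}) : {ffun 'I_d -> nat} := [ffun j => k j : nat].
have QNE : QN = \sum_(k : {ffun 'I_d -> 'I_N.+1}) cos_coef f (k' k) * (T k)%:C%C.
  rewrite /QN (lattice_rule_sum n z _ xpredT (fun k => cos_coef f (k' k))
    (fun k x => (phi (k' k) (tent x))%:C%C)).
  apply: eq_bigr => k _; congr (_ * _).
  rewrite (@lattice_rule_tent d N.+1 n z (k' k) n0) => [|j]; last first.
    by rewrite ffunE ltnW.
  congr (_%:C%C); congr (_^-1 * _).
    by apply: eq_bigr => j _; rewrite ffunE.
  apply: eq_bigr => h _; congr ((_ && _)%:R).
  by rewrite /same_abs; apply: eq_forallb => j; rewrite [k' k j]ffunE.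
pose k0 : {ffun 'I_d -> 'I_N.+1} := [ffun=> ord0].
have k0E (k : {ffun 'I_d -> 'I_N.+1}) : (k != k0) = [exists j, k j != ord0].
  rewrite -negb_forall; congr (~~ _); apply/eqP/forallP => [-> j|H].
    by rewrite ffunE.
  by apply/ffunP => j; rewrite ffunE; apply/eqP.
have T0 : T k0 = 1.
  pose h0 : {ffun 'I_d -> 'I_(2 * N.+1).+1} :=
    [ffun=> Ordinal (leq_pmull N.+1 (isT : (0 < 2)%N) : (N.+1 < (2 * N.+1).+1)%N)].
  have h00 : box h0 = 0 by apply/ffunP => j; rewrite !ffunE subrr.
  rewrite /T /sqrt2_support big1 ?invr1 ?mul1r => [|j _]; last by rewrite ffunE.
  rewrite (bigD1 h0) //= big1 ?addr0.
    rewrite (_ : _ && _)//; apply/andP; split.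
      by apply/forallP => j; rewrite h00 !ffunE.
    by rewrite h00 /dual big1 ?dvdz0// => j _; rewrite ffunE mul0r.
  move=> h hh0; rewrite (_ : same_abs _ _ = false)//; apply/negbTE.
  apply: contra hh0 => /forallP hk; rewrite -(inj_eq (@box_inj _ _)) h00.
  by apply/eqP/ffunP => j; have := hk j; rewrite !ffunE /= absz_eq0 => /eqP.
have -> : cint f - QN = - \sum_(k : {ffun 'I_d -> 'I_N.+1} | [exists j, k j != ord0])
    cos_coef f (k' k) * (T k)%:C%C.
  rewrite QNE (bigD1 k0) //= T0 mulr1 (@cint_cos_coef0 _ f (k' k0)); last first.
    by move=> j; rewrite !ffunE.
  rewrite opprD addrA subrr sub0r; congr (- _).
  by apply: eq_bigl => k; rewrite k0E.
rewrite normcN -[leLHS]ger0_norm ?normc_ge0// -sqrtr_sqr ler_wsqrtr//.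
rewrite (le_trans (normc_sum_cauchy_schwarz _ _ _
  (w := fun k : {ffun 'I_d -> 'I_N.+1} => r alpha gamma (fun j => (k j : nat)%:Z)) _))//.
  by move=> k; exact: r_gt0.
have /= le2 := tent_sum_le alpha z d n0 g0 (leqnSn N).
rewrite dual_psum_pred0 addrC addKr; apply: le_trans le2.
rewrite ler_piMl//.
  by apply: sumr_ge0 => k _; rewrite divr_ge0 ?sqr_ge0// ltW// r_gt0.
have k'inj : injective k'.
  by move=> k l /ffunP kl; apply/ffunP => j; apply/val_inj; have := kl j; rewrite !ffunE.
have rE (k : {ffun 'I_d -> 'I_N.+1}) : r alpha gamma (fun j => (k j : nat)%:Z) =
    r alpha gamma (fun j => (k' k j)%:Z).
  by apply: eq_bigr => j _; rewrite [k' k j]ffunE.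
under eq_bigr => k _ do rewrite rE.
apply: (@sqrt_fine_le1 _ _ _ k' (fun k => normc (cos_coef f k) ^+ 2 *
   r alpha gamma (fun j => (k j)%:Z))) => //.
by move=> k; rewrite mulr_ge0 ?sqr_ge0// ltW// r_gt0.
Qed.

End tent_transform.

(** * The lower bound for linear cubature rules *)

Section fooling_function.
Context {R : realType}.
Local Notation C := R[i].
Local Notation TR := (measurableTypeR R).
Local Notation pt d := (d.-tuple TR).

Lemma mul_tr_row_eq0 k (u : 'rV[R]_k) : u *m u^T = 0 -> u = 0.
Proof.
move=> /matrixP/(_ 0 0); rewrite !mxE => /eqP.
rewrite psumr_eq0 => [/allP uu|j _]; last by rewrite mxE -expr2 sqr_ge0.
apply/rowP => j; rewrite mxE; have := uu j (mem_index_enum _).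
by rewrite mxE /= -expr2 sqrf_eq0 => /eqP.
Qed.

Lemma mul_tr_row_ge0 k (u : 'rV[R]_k) : 0 <= (u *m u^T) 0 0.
Proof.
by rewrite mxE; apply: sumr_ge0 => j _; rewrite mxE -expr2 sqr_ge0.
Qed.

(** P = 1 - B^T (B B^T)^-1 B, where the rows of B are a basis of the row space of A. Passing to a
    basis keeps the Gram matrix invertible when rows of A are dependent, as for nodes with equal
    first coordinates. The trace is k - rank A. *)
Lemma exists_kernel_projection m k (A : 'M[R]_(m, k)) :
  exists P : 'M[R]_k, [/\ A *m P = 0, P^T = P, P *m P = P &
    k%:R - m%:R <= \tr P].
Proof.
have [B [BE Bfree]] : exists B : 'M[R]_(\rank A, k), col_base A *m B = A /\ row_free B.
  by exists (row_base A); split; [exact: mulmx_base | exact: row_base_free].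
pose G := B *m B^T.
(* If u G = 0, then the squared norm u G u^T of u B vanishes. *)
have Gu : G \in unitmx.
  rewrite -row_free_unit -kermx_eq0; apply/eqP/row_matrixP => i.
  rewrite row0; set u := row i _.
  have uG : u *m G = 0 by rewrite /u -row_mul mulmx_ker row0.
  have uB : u *m B = 0.
    apply: mul_tr_row_eq0.
    by rewrite trmx_mul mulmxA -(mulmxA u) uG mul0mx.
  by apply: (row_free_inj Bfree); rewrite mul0mx.
pose P := 1%:M - B^T *m (invmx G *m B).
have GT : (invmx G)^T = invmx G by rewrite trmx_inv /G trmx_mul trmxK.
have BP : B *m P = 0.
  by rewrite mulmxBr mulmx1 mulmxA -/G mulKVmx// subrr.
exists P; split.
- by rewrite -BE -mulmxA BP mulmx0.
- by rewrite /P linearB /= trmx1 !trmx_mul trmxK GT mulmxA.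
- by rewrite {1}/P mulmxBl mul1mx -!mulmxA BP !mulmx0 subr0.
- rewrite /P linearB /= mxtrace1 mxtrace_mulC -mulmxA -/G mulVmx// mxtrace1.
  by rewrite lerD2l lerN2 ler_nat rank_leq_row.
Qed.

Lemma cos1_sqr_le2 k (t : R) : cos1 k t ^+ 2 <= 2.
Proof.
rewrite /cos1 exprMn; have c1 : cos (pi * k%:R * t) ^+ 2 <= 1.
  by rewrite -[leRHS](expr1n _ 2) -real_normK ?num_real// ler_pXn2r ?nnegrE// cos_max.
case: (k != 0%N); first by rewrite expr1 sqr_sqrtr// ler_piMr.
by rewrite expr0 expr1n mul1r (le_trans c1)// ler1n.
Qed.

(** The product formula for cosines, corrected by the normalizations; with truncated subtraction, (k
    - l) + (l - k) is |k - l|. *)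
Definition cos1_mul_coef (k l m : nat) : R :=
  Num.sqrt 2 ^+ (k != 0%N) * Num.sqrt 2 ^+ (l != 0%N) / 2 / Num.sqrt 2 ^+ (m != 0%N) *
  ((m == k + l)%N%:R + (m == (k - l) + (l - k))%N%:R).

Lemma cos1M M (k l : nat) (t : R) : (k < M)%N -> (l < M)%N ->
  cos1 k t * cos1 l t = \sum_(m < 2 * M) cos1_mul_coef k l m * cos1 m t.
Proof.
move=> kM lM.
have s0 (b : bool) : Num.sqrt 2 ^+ b != 0 :> R.
  by rewrite expf_neq0// gt_eqF// sqrtr_gt0.
pose s := Num.sqrt 2 ^+ (k != 0%N) * Num.sqrt 2 ^+ (l != 0%N) / 2 : R.
have pick (p : nat) : (p < 2 * M)%N ->
    \sum_(m < 2 * M) (m == p :> nat)%:R * cos (pi * m%:R * t) = cos (pi * p%:R * t).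
  move=> pM; rewrite (bigD1 (Ordinal pM)) //= eqxx mul1r big1 ?addr0// => i ip.
  rewrite (_ : (i == p :> nat) = false) ?mul0r//.
  by apply/negbTE; apply: contra ip => /eqP ip; apply/eqP/val_inj.
transitivity (s * (cos (pi * (k + l)%:R * t) + cos (pi * ((k - l) + (l - k))%N%:R * t))).
  have -> : cos (pi * ((k - l) + (l - k))%N%:R * t) = cos (pi * k%:R * t - pi * l%:R * t).
    have [kl|/ltnW lk] := leqP k l.
      rewrite (eqP kl) add0n natrB// -[LHS]cosN; congr cos; ring.
    rewrite (eqP lk) addn0 natrB//; congr cos; ring.
  rewrite natrD (_ : pi * (k%:R + l%:R) * t = pi * k%:R * t + pi * l%:R * t); last by ring.
  by rewrite cosD cosB /s /cos1; field.
rewrite -(pick (k + l)%N); last by lia.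
rewrite -(pick ((k - l) + (l - k))%N); last by lia.
rewrite -big_split mulr_sumr; apply: eq_bigr => m _ /=.
rewrite /cos1_mul_coef /cos1 -/s -mulrDl; move: (s0 (m != 0%N :> nat)).
by set q := _ ^+ (m != 0%N :> nat) => q0; field.
Qed.

(** The obstruction to fast convergence is already one-dimensional: all non-zero frequencies are put
    in the first coordinate. *)
Definition first_coord d (m : nat) : {ffun 'I_d.+1 -> nat} :=
  [ffun j => if j == ord0 then m else 0%N].

Lemma phi_first_coord d m (x : pt d.+1) : phi (first_coord d m) x = cos1 m (tnth x ord0).
Proof.
rewrite phiE big_ord_recl ffunE eqxx big1 ?mulr1// => j _.
by rewrite ffunE /cos1 mulr0 mul0r cos0 mulr1.
Qed.

Lemma first_coord_inj d : injective (first_coord d).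
Proof. by move=> m m' /ffunP/(_ ord0); rewrite !ffunE eqxx. Qed.

Lemma r_first_coord alpha (gamma : nat -> R) d m :
  r alpha gamma (fun j => (first_coord d m j)%:Z) = r1 alpha (gamma 0%N) m%:Z.
Proof.
by rewrite /r big_ord_recl ffunE eqxx big1 ?mulr1// => j _; rewrite ffunE.
Qed.

Section fool.
Context (d n : nat) (x : 'I_n -> pt d.+1).
Local Notation M := (2 * n)%N.

(* The function is t |-> v(t) P v(t)^T, where v(t) lists the first 2n cosines at
   t and P projects onto the vectors orthogonal to all the v(x_i); its mean value
   is tr P. *)
Lemma exists_fooling_coefs : exists c : 'I_(2 * M) -> R,
  [/\ forall i, \sum_m c m * cos1 m (tnth (x i) ord0) = 0,
      forall t, 0 <= \sum_m c m * cos1 m t <= 2 * M%:R &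
      forall m : 'I_(2 * M), m = 0%N :> nat -> n%:R <= c m].
Proof.
pose A : 'M[R]_(n, M) := \matrix_(i, k) cos1 k (tnth (x i) ord0).
have [P [AP PT PP trP]] := exists_kernel_projection A.
pose v (t : R) : 'rV[R]_M := \row_k cos1 k t.
pose c (m : 'I_(2 * M)) : R := \sum_k \sum_l P k l * cos1_mul_coef k l m.
have gE t : \sum_m c m * cos1 m t = (v t *m P *m (v t)^T) 0 0.
  rewrite mxE; under [RHS]eq_bigr => l _ do rewrite !mxE mulr_suml.
  rewrite [RHS]exchange_big /=.
  transitivity (\sum_(k < M) \sum_(l < M) P k l * (cos1 k t * cos1 l t)).
    under [RHS]eq_bigr => k _ do under eq_bigr => l _ do
      rewrite (cos1M _ (ltn_ord k) (ltn_ord l)) mulr_sumr.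
    under [RHS]eq_bigr => k _ do rewrite exchange_big.
    rewrite [RHS]exchange_big; apply: eq_bigr => m _.
    rewrite mulr_suml; apply: eq_bigr => k _.
    by rewrite mulr_suml; apply: eq_bigr => l _; rewrite mulrA.
  apply: eq_bigr => k _; apply: eq_bigr => l _.
  by rewrite !mxE; ring.
have sq t : (v t *m P *m (v t)^T) = (v t *m P) *m (v t *m P)^T.
  by rewrite trmx_mul PT !mulmxA -(mulmxA (v t) P P) PP.
(* The coefficient of index 0 is the mean value, and by orthonormality only the diagonal of P
   contributes to it. *)
have tr0 (m : 'I_(2 * M)) : m = 0%N :> nat -> c m = \tr P.
  move=> m0; apply: complexI.
  pose f (y : pt d.+1) : C := \sum_m (c m)%:C%C * (phi (first_coord d m) y)%:C%C.
  have fE y : f y = \sum_(k < M) \sum_(l < M) (P k l)%:C%C *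
      ((phi (first_coord d k) y)%:C%C * (phi (first_coord d l) y)%:C%C).
    rewrite /f; transitivity ((\sum_m c m * cos1 m (tnth y ord0))%:C%C : C).
      by rewrite rmorph_sum; apply: eq_bigr => j _; rewrite phi_first_coord -rmorphM.
    rewrite gE mxE; under eq_bigr => l _ do rewrite !mxE mulr_suml.
    rewrite exchange_big rmorph_sum; apply: eq_bigr => k _ /=.
    rewrite rmorph_sum; apply: eq_bigr => l _.
    by rewrite !phi_first_coord !mxE -!rmorphM; congr (_%:C%C); ring.
  have nphi k := @nice_phi R d.+1 (first_coord d k).
  transitivity (cint f).
    rewrite (@cint_cos_coef0 R _ f (first_coord d 0)); last first.
      by move=> j; rewrite ffunE; case: ifP.
    have -> : first_coord d 0 = first_coord d m by rewrite m0.
    rewrite /f (cos_coef_expansion (fun m : 'I_(2 * M) => first_coord d m)).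
    rewrite (@sum_delta _ _ _ (fun m : 'I_(2 * M) => first_coord d m))//.
    by move=> i j /first_coord_inj/val_inj.
  transitivity (cint (fun y : pt d.+1 => \sum_(kl : 'I_M * 'I_M) (P kl.1 kl.2)%:C%C *
      ((phi (first_coord d kl.1) y)%:C%C * (phi (first_coord d kl.2) y)%:C%C) : C)).
    congr cint; apply/funext => y; rewrite fE pair_big /=.
    by apply: eq_bigr => -[].
  rewrite (cint_sum _ _ _ (F := fun (kl : 'I_M * 'I_M) y =>
      (phi (first_coord d kl.1) y)%:C%C * (phi (first_coord d kl.2) y)%:C%C)); last first.
    by move=> kl; exact: niceM.
  rewrite /mxtrace rmorph_sum -(pair_big xpredT xpredT (fun k l : 'I_M => (P k l)%:C%C *
     cint (fun y => (phi (first_coord d k) y)%:C%C * (phi (first_coord d l) y)%:C%C))) /=.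
  apply: eq_bigr => k _; rewrite (bigD1 k) //= cint_phi eqxx mulr1 big1 ?addr0// => l lk.
  rewrite cint_phi (_ : (_ == _) = false) ?mulr0//; apply/negbTE.
  by apply: contra lk => /eqP/first_coord_inj/val_inj->.
exists c; split.
- move=> i; rewrite gE (_ : v _ = row i A) -?row_mul ?AP ?row0 ?mul0mx ?mxE//.
  by apply/rowP => k; rewrite !mxE.
- move=> t; rewrite gE; apply/andP; split; first by rewrite sq mul_tr_row_ge0.
  (* A projection does not increase the norm, and |v(t)|^2 <= 2 M since each squared cosine is at
     most 2. *)
  have : 0 <= (v t *m (v t)^T) 0 0 - (v t *m P *m (v t)^T) 0 0.
    have -> : (v t *m (v t)^T) 0 0 - (v t *m P *m (v t)^T) 0 0 =
        ((v t - v t *m P) *m (v t - v t *m P)^T) 0 0.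
      have -> : (v t - v t *m P) *m (v t - v t *m P)^T =
          v t *m (v t)^T - v t *m P *m (v t)^T.
        rewrite linearB /= mulmxBr !mulmxBl -sq trmx_mul PT.
        by rewrite (mulmxA (v t) P) subrr subr0.
      by rewrite [RHS]mxE [X in _ = _ + X]mxE.
    exact: mul_tr_row_ge0.
  rewrite subr_ge0 => /le_trans; apply; rewrite mxE.
  apply: (@le_trans _ _ (\sum_(k < M) 2)).
    by apply: ler_sum => k _; rewrite !mxE -expr2 cos1_sqr_le2.
  by rewrite sumr_const card_ord mulr_natr.
- move=> m m0; rewrite tr0//; apply: le_trans trP.
  by rewrite natrM; lra.
Qed.

End fool.

Lemma le_cint_real d (g : pt d -> R) B : bounded_mfun g id -> (forall x, g x <= B) ->
  complex.Re (cint (fun x => (g x)%:C%C)) <= B.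
Proof.
move=> bg gB /=; rewrite -[leRHS]/(complex.Re (Complex B 0)) -(cint_cst d (Complex B 0)) /=.
have mC := @measurable_cube R d.
apply: le_Rintegral => //; [exact: cube_integrable|].
exact: (cube_integrable (bounded_mfun_cst _ _)).
Qed.

(** The rule returns 0 on the fooling function whatever its weights, so the error is the integral,
    at least n. As L = 4n bounds both values and frequencies, Parseval bounds the sum of the c_m^2
    by L^2, and the norm is at most B = L^(1 + alpha) / sqrt(gamma_0). The asserted bound is n /
    B. *)
Lemma wce_linear_rule_ge (alpha : R) (gamma : nat -> R) d n (w : 'I_n -> C)
    (x : 'I_n -> pt d.+1) : 0 < alpha -> 0 < gamma 0%N <= 1 ->
  (forall j, 0 < gamma j) -> (0 < n)%N ->
  ((Num.sqrt (gamma 0%N) / (4 * 4 `^ alpha) * n%:R `^ (- alpha))%:E <=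
   wce (cosine_space alpha gamma d.+1) (linear_rule w x))%E.
Proof.
move=> al /andP[g0 g1] gp n0.
have [c [cx cb c0]] := exists_fooling_coefs x.
pose F (m : 'I_(2 * (2 * n))) := first_coord d m.
have Finj : injective F by move=> i j /first_coord_inj/val_inj.
pose L : R := 4 * n%:R.
have n0R : 0 < n%:R :> R by rewrite ltr0n.
have L0 : 0 < L by rewrite /L; lra.
have L1 : 1 <= L by rewrite /L -natrM ler1n muln_gt0.
have LE : 2 * (2 * n)%:R = L by rewrite /L natrM; ring.
pose B := L `^ alpha * L / Num.sqrt (gamma 0%N).
have sg0 : 0 < Num.sqrt (gamma 0%N) by rewrite sqrtr_gt0.
have B0 : 0 < B by rewrite divr_gt0// mulr_gt0// powR_gt0.
have rF m : r alpha gamma (fun j => (F m j)%:Z) <= (L `^ alpha) ^+ 2 / gamma 0%N.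
  have -> : (L `^ alpha) ^+ 2 = L `^ (2 * alpha).
    by rewrite -powR_mulrn ?powR_ge0// -powRrM mulrC.
  rewrite r_first_coord /r1; case: ifP => _.
    rewrite ler_pdivlMr// mul1r (le_trans g1)//.
    apply: (@le_trans _ _ (L `^ 0)); first by rewrite powRr0.
    by rewrite ler_powR//; lra.
  rewrite ler_wpM2r ?invr_ge0 ?(ltW g0)//= ge0_ler_powR ?nnegrE ?(ltW L0)//; first lra.
  rewrite -LE -natrM ler_nat; exact: ltnW.
pose f (y : pt d.+1) : C := \sum_m (c m)%:C%C * (phi (F m) y)%:C%C.
pose g (y : pt d.+1) : R := \sum_m c m * cos1 m (tnth y ord0).
have fg y : f y = (g y)%:C%C.
  rewrite /f /g rmorph_sum; apply: eq_bigr => m _.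
  by rewrite phi_first_coord -rmorphM.
have nf : nice f by exact: nice_phi_expansion.
have bg : bounded_mfun g id.
  have [+ _] := nf; rewrite (_ : f = fun y => (g y)%:C%C)//.
  exact/funext.
have parseval : \sum_m c m ^+ 2 <= L ^+ 2.
  apply: (@le_trans _ _ (complex.Re (cint (fun y => (g y * g y)%:C%C)))).
    rewrite (_ : cint _ = (\sum_m c m ^+ 2)%:C%C)//.
    transitivity (cint (fun y => \sum_m (c m)%:C%C * (f y * (phi (F m) y)%:C%C))).
      congr cint; apply/funext => y.
      transitivity (\sum_m (g y)%:C%C * ((c m)%:C%C * (phi (F m) y)%:C%C)).
        by rewrite -mulr_sumr -/(f y) fg -rmorphM.
      by apply: eq_bigr => m _; rewrite fg mulrCA.
    rewrite (cint_sum _ _ _ (F := fun m y => f y * (phi (F m) y)%:C%C)); last first.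
      by move=> m; apply: niceM => //; exact: nice_phi.
    rewrite rmorph_sum; apply: eq_bigr => m _ /=.
    rewrite -/(cos_coef f (F m)) /f cos_coef_expansion sum_delta//.
    by rewrite expr2 rmorphM.
  apply: le_cint_real; first exact: bounded_mfunM.
  move=> y; have := cb (tnth y ord0); rewrite LE => /andP[gy0 gy1].
  by rewrite -expr2 ler_pXn2r ?nnegrE ?(ltW L0).
pose c' m : C := (c m / B)%:C%C.
pose f' (y : pt d.+1) : C := \sum_m c' m * (phi (F m) y)%:C%C.
have f'E y : f' y = (B^-1)%:C%C * f y.
  by rewrite /f' /f mulr_sumr; apply: eq_bigr => m _; rewrite /c' rmorphM /=; ring.
have sqE : cos_sqnorm alpha gamma f' =
    (\sum_m (c m / B) ^+ 2 * r alpha gamma (fun j => (F m j)%:Z))%:E.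
  rewrite /f' cos_sqnorm_expansion//; congr EFin; apply: eq_bigr => m _.
  by rewrite normc_real real_normK ?num_real.
have sq1 : \sum_m (c m / B) ^+ 2 * r alpha gamma (fun j => (F m j)%:Z) <= 1.
  apply: (@le_trans _ _ (\sum_m c m ^+ 2 * (B ^- 2 * ((L `^ alpha) ^+ 2 / gamma 0%N)))).
    apply: ler_sum => m _; rewrite exprMn exprVn -mulrA ler_wpM2l ?sqr_ge0//.
    by rewrite ler_wpM2l ?invr_ge0 ?sqr_ge0.
  rewrite -mulr_suml.
  have -> : B ^- 2 * ((L `^ alpha) ^+ 2 / gamma 0%N) = L ^- 2.
    have pL : L `^ alpha != 0 by rewrite gt_eqF// powR_gt0.
    rewrite /B; set s := Num.sqrt _ in sg0 *.
    have -> : gamma 0%N = s ^+ 2 by rewrite sqr_sqrtr// ltW.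
    by field; rewrite pL !gt_eqF.
  by rewrite ler_pdivrMr ?exprn_gt0// mul1r.
apply: le_trans (ereal_sup_ubound _); last first.
  exists f'; last reflexivity.
  split; last by rewrite /= sqE /= -[leRHS]sqrtr1 ler_sqrt.
  split.
  - by apply: nice_square_integrable; exact: nice_phi_expansion.
  - by rewrite sqE ltry.
  - move=> y _; apply: cvg_near_cst; exists (2 * (2 * n))%N => // N /= NM.
    rewrite /f' cos_psum_expansion ?subrr ?ComplexField.Normc.normc0// => m j.
    rewrite /F ffunE; case: ifP => _; first exact: leq_trans NM.
    by apply: leq_trans NM; rewrite !muln_gt0 n0.
rewrite lee_fin (_ : linear_rule w x f' = 0); last first.
  rewrite /linear_rule big1// => i _; rewrite f'E fg (_ : g (x i) = 0) ?mulr0//.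
  exact: cx.
have M0 : (0 < 2 * (2 * n))%N by rewrite !muln_gt0.
rewrite subr0 (_ : cint f' = c' (Ordinal M0)); last first.
  rewrite (@cint_cos_coef0 R _ f' (F (Ordinal M0))); last first.
    by move=> j; rewrite /F ffunE; case: ifP.
  by rewrite /f' cos_coef_expansion sum_delta.
rewrite /c' normc_real; apply: le_trans (ler_norm _).
rewrite ler_pdivlMr//; apply: le_trans (c0 (Ordinal M0) erefl).
rewrite /B /L powRM// powRN.
have p4 : 4 `^ alpha != 0 :> R by rewrite gt_eqF// powR_gt0.
have pn : n%:R `^ alpha != 0 :> R by rewrite gt_eqF// powR_gt0.
rewrite le_eqVlt; apply/orP; left; apply/eqP; field.
by rewrite p4 pn gt_eqF.
Qed.

Lemma not_powR_bound (kappa c a b : R) : 0 < kappa -> a < b ->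
  ~ \forall n \near \oo, kappa * n%:R `^ (- a) <= c * n%:R `^ (- b).
Proof.
move=> k0 ab [N _ bound].
(* For n > X, the power n^(b - a) exceeds |c| / kappa + 1, against the assumed bound. *)
pose X := (`|c| / kappa + 1) `^ (1 / (b - a)).
pose n := (maxn N (Num.truncn X)).+1.
have Nn : (N <= n)%N by rewrite /n leqW// leq_maxl.
have Xn : X < n%:R.
  apply: lt_le_trans (truncnS_gt X) _; rewrite ler_nat ltnS; exact: leq_maxr.
have n0 : 0 < n%:R :> R by rewrite ltr0n.
have pna : 0 < n%:R `^ a by rewrite powR_gt0.
have pnb : 0 < n%:R `^ b by rewrite powR_gt0.
have ba : 0 < b - a by rewrite subr_gt0.
have := bound n Nn => /=; rewrite !powRN.
rewrite ler_pdivrMr// mulrAC ler_pdivlMr//.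
have -> : n%:R `^ b = n%:R `^ (b - a) * n%:R `^ a.
  by rewrite -powRD ?subrK// (gt_eqF n0) implybT.
rewrite mulrA ler_pM2r// => le1.
have lt1 : `|c| / kappa + 1 < n%:R `^ (b - a).
  have -> : `|c| / kappa + 1 = X `^ (b - a).
    rewrite /X -powRrM div1r mulVf ?gt_eqF// powRr1//.
    by rewrite addr_ge0// divr_ge0// ltW.
  by rewrite gt0_ltr_powR// ?nnegrE ?powR_ge0// ltW.
have : kappa * (`|c| / kappa + 1) < kappa * n%:R `^ (b - a) by rewrite ltr_pM2l.
rewrite mulrDr mulrCA divff ?gt_eqF// !mulr1 => lt2.
have := ler_norm c; lra.
Qed.

End fooling_function.

(** * Programs and the fast Fourier transform *)

Section commands.
Context {R : realType} (K : R -> R).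
Implicit Types (s t : memory R) (c : cmd).
Local Notation run := (run K).
Local Notation reval := (reval K).
Local Notation beval := (beval K).
Local Notation cost := (cost K).

(** A syntactic over-approximation of the arrays that a command changes; it gives the frame rules
    [imem_run] and [rmem_run]. *)
Fixpoint iwrites c : seq nat :=
  match c with
  | Skip | RSet _ _ _ => [::]
  | ISet a _ _ => [:: a]
  | Seq c1 c2 | If _ c1 c2 => iwrites c1 ++ iwrites c2
  | For a _ c1 => a :: iwrites c1
  end.

Fixpoint rwrites c : seq nat :=
  match c with
  | Skip | ISet _ _ _ => [::]
  | RSet a _ _ => [:: a]
  | Seq c1 c2 | If _ c1 c2 => rwrites c1 ++ rwrites c2
  | For _ _ c1 => rwrites c1
  end.

Lemma for_ind (P : nat -> memory R -> Prop) a e c s : P 0%N s ->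
  (forall k t, (k < ieval s e)%N -> P k t -> P k.+1 (run c (iset t a 0 k))) ->
  P (ieval s e) (run (For a e c) s).
Proof.
move=> P0 PS /=; move: (ieval s e) PS => N.
elim: N => //= N IH PS; apply: (PS); first exact: ltnSn.
by apply: IH => k t kN; apply: (PS); exact: ltnW.
Qed.

Lemma run_Seq c1 c2 s : run (Seq c1 c2) s = run c2 (run c1 s).
Proof. by []. Qed.

Lemma run_ISet a i e s : run (ISet a i e) s = iset s a (ieval s i) (ieval s e).
Proof. by []. Qed.

Lemma run_RSet a i e s : run (RSet a i e) s = rset s a (ieval s i) (reval s e).
Proof. by []. Qed.

Lemma run_If b c1 c2 s :
  run (If b c1 c2) s = if beval s b then run c1 s else run c2 s.
Proof. by []. Qed.

Lemma run_Skip s : run Skip s = s.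
Proof. by []. Qed.

Definition runE := (run_Seq, run_ISet, run_RSet, run_If, run_Skip).

Lemma imem_run c s a : a \notin iwrites c -> imem (run c s) a = imem s a.
Proof.
elim: c s => //=.
- by move=> b e e' s; rewrite inE => ab; apply/funext => j; rewrite /upd (negbTE ab).
- by move=> c1 IH1 c2 IH2 s; rewrite mem_cat negb_or => /andP[a1 a2]; rewrite IH2// IH1.
- move=> b c1 IH1 c2 IH2 s; rewrite mem_cat negb_or => /andP[a1 a2].
  by case: ifP => _; [exact: IH1 | exact: IH2].
- move=> b e c1 IH1 s; rewrite inE negb_or => /andP[ab a1].
  elim: (ieval s e) => //= N IH; rewrite IH1// -IH.
  by apply/funext => j; rewrite /= /upd (negbTE ab).
Qed.

Lemma rmem_run c s a : a \notin rwrites c -> rmem (run c s) a = rmem s a.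
Proof.
elim: c s => //=.
- by move=> b e e' s; rewrite inE => ab; apply/funext => j; rewrite /upd (negbTE ab).
- by move=> c1 IH1 c2 IH2 s; rewrite mem_cat negb_or => /andP[a1 a2]; rewrite IH2// IH1.
- move=> b c1 IH1 c2 IH2 s; rewrite mem_cat negb_or => /andP[a1 a2].
  by case: ifP => _; [exact: IH1 | exact: IH2].
- move=> b e c1 IH1 s a1.
  by elim: (ieval s e) => //= N IH; rewrite IH1// -IH.
Qed.

Fixpoint ireads (e : iexp) : seq nat :=
  match e with
  | ICst _ => [::]
  | IGet a e1 => a :: ireads e1
  | IAdd e1 e2 | ISub e1 e2 | IMul e1 e2 | IDiv e1 e2 | IMod e1 e2 =>
      ireads e1 ++ ireads e2
  end.

Lemma eq_ieval (A : pred nat) s t e : (forall a, A a -> imem s a = imem t a) ->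
  all A (ireads e) -> ieval s e = ieval t e.
Proof.
move=> st; elim: e => //=.
- by move=> a e IH /andP[Aa /IH ->]; rewrite st.
- by move=> e1 IH1 e2 IH2; rewrite all_cat => /andP[/IH1-> /IH2->].
- by move=> e1 IH1 e2 IH2; rewrite all_cat => /andP[/IH1-> /IH2->].
- by move=> e1 IH1 e2 IH2; rewrite all_cat => /andP[/IH1-> /IH2->].
- by move=> e1 IH1 e2 IH2; rewrite all_cat => /andP[/IH1-> /IH2->].
- by move=> e1 IH1 e2 IH2; rewrite all_cat => /andP[/IH1-> /IH2->].
Qed.

Fixpoint bounds_read (A : pred nat) c : bool :=
  match c with
  | Skip | ISet _ _ _ | RSet _ _ _ => true
  | Seq c1 c2 | If _ c1 c2 => bounds_read A c1 && bounds_read A c2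
  | For _ e c1 => all A (ireads e) && bounds_read A c1
  end.

(* The cost of [c] when all its loop bounds are evaluated in the initial state
   and both branches of every test are paid for. *)
Fixpoint max_cost c s : nat :=
  match c with
  | Skip => 1
  | ISet _ i e => (icost i + icost e).+1
  | RSet _ i e => (icost i + rcost e).+1
  | Seq c1 c2 => max_cost c1 s + max_cost c2 s
  | If b c1 c2 => bcost b + (max_cost c1 s + max_cost c2 s)
  | For _ e c1 => (icost e).+1 + ieval s e * (max_cost c1 s).+1
  end%N.

(** Loop bounds read only arrays in [A], and these are never written, so every bound keeps its
    initial value. *)
Lemma cost_le_max_cost (A : pred nat) c s t : all (predC A) (iwrites c) ->
  bounds_read A c -> (forall a, A a -> imem t a = imem s a) ->
  (cost c t <= max_cost c s)%N.
Proof.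
elim: c t => //=.
- move=> c1 IH1 c2 IH2 t; rewrite all_cat => /andP[w1 w2] /andP[b1 b2] ts.
  apply: leq_add; first exact: IH1.
  apply: IH2 => // a Aa; rewrite imem_run ?ts//.
  by apply/negP => /(allP w1); rewrite /= Aa.
- move=> b c1 IH1 c2 IH2 t; rewrite all_cat => /andP[w1 w2] /andP[b1 b2] ts.
  rewrite leq_add2l; case: ifP => _.
    by rewrite (leq_trans (IH1 t w1 b1 ts))// leq_addr.
  by rewrite (leq_trans (IH2 t w2 b2 ts))// leq_addl.
- move=> v e c1 IH t /andP[Av w1] /andP[be b1] ts.
  rewrite (eq_ieval ts be) leq_add2l -[X in (X * _)%N]card_ord -sum_nat_const.
  apply: leq_sum => k _; rewrite ltnS; apply: IH => // a Aa.
  have va : (a == v) = false by apply/negP => /eqP av; move: Av; rewrite -av /= Aa.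
  transitivity (imem (iteri k (fun l u => run c1 (iset u v 0 l)) t) a).
    by apply/funext => j; rewrite /= /upd va.
  elim: (nat_of_ord k) => [|l IHl] /=; first exact: ts.
  rewrite imem_run; last by apply/negP => /(allP w1); rewrite /= Aa.
  by rewrite -IHl; apply/funext => j; rewrite /= /upd va.
Qed.

(* In all programs below, single integers are kept in cell 0 of an array:
   2: L, 3: M = 2^L (the length of the FFT), 7: the base of the traversal, then
   the primitive root, 8: its current power, 9: number of steps, 14: end flag,
   16: index of the minimum, 17: width of the FFT stage, 10-12: loop counters.
   Integer arrays: 6: marks, 15: powers of the primitive root. Real arrays:
   1: kernel values, 2, 3: real and imaginary part of their transform, 4: the
   products P, 5, 6: argument and result of the FFT, 7, 8: scratch. *)
Definition reg a : iexp := IGet a (ICst 0).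

Definition rfill v (e : iexp) a (ex : rexp) : cmd := For v e (RSet a (reg v) ex).

(** At round k the array [a] is still intact from cell k on, which covers expressions reading the
    very cell they overwrite. *)
Lemma run_rfill v e a ex (f : nat -> R) s :
  (forall k t, (k < ieval s e)%N -> imem t v 0%N = k ->
     (forall b, b != v -> imem t b = imem s b) ->
     (forall b, b != a -> rmem t b = rmem s b) ->
     (forall j, (k <= j)%N -> rmem t a j = rmem s a j) -> reval t ex = f k) ->
  forall j, rmem (run (rfill v e a ex) s) a j =
    if (j < ieval s e)%N then f j else rmem s a j.
Proof.
move=> H; pose P k t := [/\ forall b, b != v -> imem t b = imem s b,
  forall b, b != a -> rmem t b = rmem s b &
  forall j, rmem t a j = if (j < k)%N then f j else rmem s a j].
suff [] : P (ieval s e) (run (rfill v e a ex) s) by [].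
apply: for_ind; first by split.
move=> k t ke [Pi Pr Pa].
have Pi' b : b != v -> imem (iset t v 0 k) b = imem s b.
  by move=> bv; rewrite -Pi//; apply/funext => j; rewrite /= /upd (negbTE bv).
split => [b bv|b ba|j] /=.
- exact: Pi'.
- by rewrite -Pr//; apply/funext => j; rewrite /upd (negbTE ba).
- rewrite /upd !eqxx /= (H k)//.
    by rewrite ltnS Pa; case: (ltngtP j k) => // ->.
  + by rewrite /= /upd !eqxx.
  + by move=> i ki; rewrite /= Pa ltnNge ki.
Qed.

End commands.

Arguments run : simpl never.

(** * The radix-2 Fourier transform *)

Section fast_fourier_transform.
Context {R : realType} (K : R -> R).
Implicit Types (s t : memory R).
Local Notation C := R[i].
Local Notation run := (run K).

Definition cval s a b (j : nat) : C := Complex (rmem s a j) (rmem s b j).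

(* One radix-2 stage: i = q h + r is computed from the cells q' 2h + r and
   q' 2h + r + h, where q' is the residue of q modulo M / 2h. *)
Definition fft_stage (M h : nat) (F : nat -> C) (i : nat) : C :=
  let j := ((2 * (i - i %% h)) %% M + i %% h)%N in
  F j + expi (2 * pi * (i - i %% h)%N%:R / M%:R) * F (j + h)%N.

Definition dft (M : nat) (F : nat -> C) (q : nat) : C :=
  \sum_(t < M) F t * expi (2 * pi * (q%:R * t%:R / M%:R)).

Lemma expi_period M (m k : nat) : (0 < M)%N ->
  expi (2 * pi * ((m %% M)%:R * k%:R / M%:R)) =
  expi (2 * pi * (m%:R * k%:R / M%:R)) :> C.
Proof.
move=> M0; rewrite [in RHS](divn_eq m M) natrD natrM.
have -> : ((m %/ M)%:R * M%:R + (m %% M)%:R) * k%:R / M%:R =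
    (m %% M)%:R * k%:R / M%:R + ((m %/ M) * k)%N%:R :> R.
  by rewrite natrM; field; rewrite pnatr_eq0 -lt0n.
by rewrite [(_ * k)%:R]pmulrn expi_2piD_int.
Qed.

Lemma sum_even_odd m (f : nat -> C) :
  \sum_(t < 2 * m) f t = \sum_(t < m) (f (2 * t)%N + f (2 * t).+1).
Proof.
elim: m => [|m IH]; first by rewrite muln0 !big_ord0.
by rewrite mulnS addnC addn2 !big_ord_recr /= IH addrA.
Qed.

(** The invariant of the self-sorting (Stockham) FFT after l stages: blocks are indexed by the
    frequency q and, inside a block, cells by the start r of the transformed subsequence. There is
    no bit reversal; at l = L the order is the natural one. *)
Definition fft_partial L l (F G : nat -> C) : Prop := forall q r,
  (q < 2 ^ l)%N -> (r < 2 ^ (L - l))%N ->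
  G (q * 2 ^ (L - l) + r)%N = \sum_(t < 2 ^ l)
    F (r + t * 2 ^ (L - l))%N * expi (2 * pi * (q%:R * t%:R / (2 ^ l)%:R)).

Lemma fft_partialS L l F G : (l < L)%N -> fft_partial L l F G ->
  fft_partial L l.+1 F (fft_stage (2 ^ L) (2 ^ (L - l.+1)) G).
Proof.
move=> lL FG q r; set h := (2 ^ (L - l.+1))%N => q2 rh.
have h0 : (0 < h)%N by rewrite expn_gt0.
have hE : (2 ^ (L - l) = 2 * h)%N by rewrite -expnS -subSn.
have ME : (2 ^ L = 2 ^ l * (2 * h))%N by rewrite -hE -expnD subnKC// ltnW.
have l0 : (0 < 2 ^ l)%N by rewrite expn_gt0.
rewrite /fft_stage; have -> : ((q * h + r) %% h = r)%N by rewrite modnMDl modn_small.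
rewrite addnK.
have -> : (2 * (q * h) %% 2 ^ L = (q %% 2 ^ l) * (2 * h))%N.
  by rewrite ME mulnCA -muln_modl.
move: FG; rewrite /fft_partial hE => FG.
have qm : (q %% 2 ^ l < 2 ^ l)%N by rewrite ltn_pmod.
rewrite FG//; last by lia.
rewrite -addnA FG//; last by lia.
(* Even t give the subsequence of step 2h from r, odd t the one from r + h, multiplied by the
   twiddle factor. *)
rewrite expnS (sum_even_odd (2 ^ l) (fun t : nat => F (r + t * h)%N *
  expi (2 * pi * (q%:R * t%:R / (2 * 2 ^ l)%:R)))).
rewrite big_split /= mulr_sumr; congr (_ + _).
  apply: eq_bigr => t _; rewrite expi_period//; congr (F _ * expi (2 * pi * _)).
    by lia.
  rewrite !natrM; field.
  by rewrite pnatr_eq0 -lt0n.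
apply: eq_bigr => t _; rewrite expi_period// mulrCA; congr (F _ * _); first by lia.
rewrite -expiD -mulrA -mulrDr; congr (expi (_ * _)).
rewrite ME -natr1 !natrM; field.
by rewrite !pnatr_eq0 -!lt0n h0 l0.
Qed.

Lemma fft_partial0 L F : fft_partial L 0 F F.
Proof.
move=> q r; rewrite expn0 ltnS leqn0 => /eqP-> rL.
by rewrite big_ord1 !mul0n addn0 !mul0r mulr0 expi0 mulr1.
Qed.

Lemma fft_partial_dft L F G q : fft_partial L L F G -> (q < 2 ^ L)%N ->
  G q = dft (2 ^ L) F q.
Proof.
move=> FG qL; have := FG q 0%N qL; rewrite subnn expn0 muln1 addn0 => -> //.
by apply: eq_bigr => t _; rewrite muln1 add0n.
Qed.

(** A stage reads only cells below M, the range in which the memory is specified. *)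
Lemma eq_fft_stage M h F G i : (0 < h)%N -> (2 * h %| M)%N -> (0 < M)%N ->
  (forall j, (j < M)%N -> F j = G j) -> fft_stage M h F i = fft_stage M h G i.
Proof.
move=> h0 hM M0 FG; rewrite /fft_stage.
have [m mE] := dvdnP hM.
have im : (i %% h < h)%N by rewrite ltn_pmod.
have small : ((2 * (i - i %% h)) %% M + i %% h + h < M)%N.
  have -> : (i - i %% h = i %/ h * h)%N by rewrite {1}(divn_eq i h) addnK.
  have -> : (2 * (i %/ h * h) %% M = (i %/ h %% m) * (2 * h))%N.
    by rewrite mE mulnCA -muln_modl.
  have m0 : (0 < m)%N by move: M0; rewrite mE muln_gt0 => /andP[].
  have : (i %/ h %% m < m)%N by rewrite ltn_pmod.
  rewrite mE; move: (i %/ h %% m)%N => u um; nia.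
by move: ((2 * (i - i %% h)) %% M + i %% h)%N small => u small; rewrite !FG//; lia.
Qed.

Definition rdiff : iexp := ISub (reg 11) (IMod (reg 11) (reg 17)).
Definition rsrc : iexp :=
  IAdd (IMod (IMul (ICst 2) rdiff) (reg 3)) (IMod (reg 11) (reg 17)).
Definition rangle : rexp :=
  RDiv (RMul (RMul (RNat (ICst 2)) RPi) (RNat rdiff)) (RNat (reg 3)).

(** Every input cell serves two output cells, so a cell-by-cell update in place would destroy data;
    the arrays 7 and 8 hold the result meanwhile. *)
Definition fft_stage_cmd : cmd :=
  Seq (ISet 17 (ICst 0) (IDiv (reg 17) (ICst 2)))
  (Seq (rfill 11 (reg 3) 7 (RAdd (RGet 5 rsrc)
          (RSub (RMul (RCos rangle) (RGet 5 (IAdd rsrc (reg 17))))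
                (RMul (RSin rangle) (RGet 6 (IAdd rsrc (reg 17)))))))
  (Seq (rfill 11 (reg 3) 8 (RAdd (RGet 6 rsrc)
          (RAdd (RMul (RCos rangle) (RGet 6 (IAdd rsrc (reg 17))))
                (RMul (RSin rangle) (RGet 5 (IAdd rsrc (reg 17)))))))
  (Seq (rfill 11 (reg 3) 5 (RGet 7 (reg 11)))
       (rfill 11 (reg 3) 6 (RGet 8 (reg 11)))))).

Definition fft_cmd : cmd :=
  Seq (ISet 17 (ICst 0) (reg 3)) (For 10 (reg 2) fft_stage_cmd).

Lemma run_fft_stage s M h : imem s 3 0%N = M -> (imem s 17 0 %/ 2 = h)%N ->
  imem (run fft_stage_cmd s) 17 0%N = h /\
  forall i, (i < M)%N ->
    cval (run fft_stage_cmd s) 5 6 i = fft_stage M h (cval s 5 6) i.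
Proof.
move=> sM sh; rewrite /fft_stage_cmd; split.
  by rewrite run_Seq imem_run// run_ISet /= /upd /= sh.
move=> i iM.
set c1 := ISet _ _ _; set c2 := rfill 11 _ 7 _; set c3 := rfill 11 _ 8 _.
set c4 := rfill 11 _ 5 _; set c5 := rfill 11 _ 6 _.
rewrite !runE; set s1 := iset s 17 0 _.
have s1h : imem s1 17 0%N = h by rewrite /s1 /= /upd /= sh.
have s1M : ieval s1 (reg 3) = M by rewrite /s1 /= /upd /= sM.
have s1r : rmem s1 = rmem s by [].
clearbody s1; rewrite /cval -s1r -/(cval s1 5 6).
set s2 := run c2 s1; set s3 := run c3 s2; set s4 := run c4 s3; set s5 := run c5 s4.
pose T := fft_stage M h (cval s1 5 6); rewrite -/(T i).
have s1M' : imem s1 3 0%N = M by exact: s1M.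
have r2 j : (j < M)%N -> rmem s2 7 j = complex.Re (T j).
  move=> jM; rewrite /s2 (run_rfill (f := fun k => complex.Re (T k))) ?s1M ?jM//.
  move=> k t kM tv ti tr _; rewrite /T /fft_stage /cval /=.
  by rewrite tv !ti// !tr// s1h s1M'.
have s2i b : b != 11%N -> imem s2 b = imem s1 b by move=> b11; rewrite imem_run//= inE.
have s2M : ieval s2 (reg 3) = M by rewrite /= s2i.
have r3 j : (j < M)%N -> rmem s3 8 j = complex.Im (T j).
  have s2r b : b != 7%N -> rmem s2 b = rmem s1 b by move=> b7; rewrite rmem_run//= inE.
  move=> jM; rewrite /s3 (run_rfill (f := fun k => complex.Im (T k))) ?s2M ?jM//.
  move=> k t kM tv ti tr _; rewrite /T /fft_stage /cval /=.
  by rewrite tv !ti// !tr// !s2i// !s2r// s1h s1M'.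
have s3M : ieval s3 (reg 3) = M by rewrite /= imem_run.
have r4 j : (j < M)%N -> rmem s4 5 j = complex.Re (T j).
  move=> jM; rewrite /s4 (run_rfill (f := fun k => rmem s3 7 k)) ?s3M ?jM.
    by rewrite rmem_run// r2.
  by move=> k t kM tv ti tr _ /=; rewrite tv tr.
have s4M : ieval s4 (reg 3) = M by rewrite /= imem_run.
have r5 j : (j < M)%N -> rmem s5 6 j = complex.Im (T j).
  move=> jM; rewrite /s5 (run_rfill (f := fun k => rmem s4 8 k)) ?s4M ?jM.
    by rewrite rmem_run// r3.
  by move=> k t kM tv ti tr _ /=; rewrite tv tr.
by rewrite r5// (_ : rmem s5 5 = rmem s4 5) ?r4//; rewrite rmem_run.
Qed.

Lemma run_fft s L : imem s 2 0%N = L -> imem s 3 0%N = (2 ^ L)%N ->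
  forall q, (q < 2 ^ L)%N ->
    cval (run fft_cmd s) 5 6 q = dft (2 ^ L) (cval s 5 6) q.
Proof.
move=> sL sM q qL; rewrite /fft_cmd.
rewrite runE; set c2 := For _ _ _; rewrite runE; set s1 := iset _ _ _ _.
pose P k t := [/\ imem t 3 0%N = (2 ^ L)%N, imem t 17 0%N = (2 ^ (L - k))%N &
  exists2 G, fft_partial L k (cval s 5 6) G &
    forall i, (i < 2 ^ L)%N -> cval t 5 6 i = G i].
have s1L : ieval s1 (reg 2) = L by rewrite /s1 /= /upd /= sL.
have : P L (run c2 s1).
  rewrite -{1}s1L; apply: for_ind.
    split; rewrite /s1 /= /upd /= ?sM ?subn0//.
    by exists (cval s 5 6) => //; exact: fft_partial0.
  rewrite s1L => k t kL [t3 t17 [G FG tG]].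
  have t'3 : imem (iset t 10 0 k) 3 0%N = (2 ^ L)%N by rewrite /= /upd /= t3.
  have t'17 : (imem (iset t 10 0 k) 17 0 %/ 2 = 2 ^ (L - k.+1))%N.
    by rewrite /= /upd /= t17 -(subnSK kL) expnS mulKn.
  have [h17 hF] := run_fft_stage t'3 t'17.
  split => //; first by rewrite imem_run.
  exists (fft_stage (2 ^ L) (2 ^ (L - k.+1)) G); first exact: fft_partialS.
  move=> i iL; rewrite hF//; apply: eq_fft_stage => //.
  - by rewrite expn_gt0.
  - by rewrite -expnS dvdn_exp2l// -subSn// subSS leq_subr.
  - by rewrite expn_gt0.
by case=> _ _ [G FG] ->//; exact: fft_partial_dft.
Qed.

End fast_fourier_transform.

(** * Search for a primitive root *)

Section unit_orders.

(** All that is used of the multiplicative order modulo n, in terms of natural numbers. The third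
    clause rests on cyclicity: there is only one subgroup of each order. *)
Definition unit_order_spec (n : nat) (o : nat -> nat) : Prop :=
  [/\ forall c, (0 < c < n)%N -> (0 < o c)%N /\ (o c %| n.-1)%N,
      forall c i j, (0 < c < n)%N -> (c ^ i == c ^ j %[mod n])%N = (i == j %[mod o c])%N,
      forall b c, (0 < b < n)%N -> (0 < c < n)%N -> (o c %| o b)%N ->
        exists k, c = (b ^ k %% n)%N &
      exists2 g, (0 < g < n)%N & o g = n.-1].

Lemma exists_unit_order n : prime n -> exists o, unit_order_spec n o.
Proof.
move=> pn; have n1 := prime_gt1 pn.
pose u c : {unit 'Z_n} := insubd (1%g : {unit 'Z_n}) (c%:R : 'Z_n).
have cop c : (0 < c < n)%N -> coprime n c.
  by move=> /andP[c0 cn]; rewrite prime_coprime// gtnNdvd.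
have uE c : (0 < c < n)%N -> val (u c) = c%:R.
  by move=> cn; rewrite insubdK// -topredE /= unitZpE// cop.
have uX c k : (0 < c < n)%N -> val (u c ^+ k)%g = (c ^ k)%:R.
  by move=> cn; rewrite FinRing.val_unitX uE// natrX.
have ueq c b i j : (0 < c < n)%N -> (0 < b < n)%N ->
    ((u c ^+ i)%g == (u b ^+ j)%g) = (c ^ i == b ^ j %[mod n])%N.
  move=> cn bn; rewrite -(inj_eq val_inj) !uX//.
  by rewrite -(inj_eq val_inj) /= !val_Zp_nat.
have cardU : #|units_Zp n| = n.-1 by rewrite card_units_Zp ?prime_gt0// totient_prime.
have inU (x : {unit 'Z_n}) : x \in units_Zp n by rewrite inE.
have cycU := units_Zp_cyclic pn.
exists (fun c => #[u c]%g); split.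
- move=> c cn; split; first exact: order_gt0.
  by rewrite -cardU order_dvdG.
- by move=> c i j cn; rewrite -eq_expg_mod_order ueq.
- move=> b c bn cn cb.
  have [q qE] := dvdnP cb.
  have q0 : (0 < q)%N by move: (order_gt0 (u b)); rewrite qE muln_gt0 => /andP[].
  have oq : #[(u b ^+ q)%g]%g = #[u c]%g.
    by rewrite orderXdiv ?qE ?dvdn_mulr// mulKn.
  (* A power of [u b] has the order of [u c], hence generates the same subgroup of the cyclic unit
     group. *)
  have /eqP sub : <[u c]>%g == <[(u b ^+ q)%g]>%g :> {set _}.
    rewrite (eq_subG_cyclic cycU) ?cycle_subG ?inU//.
    by rewrite -!orderE oq.
  have : u c \in <[(u b ^+ q)%g]>%g by rewrite -sub cycle_id.
  move=> /cycleP[k]; rewrite -expgM => /eqP.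
  rewrite -[u c]expg1 ueq// expn1 => /eqP ck; exists (q * k)%N.
  by rewrite -ck modn_small//; case/andP: cn.
- have [x xE] := cyclicP cycU.
  have x0 : (val x : 'Z_n) != 0 :> nat.
    apply/negP => /eqP x0; have := valP x => /=.
    by rewrite -(natr_Zp (val x)) x0 unitZpE// /coprime gcdn0 gtn_eqF.
  have xn : (0 < val x < n)%N.
    by rewrite lt0n x0 -[X in (_ < X)%N](Zp_cast n1) ltn_ord.
  exists (val x : nat) => //; rewrite -cardU xE -orderE; congr #[_]%g.
  by apply/val_inj; rewrite uE// natr_Zp.
Qed.

(** Divisors are written as N / e, and each dyadic block 2^l <= e < 2^(l+1) contributes at most 2^l
    (N / 2^l) <= N. *)
Lemma sum_divisors_le N L : (0 < N)%N -> (N < 2 ^ L)%N ->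
  (\sum_(d < N.+1 | d %| N) d <= N * L)%N.
Proof.
move=> N0 NL.
have half l : (\sum_(1 <= e < 2 ^ l) N %/ e <= N * l)%N.
  elim: l => [|l IH]; first by rewrite big_geq// expn0.
  rewrite (@big_cat_nat _ _ _ (2 ^ l)) ?expn_gt0 ?leq_exp2l//=.
  rewrite mulnS addnC leq_add//.
  apply: (@leq_trans (\sum_(2 ^ l <= e < 2 ^ l.+1) N %/ 2 ^ l)).
    rewrite !big_nat; apply: leq_sum => e /andP[le _].
    by rewrite leq_div2l// expn_gt0.
  rewrite sum_nat_const_nat expnS mul2n -addnn addnK mulnC.
  exact: leq_trunc_div.
apply: leq_trans (half L).
rewrite (@big_cat_nat _ _ _ N.+1) //=; apply: leq_trans (leq_addr _ _).
pose f (d : 'I_N.+1) : 'I_N.+1 := inord (N %/ d).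
have fE (d : 'I_N.+1) : f d = (N %/ d)%N :> nat.
  by rewrite inordK// ltnS leq_div.
have ff (d : 'I_N.+1) : (d %| N)%N -> f (f d) = d.
  by move=> dN; apply/val_inj; rewrite /= !fE divnA// mulKn.
rewrite (reindex_onto f f) //=.
apply: (@leq_trans (\sum_(j < N.+1 | (0 < j)%N) N %/ j)); last first.
  by rewrite -(big_mkord (fun j => 0 < j)%N (fun j => N %/ j)%N) big_ltn_cond//= big_nat_cond
    [leqRHS]big_nat_cond; apply: eq_leq; apply: eq_bigl => j; case: j => //= j; rewrite andbT.
rewrite big_mkcond [leqRHS]big_mkcond; apply: leq_sum => j _.
case: ifP => // /andP[fN _]; rewrite fE; case: (posnP j) => // j0.
by move: fN; rewrite fE j0 divn0 dvd0n gtn_eqF.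
Qed.

Record gstate := GState {
  gbase : nat; gcur : nat; gcount : nat; gdone : nat; gmark : nat -> nat }.

(* Traverses in turn the cyclic groups generated by 1, 2, 3, ... modulo [n],
   skipping the bases that lie in a group seen before, until a traversal has
   n - 1 steps. The groups traversed have distinct orders dividing n - 1, so
   that n + sigma(n - 1) steps suffice. *)
Definition gstep n st : gstate :=
  if (gdone st < 1)%N then
    if (gmark st (gbase st) < 1)%N then
      let x := ((gcur st * gbase st) %% n)%N in
      let mark j := if j == x then 1%N else gmark st j in
      GState (gbase st) x (gcount st + 1)
        (if (mark (gbase st) < 1)%N then gdone st
         else if (gcount st + 1 < n - 1)%N then gdone st else 1%N) mark
    else GState (gbase st + 1) (gbase st + 1) 0 (gdone st) (gmark st)
  else st.

Definition ginit : gstate := GState 1 1 0 0 (fun=> 0%N).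

Section generator_search.
Variables (n : nat) (o : nat -> nat).
Hypotheses (pn : prime n) (os : unit_order_spec n o).

Let n1 : (1 < n)%N := prime_gt1 pn.

Definition generates b x : bool := has (fun k => x == b ^ k %% n)%N (iota 0 n).

Let o_gt0 c : (0 < c < n)%N -> (0 < o c)%N.
Proof. by case: os => H _ _ _ /H[]. Qed.

Let o_dvd c : (0 < c < n)%N -> (o c %| n.-1)%N.
Proof. by case: os => H _ _ _ /H[]. Qed.

Let o_le c : (0 < c < n)%N -> (o c <= n.-1)%N.
Proof. by move=> /o_dvd; apply: dvdn_leq; rewrite -ltnS prednK// ltnW. Qed.

Let o_eq c i j : (0 < c < n)%N -> (c ^ i == c ^ j %[mod n])%N = (i == j %[mod o c])%N.
Proof. by case: os => _ H _ _; exact: H. Qed.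

Lemma generatesP b x : (0 < b < n)%N ->
  reflect (exists k, x = b ^ k %% n)%N (generates b x).
Proof.
move=> bn; apply: (iffP hasP) => [[k _ /eqP ->]|[k ->]]; first by exists k.
exists (k %% o b)%N.
  rewrite mem_iota add0n /=; apply: leq_trans (ltn_pmod _ (o_gt0 bn)) _.
  exact: leq_trans (o_le bn) (leq_pred n).
by rewrite o_eq// modn_mod.
Qed.

Definition gmarked c x : bool := has (fun b => generates b x) (iota 1 c.-1).

(** The state on arrival at the base c: exactly the groups of the smaller bases are marked. *)
Definition gscan c st : Prop :=
  [/\ gbase st = c, gcur st = c, gcount st = 0%N, gdone st = 0%N &
    forall x, gmark st x = gmarked c x].

(** The marks start at c^2 because c itself stays unmarked until the traversal returns to it; its
    mark is the test for the end of the cycle. *)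
Lemma gtraverse c st k : (0 < c < n)%N -> gscan c st -> ~~ gmarked c c -> (k < o c)%N ->
  let st' := iter k (gstep n) st in
  [/\ gbase st' = c, gcur st' = (c ^ k.+1 %% n)%N, gcount st' = k, gdone st' = 0%N &
    forall x, gmark st' x =
      gmarked c x || has (fun j => x == c ^ j.+2 %% n)%N (iota 0 k)].
Proof.
move=> cn [sb sx sk sd sm] cm; have cE : (c %% n = c)%N.
  by rewrite modn_small//; case/andP: cn.
have back j : (j.+1 < o c)%N -> (c == c ^ j.+2 %% n)%N = false.
  move=> jo; rewrite -[X in (X == _)%N]cE -{1}(expn1 c) o_eq//.
  rewrite -[1%N]addn0 -(addn1 j.+1) [(j.+1 + _)%N]addnC eqn_modDl mod0n modn_small//.
elim: k => [_|k IH ko] st'; rewrite {}/st'.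
  by split => //; rewrite ?expn1 ?cE// => x; rewrite sm orbF.
have [ib ix ik id im] := IH (ltnW ko).
have mc0 : gmark (iter k (gstep n) st) c = 0%N.
  rewrite im (negbTE cm) /=; apply/eqP; rewrite eqb0; apply/hasPn => j.
  rewrite mem_iota add0n => /andP[_ jk]; rewrite back//.
  by rewrite (leq_ltn_trans _ (ltnW ko)).
have xE : ((c ^ k.+1 %% n) * c %% n = c ^ k.+2 %% n)%N.
  by rewrite modnMml -expnSr.
have hS x : has (fun j => x == c ^ j.+2 %% n)%N (iota 0 k.+1) =
    has (fun j => x == c ^ j.+2 %% n)%N (iota 0 k) || (x == c ^ k.+2 %% n)%N.
  by rewrite -[in LHS]addn1 iotaD has_cat add0n /= orbF.
rewrite iterS; move: (iter k (gstep n) st) ib ix ik id im mc0 => u ib ix ik id im mc0.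
rewrite /gstep id ib mc0 /= ix xE ik addn1 back//; split => //.
move=> x; have := hS x; rewrite /= => ->; rewrite im.
by case: eqP => [->|_]; rewrite ?orbT ?orbF.
Qed.

Lemma gtraverse_all c st : (0 < c < n)%N -> gscan c st -> ~~ gmarked c c ->
  let st' := iter (o c) (gstep n) st in
  [/\ gbase st' = c, gdone st' = (n.-1 <= o c)%N &
    forall x, gmark st' x = gmarked c x || generates c x].
Proof.
move=> cn sc cm; have o0 := o_gt0 cn.
have cE : (c %% n = c)%N by rewrite modn_small//; case/andP: cn.
have [|ib ix ik id im] := @gtraverse c st (o c).-1 cn sc cm.
  by rewrite prednK.
have cperiod j : (c ^ (o c + j) %% n = c ^ j %% n)%N.
  by apply/eqP; rewrite o_eq// modnDl.
have mc0 : gmark (iter (o c).-1 (gstep n) st) c = 0%N.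
  rewrite im (negbTE cm) /=; apply/eqP; rewrite eqb0; apply/hasPn => j.
  rewrite mem_iota add0n => /andP[_ jk]; rewrite -[X in (X == _)%N]cE -{1}(expn1 c) o_eq//.
  rewrite -[1%N]addn0 -(addn1 j.+1) [(j.+1 + _)%N]addnC eqn_modDl mod0n modn_small//.
  by move: jk o0; lia.
have xE : ((c ^ (o c).-1.+1 %% n) * c %% n = c)%N.
  by rewrite modnMml -expnSr prednK// -addn1 cperiod expn1.
have oE : (o c).-1.+1 = o c by rewrite prednK.
have -> : iter (o c) (gstep n) st = gstep n (iter (o c).-1 (gstep n) st).
  by rewrite -[in LHS]oE iterS.
move: (iter (o c).-1 (gstep n) st) ib ix ik id im mc0 => u ib ix ik id im mc0.
rewrite /gstep id ib mc0 /= ix xE ik addn1 eqxx oE /=.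
split => //; first by rewrite subn1 [in RHS]leqNgt; case: (_ < _)%N.
move=> x; rewrite im; case: eqP => [->|xc].
  rewrite (_ : generates c c) ?orbT//; apply/generatesP => //; exists 1%N.
  by rewrite expn1.
congr (nat_of_bool (_ || _)); apply/hasP/generatesP => // -[j].
  by move=> _ /eqP->; exists j.+2.
move=> xj; pose i := (j %% o c)%N.
have xi : x = (c ^ i %% n)%N by rewrite xj; apply/eqP; rewrite o_eq// modn_mod.
have io : (i < o c)%N by rewrite ltn_pmod.
(* The recorded exponents run from 2 to [o c]: the exponent 0 is represented by [o c], and 1 is
   excluded by x <> c. *)
have [i0|i0] := posnP i.
  have o2 : (1 < o c)%N.
    rewrite ltn_neqAle o0 andbT; apply/eqP => o1; apply: xc.
    by rewrite xi i0 -(cperiod 0%N) addn0 -o1 expn1 cE.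
  exists (o c - 2)%N; first by rewrite mem_iota add0n /=; clear -o2; lia.
  by rewrite xi i0 -(cperiod 0%N) addn0; apply/eqP; congr (_ ^ _ %% _)%N; clear -o2; lia.
have [i1|i1] := eqVneq i 1%N.
  by case: xc; rewrite xi i1 expn1.
exists (i - 2)%N; first by rewrite mem_iota add0n /=; move: i0 i1 io; clear; lia.
by rewrite xi; apply/eqP; congr (_ ^ _ %% _)%N; move: i0 i1; clear; lia.
Qed.

(** One step moves on to the next base; an unmarked base costs in addition the length of its
    cycle. *)
Definition gsteps c : nat := if gmarked c c then 1%N else (o c).+1.

Lemma gscan_next c st : (0 < c < n)%N -> gscan c st -> (o c < n.-1)%N ->
  gscan c.+1 (iter (gsteps c) (gstep n) st).
Proof.
move=> cn sc oc; have [sb sx sk sd sm] := sc.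
have c0 : (0 < c)%N by case/andP: cn.
have iS : iota 1 c = iota 1 c.-1 ++ [:: c].
  by rewrite -[in LHS](prednK c0) -[c.-1.+1]addn1 iotaD add1n prednK.
have mS x : gmarked c.+1 x = gmarked c x || generates c x.
  by rewrite /gmarked [c.+1.-1]/= iS has_cat /= orbF.
rewrite /gsteps; case: ifPn => cm.
  (* A marked c is a power of an earlier base b, so all its powers are powers of b and carry a mark
     already. *)
  rewrite /= /gstep sd sb sm cm /=; split; rewrite ?addn1//= => x.
  rewrite sm mS; case: (boolP (gmarked c x)) => //= xm; apply/esym/eqP.
  rewrite eqb0; apply: contra xm => /(generatesP _ cn)[k ->].
  have /hasP[b bi /generatesP] := cm.
  have bn : (0 < b < n)%N.
    by move: bi; rewrite mem_iota; case/andP: cn; lia.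
  move=> /(_ bn)[j cE]; apply/hasP; exists b => //; apply/generatesP => //.
  by exists (j * k)%N; rewrite cE modnXm -expnM.
have [ib id im] := gtraverse_all cn sc cm.
have cc : generates c c.
  by apply/generatesP => //; exists 1%N; rewrite expn1 modn_small//; case/andP: cn.
rewrite iterS; move: (iter (o c) (gstep n) st) ib id im => u ib id im.
rewrite leqNgt oc in id; rewrite /gstep id ib im cc orbT /=.
by split; rewrite ?addn1//= => x; rewrite im mS.
Qed.

Lemma gscan_iter c : (0 < c)%N -> (c <= n)%N ->
  (forall b, (0 < b < c)%N -> (o b < n.-1)%N) ->
  gscan c (iter (\sum_(1 <= b < c) gsteps b) (gstep n) ginit).
Proof.
elim: c => // c IH _ cn ob; have [->|c0] := posnP c.
  by rewrite big_geq.
rewrite big_nat_recr//= addnC iterD.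
apply: gscan_next; first by rewrite c0.
  apply: IH => //; first exact: ltnW.
  by move=> b /andP[b0 bc]; apply: ob; rewrite b0 ltnW.
by apply: ob; rewrite c0 ltnSn.
Qed.

Lemma sum_gsteps_le L g : (n < 2 ^ L)%N -> (0 < g < n)%N -> ~~ gmarked g g ->
  (\sum_(1 <= b < g) gsteps b + o g <= n * L.+1)%N.
Proof.
move=> nL gn gm; have g0 : (0 < g)%N by case/andP: gn.
pose w b := (if gmarked b b then 0 else o b)%N.
have -> : (\sum_(1 <= b < g) gsteps b = g.-1 + \sum_(1 <= b < g) w b)%N.
  rewrite -[X in (X + _)%N]muln1 -subn1 -sum_nat_const_nat -big_split.
  by apply: eq_bigr => b _; rewrite /gsteps /w; case: ifP.
rewrite -addnA (_ : o g = w g); last by rewrite /w (negbTE gm).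
rewrite -big_nat_recr//= mulnS; apply: leq_add.
  by case/andP: gn; lia.
have N0 : (0 < n.-1)%N by rewrite -ltnS prednK// ltnW.
apply: (@leq_trans (n.-1 * L)); last by rewrite leq_mul2r leq_pred orbT.
apply: leq_trans (sum_divisors_le N0 (leq_ltn_trans (leq_pred n) nL)).
pose A := [set b : 'I_g.+1 | (0 < b)%N && ~~ gmarked b b]%SET.
pose h (b : 'I_g.+1) : 'I_n.-1.+1 := inord (o b).
have gb (b : nat) : (0 < b)%N -> (b < g.+1)%N -> (0 < b < n)%N.
  by move=> b0 bg; rewrite b0; case/andP: gn; lia.
have hE b : b \in A -> h b = o b :> nat.
  rewrite inE => /andP[b0 _]; rewrite inordK// ltnS; apply: o_le.
  exact: gb.
have ohinj : {in A &, injective h}.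
  move=> b c bA cA hbc; apply/val_inj => /=.
  have obc : o b = o c by rewrite -(hE b bA) -(hE c cA) hbc.
  (* Of two bases of equal order the later one is a power of the earlier one, hence marked. *)
  have lem (b' c' : 'I_g.+1) : b' \in A -> c' \in A -> o b' = o c' -> (b' < c')%N -> False.
    rewrite !inE => /andP[b0 _] /andP[c0 /negP cm] obc' bc; apply: cm.
    have [_ _ H _] := os.
    have [k cE] : exists k, c' = (b' ^ k %% n)%N :> nat.
      by apply: H; [exact: gb | exact: gb | rewrite obc'].
    apply/hasP; exists (b' : nat); first by rewrite mem_iota; lia.
    by apply/generatesP; [exact: gb | exists k].
  case: (ltngtP b c) => // bc; [case: (lem b c) | case: (lem c b)] => //.
have -> : (\sum_(1 <= b < g.+1) w b = \sum_(b in A) o b)%N.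
  rewrite (eq_bigl (fun b : 'I_g.+1 => (0 < b)%N && ~~ gmarked b b)); last first.
    by move=> b; rewrite inE.
  rewrite big_mkcondr /= -(big_mkord (fun i => 0 < i)%N
    (fun i => if ~~ gmarked i i then o i else 0%N)).
  rewrite [RHS]big_ltn_cond//= big_nat [RHS]big_nat_cond; apply: eq_big => [b|b _].
    by rewrite andbAC andbb.
  by rewrite /w; case: (gmarked b b).
have -> : (\sum_(b in A) o b = \sum_(d in h @: A) d)%N.
  by rewrite big_imset//; apply: eq_bigr => b bA; rewrite hE.
rewrite big_mkcond [leqRHS]big_mkcond; apply: leq_sum => d _.
case: ifP => // /imsetP[b bA ->]; rewrite hE// o_dvd//.
by move: bA; rewrite inE => /andP[b0 _]; exact: gb.
Qed.

(** The least primitive root is unmarked, since no base of smaller order generates it. Its traversal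
    sets the flag, and all further steps leave the state unchanged, so any sufficient number T of
    rounds will do. *)
Lemma ex_gscan_done L T : (n < 2 ^ L)%N -> (n * L.+1 <= T)%N ->
  exists g, [/\ (0 < g < n)%N, o g = n.-1, gbase (iter T (gstep n) ginit) = g &
    gdone (iter T (gstep n) ginit) = 1%N].
Proof.
move=> nL nT.
have ex : exists g, (0 < g < n)%N && (o g == n.-1).
  by case: os => _ _ _ [g gn og]; exists g; rewrite gn og eqxx.
case: (ex_minnP ex) => g /andP[gn /eqP og] gmin.
have bg b : (0 < b < g)%N -> (o b < n.-1)%N.
  move=> /andP[b0 bg]; have bn : (0 < b < n)%N by rewrite b0; case/andP: gn; lia.
  rewrite ltn_neqAle o_le// andbT; apply/negP => ob.
  by have := gmin b; rewrite bn ob => /(_ isT); rewrite leqNgt bg.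
have gm : ~~ gmarked g g.
  apply/hasPn => b; rewrite mem_iota => bi.
  have b0 : (0 < b < g)%N by case/andP: gn; move: bi; lia.
  have bn : (0 < b < n)%N by case/andP: gn; move: b0; lia.
  apply/negP => /(generatesP _ bn)[k gE].
  have : (g ^ (o b) == g ^ 0 %[mod n])%N.
    by rewrite gE modnXm -expnM (o_eq _ 0)// mod0n modnMl.
  rewrite o_eq// og mod0n => /eqP; rewrite modn_small ?bg// => ob0.
  by have := o_gt0 bn; rewrite ob0.
have [|st1 st2 st3] := gtraverse_all gn _ gm
  (st := iter (\sum_(1 <= b < g) gsteps b) (gstep n) ginit).
  apply: gscan_iter => //; first by case/andP: gn.
  by case/andP: gn => _ /ltnW.
exists g; have := sum_gsteps_le nL gn gm => sle.
have [m ->] : exists m, T = (m + (o g + \sum_(1 <= b < g) gsteps b))%N.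
  by exists (T - (o g + \sum_(1 <= b < g) gsteps b))%N; lia.
rewrite iterD (iterD (o g)).
move: (iter (o g) _ _) st1 st2 {st3} => st b1 d1.
suff -> : iter m (gstep n) st = st by split => //; rewrite d1 og leqnn.
by elim: m => // m /= ->; rewrite /gstep d1 og leqnn.
Qed.

Lemma generator_powers g : (0 < g < n)%N -> o g = n.-1 ->
  forall c, (0 < c < n)%N -> exists2 a, (a < n.-1)%N & c = (g ^ a %% n)%N.
Proof.
move=> gn og c cn; have [_ _ H _] := os.
have [|k cE] := H g c gn cn; first by rewrite og o_dvd.
exists (k %% o g)%N; first by rewrite og ltn_pmod// -og o_gt0.
by rewrite cE; apply/eqP; rewrite o_eq// modn_mod.
Qed.

Lemma generator_powers_inj g i j : (0 < g < n)%N -> o g = n.-1 ->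
  (i < n.-1)%N -> (j < n.-1)%N -> (g ^ i %% n = g ^ j %% n)%N -> i = j.
Proof.
move=> gn og iN jN /eqP; rewrite o_eq// og => /eqP.
by rewrite !modn_small.
Qed.

Lemma sum_generator_powers (V : nmodType) g (F : nat -> V) :
  (0 < g < n)%N -> o g = n.-1 ->
  \sum_(i < n | (0 < i)%N) F i = \sum_(a < n.-1) F (g ^ a %% n)%N.
Proof.
move=> gn og; have n0 : (0 < n)%N := ltnW n1.
have ipos a : (0 < g ^ a %% n)%N.
  rewrite lt0n; apply/negP => ga; suff : (n %| g)%N by rewrite gtnNdvd//; case/andP: gn.
  by move: ga; rewrite -/(n %| g ^ a)%N Euclid_dvdX// => /andP[].
pose h (a : 'I_n.-1) : 'I_n := Ordinal (ltn_pmod (g ^ a) n0).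
have hinj : injective h.
  by move=> a b [] /(generator_powers_inj gn og (ltn_ord a) (ltn_ord b)) /val_inj.
transitivity (\sum_(i in h @: [set: 'I_n.-1]%SET) F i); last first.
  rewrite big_imset => [|a b _ _ /hinj//] /=.
  by apply: eq_bigl => a; rewrite inE.
apply: eq_bigl => i; apply/idP/imsetP => [i0|[a _ ->]]; last exact: ipos.
have [|a aN iE] := generator_powers gn og (c := i); first by rewrite i0 ltn_ord.
by exists (Ordinal aN) => //; apply/val_inj.
Qed.

End generator_search.

End unit_orders.

(** * Programs for the primitive root and for the FFT length *)

Section generator_program.
Context {R : realType} (K : R -> R).
Implicit Types (s t : memory R).
Local Notation run := (run K).

Definition nreg : iexp := IGet 0 (ICst 1).

Definition gstep_cmd : cmd :=
  If (ILt (reg 14) (ICst 1))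
    (If (ILt (IGet 6 (reg 7)) (ICst 1))
      (Seq (ISet 8 (ICst 0) (IMod (IMul (reg 8) (reg 7)) nreg))
      (Seq (ISet 9 (ICst 0) (IAdd (reg 9) (ICst 1)))
      (Seq (ISet 6 (reg 8) (ICst 1))
        (If (ILt (IGet 6 (reg 7)) (ICst 1)) Skip
          (If (ILt (reg 9) (ISub nreg (ICst 1))) Skip (ISet 14 (ICst 0) (ICst 1)))))))
      (Seq (ISet 7 (ICst 0) (IAdd (reg 7) (ICst 1)))
      (Seq (ISet 8 (ICst 0) (reg 7)) (ISet 9 (ICst 0) (ICst 0)))))
    Skip.

Definition represents st s : Prop :=
  [/\ imem s 7 0%N = gbase st, imem s 8 0%N = gcur st, imem s 9 0%N = gcount st,
      imem s 14 0%N = gdone st & forall j, imem s 6 j = gmark st j].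

Lemma run_gstep n st s : imem s 0 1%N = n -> represents st s ->
  represents (gstep n st) (run gstep_cmd s).
Proof.
move=> sn [s7 s8 s9 s14 s6].
rewrite /gstep_cmd !runE /gstep /= s14; case: ifP => // d1.
rewrite s7 s6; case: ifP => m1; last first.
  by split => //=; rewrite /upd /= ?s7.
rewrite /upd /= s7 s8 s9 sn /= s6; set x := (_ %% n)%N.
by case: (gbase st == x) => /=; rewrite ?m1 /represents /=; repeat case: ifP => _;
  split => //= *; rewrite /upd /= ?s7 ?s8 ?s9 ?s14 ?s6 ?sn ?eqxx.
Qed.

Definition search_cmd : cmd :=
  Seq (ISet 7 (ICst 0) (ICst 1))
  (Seq (ISet 8 (ICst 0) (ICst 1))
    (For 11 (IMul nreg (IAdd (reg 2) (ICst 1))) gstep_cmd)).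

Lemma run_search n L s : imem s 0 1%N = n -> imem s 2 0%N = L ->
  imem s 9 = (fun=> 0%N) -> imem s 14 = (fun=> 0%N) -> imem s 6 = (fun=> 0%N) ->
  represents (iter (n * L.+1) (gstep n) ginit) (run search_cmd s).
Proof.
move=> sn sL s9 s14 s6; rewrite /search_cmd !runE.
set s2 := iset (iset _ _ _ _) _ _ _.
have e2 : ieval s2 (IMul nreg (IAdd (reg 2) (ICst 1))) = (n * L.+1)%N.
  by rewrite /= /upd /= sn sL addn1.
pose P k t := imem t 0 1%N = n /\ represents (iter k (gstep n) ginit) t.
suff : P (n * L.+1)%N (run (For 11 (IMul nreg (IAdd (reg 2) (ICst 1))) gstep_cmd) s2).
  by case.
rewrite -e2; apply: for_ind.
  by split => //; split; rewrite /= /upd /= ?s9 ?s14 ?s6.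
move=> k t _ [tn tr]; split; first by rewrite imem_run.
rewrite iterS; apply: run_gstep => //.
Qed.

Definition log_cmd : cmd :=
  Seq (ISet 3 (ICst 0) (ICst 1))
    (For 11 nreg
      (If (ILt (reg 3) (IMul (ICst 2) nreg))
        (Seq (ISet 3 (ICst 0) (IMul (ICst 2) (reg 3)))
             (ISet 2 (ICst 0) (IAdd (reg 2) (ICst 1)))) Skip)).

Lemma run_log n s : imem s 0 1%N = n -> (1 < n)%N -> imem s 2 0%N = 0%N ->
  exists L, [/\ imem (run log_cmd s) 2 0%N = L, imem (run log_cmd s) 3 0%N = (2 ^ L)%N,
    (2 * n <= 2 ^ L)%N & (2 ^ L < 4 * n)%N].
Proof.
move=> sn n1 s2; rewrite /log_cmd !runE; set s1 := iset _ _ _ _; set c := For _ _ _.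
pose P k t := imem t 0 1%N = n /\ exists L, [/\ imem t 2 0%N = L,
  imem t 3 0%N = (2 ^ L)%N, (2 * n <= 2 ^ L)%N || (L == k) & (2 ^ L < 4 * n)%N].
have s1n : ieval s1 nreg = n by rewrite /= /upd /= sn.
have : P n (run c s1).
  rewrite -{1}s1n; apply: for_ind.
    split => //; exists 0%N; rewrite /= /upd /= s2 eqxx orbT; split => //.
    by rewrite expn0; lia.
  move=> k t _ [tn [L [t2 t3 nL Ln]]]; split; first by rewrite imem_run.
  rewrite !runE /= /upd /= t3 tn; case: ifP => Mn; last first.
    exists L; rewrite /= /upd /= t2 t3; split => //.
    by rewrite leqNgt Mn.
  exists L.+1; rewrite /= /upd /= t2 addn1 expnS; split => //.
    by case/orP: nL => [|/eqP ->]; [rewrite leqNgt Mn | rewrite eqxx orbT].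
  by lia.
case=> _ [L [e2 e3 nL Ln]]; exists L; split => //.
(* If all n rounds have doubled, then L = n and 2^n >= 2n. *)
case/orP: nL => // /eqP ->; rewrite -{2}(ltn_predK n1) expnS leq_mul2l /=.
by rewrite -{1}(ltn_predK n1) ltn_expl.
Qed.

End generator_program.

(** * Correlation by Fourier transforms *)

Section correlation.
Context {R : realType}.
Local Notation C := R[i].

Lemma eq_dft M (F G : nat -> C) q : (forall t, (t < M)%N -> F t = G t) ->
  dft M F q = dft M G q.
Proof. by move=> FG; apply: eq_bigr => t _; rewrite FG. Qed.

(** With the sign convention of [dft], conjugating the first factor selects u = a + b modulo M, and
    a further transform of the same sign acts as the inverse up to the factor M. The zeros of p from
    N on and N + b <= M exclude wrap-around. *)
Lemma dft_correlation M N (w p : nat -> R) b :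
  (forall a, (N <= a)%N -> p a = 0) -> (N + b <= M)%N -> (0 < N)%N ->
  dft M (fun q => conjc (dft M (fun t => (w t)%:C%C) q) * dft M (fun t => (p t)%:C%C) q) b =
  (M%:R * \sum_(a < N) p a * w (a + b)%N)%:C%C.
Proof.
move=> pN NbM N0; have M0 : (0 < M)%N by lia.
have NM : (N <= M)%N by lia.
transitivity (\sum_(u < M) \sum_(a < M) (w u)%:C%C * (p a)%:C%C *
    \sum_(t < M) expi (2 * pi * (((a + b)%N%:Z - u%:Z)%:~R * t%:R / M%:R)) : C).
  rewrite /dft; under eq_bigr => t _.
    rewrite raddf_sum mulr_suml mulr_suml.
    under eq_bigr => u _ do rewrite mulr_sumr mulr_suml.
    over.
  rewrite exchange_big; apply: eq_bigr => u _.
  rewrite exchange_big; apply: eq_bigr => a _.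
  rewrite mulr_sumr; apply: eq_bigr => t _.
  have cE (x y : R) : conjc (x%:C%C * expi y) = x%:C%C * expi (- y).
    by rewrite /expi cosN sinN /=; congr Complex; ring.
  rewrite [X in X * _ * _]cE mulrACA -!mulrA; congr (_ * (_ * _)).
  rewrite -!expiD; congr expi.
  rewrite intrB -!pmulrn natrD; ring.
under eq_bigr => u _ do under eq_bigr => a _ do rewrite sum_expi_div//.
rewrite exchange_big /=.
rewrite (big_ord_widen M (fun a => p a * w (a + b)%N) NM) mulr_sumr rmorph_sum /=.
rewrite [RHS]big_mkcond; apply: eq_bigr => a _.
case: ltnP => aN; last first.
  by rewrite big1// => u _; rewrite pN// mulr0 mul0r.
have abM : (a + b < M)%N by lia.
rewrite (bigD1 (Ordinal abM)) //= subrr dvdz0 big1 ?addr0 => [|u uab].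
  by rewrite !rmorphM /= rmorph_nat; ring.
(* Both a + b and u lie in [0, M), so M divides their difference only when they agree. *)
case: ifPn => [/dvdzP[q qE]|_]; last by rewrite mulr0.
exfalso; move/eqP: uab; apply; apply/val_inj => /=.
move: (ltn_ord u) qE abM; move: (nat_of_ord u) => u' uM; clear -uM.
have [q0|q0|->] := ltrgtP (q : int) 0; last by lia.
  by have qM : (q * M <= - M%:Z)%R; [nia | lia].
by have qM : (M%:Z <= q * M)%R; [nia | lia].
Qed.

End correlation.

(** * The component-by-component program *)

Section cbc_program.
Context {R : realType} (K : R -> R).
Implicit Types (s t : memory R).
Local Notation C := R[i].
Local Notation run := (run K).

Definition table_cmd : cmd :=
  Seq (ISet 15 (ICst 0) (ICst 1))
  (Seq (For 11 (reg 3)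
         (ISet 15 (IAdd (reg 11) (ICst 1)) (IMod (IMul (IGet 15 (reg 11)) (reg 7)) nreg)))
  (Seq (rfill 11 (reg 3) 1 (RKer (RDiv (RNat (IGet 15 (reg 11))) (RNat nreg))))
  (Seq (rfill 11 (reg 3) 5 (RGet 1 (reg 11)))
  (Seq (rfill 11 (reg 3) 6 (RNat (ICst 0)))
  (Seq fft_cmd
  (Seq (rfill 11 (reg 3) 2 (RGet 5 (reg 11)))
  (Seq (rfill 11 (reg 3) 3 (RGet 6 (reg 11)))
       (rfill 11 (ISub nreg (ICst 1)) 4 (RNat (ICst 1)))))))))).

(** Its table has length 2^L >= 2n, beyond the period n - 1, so that the index a + b needs no
    reduction. *)
Definition power_kernel n g (i : nat) : R := K ((g ^ i %% n)%N%:R / n%:R).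

Definition tabulated n g L s : Prop :=
  [/\ imem s 0 1%N = n, imem s 2 0%N = L, imem s 3 0%N = (2 ^ L)%N,
      forall i, (i < 2 ^ L)%N -> imem s 15 i = (g ^ i %% n)%N &
      (forall i, (i < 2 ^ L)%N -> rmem s 1 i = power_kernel n g i) /\
      (forall q, (q < 2 ^ L)%N ->
        cval s 2 3 q = dft (2 ^ L) (fun i => (power_kernel n g i)%:C%C) q)].

Lemma run_table n g L s : (1 < n)%N -> imem s 0 1%N = n -> imem s 2 0%N = L ->
  imem s 3 0%N = (2 ^ L)%N -> imem s 7 0%N = g -> (forall a, rmem s 4 a = 0) ->
  tabulated n g L (run table_cmd s) /\
  forall a, rmem (run table_cmd s) 4 a = if (a < n.-1)%N then 1 else 0.
Proof.
move=> n1 s0 s2 s3 s7 s4; rewrite /table_cmd; set M := (2 ^ L)%N in s3 *.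
set c1 := For _ _ _; set c2 := rfill 11 _ 1 _; set c3 := rfill 11 _ 5 _.
set c4 := rfill 11 _ 6 _; set c5 := rfill 11 _ 2 _; set c6 := rfill 11 _ 3 _.
set c7 := rfill 11 _ 4 _; rewrite 8!run_Seq run_ISet; set t0 := iset _ _ _ _.
have t0i b : b != 15%N -> imem t0 b = imem s b.
  by move=> b15; apply/funext => j; rewrite /t0 /= /upd (negbTE b15).
have b0 : ieval t0 (reg 3) = M.
  by have t0M : imem t0 3 0%N = M; [rewrite t0i | exact: t0M].
have G1 i : (i <= M)%N -> imem (run c1 t0) 15 i = (g ^ i %% n)%N.
  pose Q k t := [/\ imem t 0 1%N = n, imem t 7 0%N = g &
    forall i, (i <= k)%N -> imem t 15 i = (g ^ i %% n)%N].
  have : Q M (run c1 t0).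
    rewrite -b0; apply: for_ind.
      split; [by rewrite t0i | by rewrite t0i | move=> j]; rewrite leqn0 => /eqP ->.
      by rewrite /t0 /= /upd /= expn0 modn_small.
    move=> k t _ [q0 q7 q15]; rewrite !runE /= /upd /=; split => //= j.
    rewrite /upd /= addn1 q0 q7 q15// leq_eqVlt ltnS.
    case: eqP => [->|_] /= jk; first by rewrite modnMml -expnSr.
    by rewrite (q15 j jk).
  by case=> _ _; apply.
set t1 := run c1 t0 in G1 *.
have t1i b : b != 15%N -> b != 11%N -> imem t1 b = imem s b.
  by move=> b15 b11; rewrite imem_run ?t0i// !inE negb_or b11.
have t1r : rmem t1 = rmem s by apply/funext => b; rewrite rmem_run.
clearbody t1 => {t0 t0i b0 c1}.
set t2 := run c2 t1; set t3 := run c3 t2; set t4 := run c4 t3.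
set t5 := run fft_cmd t4; set t6 := run c5 t5; set t7 := run c6 t6.
set t8 := run c7 t7.
have b1 : ieval t1 (reg 3) = M by rewrite /= t1i.
have b2 : ieval t2 (reg 3) = M by rewrite /= imem_run.
have b3 : ieval t3 (reg 3) = M by rewrite /= imem_run.
have b4 : ieval t4 (reg 3) = M by rewrite /= imem_run.
have b5 : ieval t5 (reg 3) = M by rewrite /= imem_run.
have b6 : ieval t6 (reg 3) = M by rewrite /= imem_run.
have b7 : ieval t7 (ISub nreg (ICst 1)) = n.-1.
  by rewrite /= !imem_run// t1i// s0 subn1.
have r2 i : (i < M)%N -> rmem t2 1 i = power_kernel n g i.
  move=> iM; rewrite (run_rfill (f := power_kernel n g)) ?b1 ?iM//.
  move=> k t kM tv ti _ _ /=; rewrite tv !ti// (t1i 0%N)// s0 G1//.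
  exact: ltnW.
have r3 i : (i < M)%N -> rmem t3 5 i = power_kernel n g i.
  move=> iM; rewrite (run_rfill (f := power_kernel n g)) ?b2 ?iM//.
  by move=> k t kM tv _ tr _ /=; rewrite tv tr// r2.
have r4 i : (i < M)%N -> rmem t4 6 i = 0.
  by move=> iM; rewrite (run_rfill (f := fun=> 0)) ?b3 ?iM.
have c4E i : (i < M)%N -> cval t4 5 6 i = (power_kernel n g i)%:C%C.
  by move=> iM; rewrite /cval r4// rmem_run// r3.
have r5 q : (q < M)%N -> cval t5 5 6 q = dft M (fun i => (power_kernel n g i)%:C%C) q.
  move=> qM; rewrite (@run_fft _ K _ L)//; [|by rewrite !imem_run// t1i..].
  by apply: eq_dft => t tM; rewrite c4E.
have r6 i : (i < M)%N -> rmem t6 2 i = rmem t5 5 i.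
  move=> iM; rewrite (run_rfill (f := rmem t5 5)) ?b5 ?iM//.
  by move=> k t kM tv _ tr _ /=; rewrite tv tr.
have r7 i : (i < M)%N -> rmem t7 3 i = rmem t5 6 i.
  move=> iM; rewrite (run_rfill (f := rmem t5 6)) ?b6 ?iM//.
  by move=> k t kM tv _ tr _ /=; rewrite tv tr// rmem_run.
split; last first.
  move=> a; rewrite (run_rfill (f := fun=> 1)) ?b7//.
  by rewrite !rmem_run// t1r s4.
split; [by rewrite !imem_run// t1i | by rewrite !imem_run// t1i | by rewrite !imem_run// t1i | |].
- by move=> i iM; rewrite !imem_run// G1// ltnW.
- split=> [i iM|q qM].
    by rewrite /t8 rmem_run// /t7 rmem_run// /t6 rmem_run// /t5 rmem_run// /t4
      rmem_run// /t3 rmem_run// r2.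
  by rewrite -r5// /cval !(@rmem_run _ _ c7)// r7// (@rmem_run _ _ c6)// r6.
Qed.

Definition argmin_cmd : cmd :=
  Seq (ISet 16 (ICst 0) (ICst 0))
    (For 11 (ISub nreg (ICst 1))
      (If (RLt (RGet 5 (reg 11)) (RGet 5 (reg 16)))
        (ISet 16 (ICst 0) (reg 11)) Skip)).

Lemma run_argmin n s : (1 < n)%N -> imem s 0 1%N = n ->
  exists2 b, (b < n.-1)%N & imem (run argmin_cmd s) 16 0%N = b /\
    forall c, (c < n.-1)%N -> rmem s 5 b <= rmem s 5 c.
Proof.
move=> n1 s0; rewrite /argmin_cmd runE; set c := For _ _ _; rewrite runE.
set s1 := iset _ _ _ _.
have N0 : (0 < n.-1)%N by rewrite -ltnS prednK// ltnW.
pose Q k t := [/\ rmem t = rmem s, (imem t 16 0 < n.-1)%N &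
  forall c, (c < k)%N -> rmem s 5 (imem t 16 0%N) <= rmem s 5 c].
have : Q n.-1 (run c s1).
  have b1 : ieval s1 (ISub nreg (ICst 1)) = n.-1 by rewrite /= /upd /= s0 subn1.
  rewrite -b1; apply: for_ind; first by split; rewrite //= /upd /=.
  rewrite b1 => k t kn [tr tb tc]; rewrite !runE /= /upd /= tr.
  case: ltP => lt; split => //= j; rewrite /upd /= ltnS leq_eqVlt => /predU1P[->|jk] //.
    by rewrite (le_trans (ltW lt)) ?tc.
  exact: tc.
by case=> _ bn bc; exists (imem (run c s1) 16 0%N).
Qed.

(** With W in the arrays 2, 3 and X the transform of P, the arrays 7, 8 receive conj(W) X, whose
    transform leaves M times the correlations in array 5; the positive factor M does not move the
    minimum. The last loop multiplies P by the factors of the new component. *)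
Definition step_cmd : cmd :=
  Seq (rfill 11 (reg 3) 5 (RGet 4 (reg 11)))
  (Seq (rfill 11 (reg 3) 6 (RNat (ICst 0)))
  (Seq fft_cmd
  (Seq (rfill 11 (reg 3) 7 (RAdd (RMul (RGet 2 (reg 11)) (RGet 5 (reg 11)))
                                 (RMul (RGet 3 (reg 11)) (RGet 6 (reg 11)))))
  (Seq (rfill 11 (reg 3) 8 (RSub (RMul (RGet 2 (reg 11)) (RGet 6 (reg 11)))
                                 (RMul (RGet 3 (reg 11)) (RGet 5 (reg 11)))))
  (Seq (rfill 11 (reg 3) 5 (RGet 7 (reg 11)))
  (Seq (rfill 11 (reg 3) 6 (RGet 8 (reg 11)))
  (Seq fft_cmd
  (Seq argmin_cmd
  (Seq (ISet 1 (reg 12) (IGet 15 (reg 16)))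
       (rfill 11 (ISub nreg (ICst 1)) 4
          (RMul (RGet 4 (reg 11)) (RAdd (RNat (ICst 1))
            (RMul (RGet 0 (reg 12)) (RGet 1 (IAdd (reg 11) (reg 16)))))))))))))))).

Lemma run_step n g L s : (1 < n)%N -> (2 * n <= 2 ^ L)%N -> tabulated n g L s ->
  (forall a, (n.-1 <= a)%N -> rmem s 4 a = 0) ->
  exists2 b, (b < n.-1)%N &
    [/\ tabulated n g L (run step_cmd s), rmem (run step_cmd s) 0 = rmem s 0,
      (forall j, imem (run step_cmd s) 1 j =
         if j == imem s 12 0%N then (g ^ b %% n)%N else imem s 1 j),
      (forall c, (c < n.-1)%N ->
         \sum_(a < n.-1) rmem s 4 a * power_kernel n g (a + b) <=
         \sum_(a < n.-1) rmem s 4 a * power_kernel n g (a + c)) &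
      forall a, rmem (run step_cmd s) 4 a = if (a < n.-1)%N then
         rmem s 4 a * (1 + rmem s 0 (imem s 12 0%N) * power_kernel n g (a + b)) else 0].
Proof.
set M := (2 ^ L)%N; move=> n1 nM [s0 s2 s3 s15 [s1 s23]] s4; rewrite -/M in s3 s15 s1 s23.
have M0 : (0 < M)%N by rewrite expn_gt0.
have tab : tabulated n g L (run step_cmd s).
  split; rewrite ?imem_run//; split => [i iM|q qM]; first by rewrite rmem_run// s1.
  by rewrite /cval !rmem_run// -/(cval s 2 3 q) s23.
move: tab; rewrite /step_cmd.
set c1 := rfill 11 _ 5 (RGet 4 _); set c2 := rfill 11 _ 6 (RNat _); set c4 := rfill 11 _ 7 _.
set c5 := rfill 11 _ 8 _; set c6 := rfill 11 _ 5 (RGet 7 _).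
set c7 := rfill 11 _ 6 (RGet 8 _); set c11 := rfill 11 _ 4 _; rewrite 10!run_Seq run_ISet.
set t1 := run c1 s; set t2 := run c2 t1; set t3 := run fft_cmd t2.
set t4 := run c4 t3; set t5 := run c5 t4; set t6 := run c6 t5; set t7 := run c7 t6.
set t8 := run fft_cmd t7; set t9 := run argmin_cmd t8; set t10 := iset _ _ _ _.
set t11 := run c11 t10; move=> tab.
have b1 : ieval t1 (reg 3) = M by rewrite /= imem_run.
have b2 : ieval t2 (reg 3) = M by rewrite /= imem_run.
have b3 : ieval t3 (reg 3) = M by rewrite /= imem_run.
have b4 : ieval t4 (reg 3) = M by rewrite /= imem_run.
have b5 : ieval t5 (reg 3) = M by rewrite /= imem_run.
have b6 : ieval t6 (reg 3) = M by rewrite /= imem_run.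
have r1 i : (i < M)%N -> rmem t1 5 i = rmem s 4 i.
  move=> iM; rewrite (run_rfill (f := rmem s 4)) /= ?s3 ?iM//.
  by move=> k t kM tv _ tr _ /=; rewrite tv tr.
have r2 i : (i < M)%N -> rmem t2 6 i = 0.
  by move=> iM; rewrite (run_rfill (f := fun=> 0)) ?b1 ?iM.
pose X := dft M (fun i => (rmem s 4 i)%:C%C).
have r3 q : (q < M)%N -> cval t3 5 6 q = X q.
  move=> qM; rewrite (@run_fft _ K _ L)//; [|by rewrite !imem_run..].
  by apply: eq_dft => t tM; rewrite /cval r2// rmem_run// r1.
pose Y q := conjc (dft M (fun i => (power_kernel n g i)%:C%C) q) * X q.
have YE q : (q < M)%N -> Y q = Complex
    (rmem s 2 q * rmem t3 5 q + rmem s 3 q * rmem t3 6 q)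
    (rmem s 2 q * rmem t3 6 q - rmem s 3 q * rmem t3 5 q).
  by move=> qM; rewrite /Y -s23// -r3// /cval /=; congr Complex; ring.
have t3r b : b \in [:: 2; 3; 4; 0; 1]%N -> rmem t3 b = rmem s b.
  by rewrite !inE => bE; rewrite !rmem_run//; move: bE;
    do !(case/orP => [/eqP -> //|]); move=> /eqP ->.
have r4 i : (i < M)%N -> rmem t4 7 i = complex.Re (Y i).
  move=> iM; rewrite (run_rfill (f := fun j => complex.Re (Y j))) ?b3 ?iM//.
  by move=> k t kM tv _ tr _ /=; rewrite tv !tr// YE//= (t3r 2%N)// (t3r 3%N).
have r5 i : (i < M)%N -> rmem t5 8 i = complex.Im (Y i).
  move=> iM; rewrite (run_rfill (f := fun j => complex.Im (Y j))) ?b4 ?iM//.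
  by move=> k t kM tv _ tr _ /=; rewrite tv !tr// !(@rmem_run _ _ c4)// YE//=
    (t3r 2%N)// (t3r 3%N).
have r6 i : (i < M)%N -> rmem t6 5 i = complex.Re (Y i).
  move=> iM; rewrite (run_rfill (f := fun j => complex.Re (Y j))) ?b5 ?iM//.
  by move=> k t kM tv _ tr _ /=; rewrite tv tr// rmem_run// r4.
have r7 i : (i < M)%N -> rmem t7 6 i = complex.Im (Y i).
  move=> iM; rewrite (run_rfill (f := fun j => complex.Im (Y j))) ?b6 ?iM//.
  by move=> k t kM tv _ tr _ /=; rewrite tv tr// rmem_run// r5.
have r8 c : (c < n.-1)%N -> rmem t8 5 c =
    M%:R * \sum_(a < n.-1) rmem s 4 a * power_kernel n g (a + c).
  move=> cn; have cM : (c < M)%N by lia.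
  have : cval t8 5 6 c = dft M Y c.
    rewrite (@run_fft _ K _ L)//; [|by rewrite !imem_run..].
    apply: eq_dft => t tM; rewrite /cval r7// (@rmem_run _ _ c7)// r6//.
    by case: (Y t).
  by rewrite (dft_correlation _ s4); [case | lia | lia].
have t8n : imem t8 0 1%N = n by rewrite !imem_run.
have [b bn [bE bmin]] := run_argmin n1 t8n; exists b => //.
have bM : (b < M)%N by lia.
have t9r c : c \in [:: 0; 1; 4]%N -> rmem t9 c = rmem s c.
  by rewrite !inE => /or3P[] /eqP ->; rewrite !rmem_run.
have t9i c : c \in [:: 0; 1; 12; 15]%N -> imem t9 c = imem s c.
  by rewrite !inE => /or4P[] /eqP ->; rewrite !imem_run.
have {}bE : imem t9 16 0%N = b := bE.
move: (t9) bE t9r t9i @t10 @t11 tab => {}t9 bE t9r t9i t10 t11 tab.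
have t10r c : c \in [:: 0; 1; 4]%N -> rmem t10 c = rmem s c by exact: t9r.
have t10i c : c \in [:: 0; 12; 15]%N -> imem t10 c = imem s c.
  by rewrite !inE => /or3P[] /eqP ->; rewrite -t9i.
have t10b : imem t10 16 0%N = b by rewrite /t10 /= /upd.
have out j : imem t10 1 j = if j == imem s 12 0%N then (g ^ b %% n)%N else imem s 1 j.
  by rewrite /t10 /= /upd eqxx/= (t9i 1%N)// (t9i 12%N)// (t9i 15%N)// bE s15.
move: (t10) @t11 tab t10r t10i t10b out => {t9 bE t9r t9i}t10 t11 tab t10r t10i t10b out.
have b10 : ieval t10 (ISub nreg (ICst 1)) = n.-1 by rewrite /= t10i// s0 subn1.
split => //.
- by rewrite rmem_run// t10r.
- by move=> j; rewrite imem_run.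
- by move=> c cn; have := bmin c cn; rewrite !r8// ler_pM2l// ltr0n.
- move=> a; rewrite (run_rfill (f := fun a => rmem s 4 a *
    (1 + rmem s 0 (imem s 12 0%N) * power_kernel n g (a + b)))) b10.
    by case: ltnP => // an; rewrite t10r// s4.
  move=> k t kn tv ti tr ta /=.
  rewrite tv ta// (tr 0%N)// (tr 1%N)// (ti 12%N)// (ti 16%N)// t10b.
  by rewrite !t10r// t10i// s1//; lia.
Qed.

End cbc_program.

(** * Correctness of the program *)

Section cbc_correctness.
Context {R : realType}.
Implicit Types (s t : memory R) (gamma : nat -> R) (z : nat -> nat).

Definition cbc_cmd : cmd :=
  Seq log_cmd (Seq search_cmd (Seq table_cmd (For 12 (IGet 0 (ICst 0)) step_cmd))).

(** The criterion reduced to what depends on the candidate: the node i = 0, the terms of the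
    previous dimension and the positive factor gamma_k / n are left out. *)
Definition greedy (K : R -> R) gamma n d z : Prop := forall k, (k < d)%N ->
  (0 < z k < n)%N /\ forall c, (0 < c < n)%N ->
    \sum_(i < n | (0 < i)%N)
      (\prod_(j < k) (1 + gamma j * K ((i * z j %% n)%N%:R / n%:R))) *
        K ((i * z k %% n)%N%:R / n%:R) <=
    \sum_(i < n | (0 < i)%N)
      (\prod_(j < k) (1 + gamma j * K ((i * z j %% n)%N%:R / n%:R))) *
        K ((i * c %% n)%N%:R / n%:R).

Lemma run_cbc K gamma n d : prime n ->
  greedy K gamma n d (imem (run K cbc_cmd (cbc_input gamma d n)) 1).
Proof.
move=> pn; have n1 := prime_gt1 pn; have [ o os] := exists_unit_order pn.
set s := cbc_input gamma d n; rewrite /cbc_cmd.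
set cm := For 12 _ _; rewrite 3!run_Seq.
set s1 := run K log_cmd s; set s2 := run K search_cmd s1; set s3 := run K table_cmd s2.
have s1n : imem s1 0 1%N = n by rewrite imem_run.
have [L [s1L s1M nM Mn]] := run_log K (erefl : imem s 0 1%N = n) n1 erefl.
rewrite -/s1 in s1L s1M.
have nL : (n < 2 ^ L)%N by lia.
have [s2g _ _ _ _] : represents (iter (n * L.+1) (gstep n) ginit) s2.
  by apply: run_search => //; rewrite imem_run.
have [g [gn og gE _]] := ex_gscan_done pn os nL (leqnn _).
rewrite gE in s2g.
have [] := @run_table _ K n g L s2 n1 _ _ _ s2g _.
- by rewrite !imem_run.
- by rewrite /s2 imem_run.
- by rewrite /s2 imem_run.
- by move=> a; rewrite !rmem_run.
rewrite -/s3 => tab s34.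
have s3d : imem s3 0 0%N = d by rewrite !imem_run.
have s3r : rmem s3 0 = rmem s 0 by rewrite !rmem_run.
pose V a c := K ((g ^ a * c %% n)%N%:R / n%:R).
(* With i = g^a, multiplying i by c = g^b becomes the shift of a by b, whence a correlation. *)
have sumV k z (c : nat) : \sum_(i < n | (0 < i)%N)
      (\prod_(j < k) (1 + gamma j * K ((i * z j %% n)%N%:R / n%:R))) *
        K ((i * c %% n)%N%:R / n%:R) =
    \sum_(a < n.-1) (\prod_(j < k) (1 + gamma j * V a (z j))) * V a c.
  rewrite (sum_generator_powers pn os (fun i => (\prod_(j < k)
    (1 + gamma j * K ((i * z j %% n)%N%:R / n%:R))) * K ((i * c %% n)%N%:R / n%:R)) gn og).
  by apply: eq_bigr => a _; rewrite /V modnMml; congr (_ * _); apply: eq_bigr => j _;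
    rewrite modnMml.
pose Q k t := [/\ tabulated K n g L t, rmem t 0 = rmem s 0,
  greedy K gamma n k (imem t 1) &
  forall a, rmem t 4 a = if (a < n.-1)%N then
    \prod_(j < k) (1 + gamma j * V a (imem t 1 j)) else 0].
suff [] : Q d (run K cm s3) by [].
have b3 : ieval s3 (IGet 0 (ICst 0)) = d by exact: s3d.
rewrite -b3; apply: for_ind.
  split => // a; rewrite s34; case: ifP => // _.
  by rewrite big_ord0.
move=> k t; rewrite b3 => kd [ttab tr tz tP].
set u := iset t 12 0 k.
have ui b : b != 12%N -> imem u b = imem t b.
  by move=> b12; apply/funext => j; rewrite /u /= /upd (negbTE b12).
have utab : tabulated K n g L u.
  by case: ttab => t0 t2 t3 t15 [t1 t23]; split; rewrite ?ui.
have u4 a : (n.-1 <= a)%N -> rmem u 4 a = 0 by rewrite /u /= tP ltnNge => ->.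
have [b bn [vtab v0 v1 vmin v4]] := run_step n1 nM utab u4.
have u12 : imem u 12 0%N = k by rewrite /u /= /upd.
rewrite u12 (ui 1%N)// in v1; rewrite u12 in v4.
have uk : rmem u 0 k = gamma k by rewrite /u /= tr /= kd.
rewrite uk in v4.
move: (run K step_cmd u) vtab v0 v1 v4 => v vtab v0 v1 v4.
have VE a e : V a (g ^ e %% n)%N = power_kernel K n g (a + e).
  by rewrite /V modnMmr -expnD.
have oldz j : (j < k)%N -> imem v 1 j = imem t 1 j.
  by move=> jk; rewrite v1 ltn_eqF.
have newz : imem v 1 k = (g ^ b %% n)%N by rewrite v1 eqxx.
have oldP i a : (i <= k)%N ->
    \prod_(j < i) (1 + gamma j * V a (imem v 1 j)) =
    \prod_(j < i) (1 + gamma j * V a (imem t 1 j)).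
  by move=> ik; apply: eq_bigr => j _; rewrite oldz// (leq_trans (ltn_ord j)).
split => //; first by rewrite v0 /u /= tr.
- move=> i; rewrite ltnS leq_eqVlt => /predU1P[->|ik]; last first.
    have [zi zc] := tz i ik; rewrite oldz//; split => // c cn; have := zc c cn.
    rewrite !sumV; under eq_bigr => a _ do rewrite -(oldP i a (ltnW ik)).
    by under [in X in _ <= X -> _]eq_bigr => a _ do rewrite -(oldP i a (ltnW ik)).
  rewrite newz; split.
    apply/andP; split; last by rewrite ltn_pmod ?prime_gt0.
    rewrite lt0n; apply/negP => gb.
    move: gb; rewrite -/(n %| g ^ b)%N Euclid_dvdX// => /andP[] + _.
    by rewrite gtnNdvd//; case/andP: gn.
  move=> c cn; have [e en ->] := generator_powers os gn og cn.
  rewrite !sumV; have := vmin e en.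
  have uE f : \sum_(a < n.-1) rmem u 4 a * power_kernel K n g (a + f) =
      \sum_(a < n.-1) (\prod_(j < k) (1 + gamma j * V a (imem v 1 j)))
        * V a (g ^ f %% n)%N.
    by apply: eq_bigr => a _; rewrite /u /= tP ltn_ord (oldP k a (leqnn k)) VE.
  by rewrite !uE.
- move=> a; rewrite v4 /u /= tP; case: (a < n.-1)%N => //.
  by rewrite big_ord_recr /= (oldP k a (leqnn k)) newz VE.
Qed.

Lemma greedy_cbc_minimal alpha gamma n d z : prime n -> 1 / 2 < alpha ->
  (forall j, 0 < gamma j) ->
  greedy (korobov_kernel alpha) gamma n d z -> cbc_minimal alpha gamma n d z.
Proof.
move=> pn a2 gpos gr s sd; have [zs zmin] := gr s sd; split => // c cn.
have n0 : (0 < n)%N := prime_gt0 pn.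
rewrite /dual_sum ler_pM2l ?invr_gt0 ?ltr0n//.
pose P (i : nat) := \prod_(j < s)
  (1 + gamma j * korobov_kernel alpha ((i * z j %% n)%N%:R / n%:R)).
have E z' : (forall j, (j < s)%N -> z' j = z j) ->
  \sum_(i < n) \prod_(j < s.+1) ((~~ (pred0 : pred nat) j)%:R +
     gamma j * korobov_kernel alpha ((i * z' j)%N%:R / n%:R)) =
  \prod_(j < s.+1) (1 + gamma j * korobov_kernel alpha 0) +
  (\sum_(i < n | (0 < i)%N) P i +
   gamma s * \sum_(i < n | (0 < i)%N) P i *
     korobov_kernel alpha ((i * z' s %% n)%N%:R / n%:R)).
  move=> zz; rewrite (bigD1 (Ordinal n0)) //=; congr (_ + _).
    by apply: eq_bigr => j _; rewrite mul0n mul0r.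
  rewrite mulr_sumr -big_split /=; apply: eq_big => i.
    by rewrite -(inj_eq val_inj) /= lt0n.
  move=> _; rewrite big_ord_recr /= korobov_kernel_modn//.
  rewrite (_ : \prod_(j < s) _ = P i); first by ring.
  by apply: eq_bigr => j _; rewrite /= zz// korobov_kernel_modn.
rewrite (E z)// (E (fun j => if j == s then c else z j)) => [|j js]; last by rewrite ltn_eqF.
rewrite !lerD2l ler_pM2l// eqxx; exact: zmin.
Qed.

End cbc_correctness.

(** * Operation count *)

Section cbc_complexity.
Context {R : realType}.
Implicit Types (s t : memory R).

Lemma max_cost_log n s : imem s 0 1%N = n -> (0 < n)%N ->
  (max_cost log_cmd s <= 100 * n)%N.
Proof. by move=> s0 n0; rewrite /= s0; lia. Qed.

Lemma max_cost_search n L s : imem s 0 1%N = n -> imem s 2 0%N = L -> (0 < n)%N ->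
  (max_cost search_cmd s <= 200 * (n * L.+1))%N.
Proof. by move=> s0 s2 n0; rewrite /= s0 s2; nia. Qed.

Lemma max_cost_fft n L s : imem s 2 0%N = L -> imem s 3 0%N = (2 ^ L)%N ->
  (2 ^ L < 4 * n)%N -> (max_cost fft_cmd s <= 1000 * (n * L.+1))%N.
Proof.
move=> s2 s3; rewrite /= s2 s3; move: (2 ^ L)%N => M Mn.
have ML : (M * L <= 4 * n * L)%N by rewrite leq_mul2r (ltnW Mn) orbT.
by nia.
Qed.

Lemma max_cost_table n L s : imem s 0 1%N = n -> imem s 2 0%N = L ->
  imem s 3 0%N = (2 ^ L)%N -> (0 < n)%N -> (2 ^ L < 4 * n)%N ->
  (max_cost table_cmd s <= 1500 * (n * L.+1))%N.
Proof.
move=> s0 s2 s3 n0 Mn; have := max_cost_fft s2 s3 Mn.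
rewrite /table_cmd; move: fft_cmd => c; rewrite /= s0 s3.
move: (2 ^ L)%N Mn => M Mn; nia.
Qed.

Lemma max_cost_step n L s : imem s 0 1%N = n -> imem s 2 0%N = L ->
  imem s 3 0%N = (2 ^ L)%N -> (0 < n)%N -> (2 ^ L < 4 * n)%N ->
  (max_cost step_cmd s <= 3000 * (n * L.+1))%N.
Proof.
move=> s0 s2 s3 n0 Mn; have := max_cost_fft s2 s3 Mn.
rewrite /step_cmd; move: fft_cmd => c; rewrite /= s0 s3.
move: (2 ^ L)%N Mn => M Mn; nia.
Qed.

(** Later loops take their bounds from the cells L and M that [log_cmd] computes. Its cost is
    therefore bounded separately, and that of the rest from the state it leaves, after which the
    arrays 0, 2 and 3 no longer change. *)
Lemma cost_cbc_cmd : exists C : nat, forall (K : R -> R) gamma n d,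
  (1 < n)%N -> (0 < d)%N -> exists2 L, (2 ^ L < 4 * n)%N &
    (cost K cbc_cmd (cbc_input gamma d n) <= C * (d * (n * L.+1)))%N.
Proof.
exists 5000%N => K gamma n d n1 d0; set s := cbc_input gamma d n; have n0 := ltnW n1.
have [L [s1L s1M nM Mn]] := run_log K (erefl : imem s 0 1%N = n) n1 erefl.
exists L => //; set s1 := run K log_cmd s in s1L s1M.
have s1n : imem s1 0 1%N = n by rewrite imem_run.
have s1d : imem s1 0 0%N = d by rewrite imem_run.
rewrite /cbc_cmd; set c := Seq search_cmd _.
have c1 : (cost K log_cmd s <= max_cost log_cmd s)%N.
  exact: (@cost_le_max_cost _ _ (pred1 0%N)).
have c2 : (cost K c s1 <= max_cost c s1)%N.
  exact: (@cost_le_max_cost _ _ (pred3 0 2 3)%N).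
apply: (leq_trans (leq_add c1 c2)).
have := max_cost_log (erefl : imem s 0 1%N = n) n0.
have := max_cost_search s1n s1L n0.
have := max_cost_table s1n s1L s1M n0 Mn.
have := max_cost_step s1n s1L s1M n0 Mn.
rewrite /c; move: log_cmd search_cmd table_cmd step_cmd => a1 a2 a3 a4.
rewrite /= s1d; set X := (n * L.+1)%N.
have nX : (n <= X)%N by rewrite leq_pmulr.
have X0 : (0 < X)%N by exact: leq_trans nX.
move: (max_cost a1 s) (max_cost a2 s1) (max_cost a3 s1) (max_cost a4 s1) => x y z w.
move=> wX zX yX xn; have dw : (d * w.+1 <= d * (3000 * X + X))%N.
  by rewrite leq_mul2l; apply/orP; right; lia.
have dX : (X <= d * X)%N by rewrite leq_pmull.
by nia.
Qed.

(** From 2^L < 4n one gets (L + 1) ln 2 <= 3 ln 2 + ln n <= 4 ln n, as n >= 2. *)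
Lemma log_le_ln n L : (1 < n)%N -> (2 ^ L < 4 * n)%N ->
  (L.+1)%:R <= 4 / ln 2 * ln (n%:R : R).
Proof.
move=> n1 Ln; have l2 : 0 < ln (2 : R) by rewrite ln_gt0// ltr1n.
have np : 0 < n%:R :> R by rewrite ltr0n ltnW.
have l2n : ln (2 : R) <= ln n%:R by rewrite ler_ln ?posrE// ler_nat.
rewrite mulrAC ler_pdivlMr//.
have : L%:R * ln (2 : R) <= ln 2 *+ 2 + ln n%:R.
  have -> : ln (2 : R) *+ 2 = ln (4 : R).
    by rewrite -lnXn//; congr ln; rewrite -natrX.
  rewrite -lnM ?posrE// mulr_natl -lnXn// ler_ln ?posrE ?exprn_gt0 ?mulr_gt0//.
  by rewrite -natrX -natrM ler_nat ltnW.
by rewrite -natr1 mulrDl mul1r; lra.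
Qed.

Lemma cbc_cost_le : exists c : R, forall (alpha : R) gamma n d, (1 < n)%N -> (0 < d)%N ->
  (cbc_cost cbc_cmd alpha gamma n d)%:R <= c * (d%:R * n%:R * ln n%:R).
Proof.
have [C cC] := cost_cbc_cmd; exists (C%:R * (4 / ln 2)) => alpha gamma n d n1 d0.
have [L Ln cL] := cC (korobov_kernel alpha) gamma n d n1 d0.
apply: (@le_trans _ _ (C * (d * (n * L.+1)))%N%:R); first by rewrite ler_nat.
have := log_le_ln n1 Ln; move: (4 / ln 2) => c Lc; rewrite !natrM.
have -> : C%:R * c * (d%:R * n%:R * ln n%:R) = C%:R * (d%:R * (n%:R * (c * ln n%:R))).
  by ring.
by rewrite !ler_wpM2l.
Qed.

End cbc_complexity.

(** * From the error bound to convergence rates *)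

Section error_bounds.
Context {R : realType}.
Implicit Types (alpha lambda : R) (gamma : nat -> R) (z : nat -> nat).

Lemma cbc_minimal_is_cbc alpha gamma n d z : 1 / 2 < alpha -> (0 < n)%N ->
  (forall j, 0 < gamma j) -> cbc_minimal alpha gamma n d z -> is_cbc alpha gamma n d z.
Proof.
move=> al n0 g0 zmin s sd; have [zs zc] := zmin s sd; split => // c cn.
rewrite /cbc_criterion !wce_korobov// -!EFin_expe lee_fin !sqr_sqrtr ?subr_ge0 ?dual_sum_ge1//.
by rewrite lerD2r; exact: zc.
Qed.

Lemma sqrt_dual_sum_le alpha gamma n z d lambda (B : R) : 1 / 2 < alpha -> (0 < n)%N ->
  (forall j, 0 < gamma j) -> 0 < lambda ->
  (dual_sum alpha gamma n z d pred0 - 1) `^ lambda <= B ->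
  Num.sqrt (dual_sum alpha gamma n z d pred0 - 1) <= B `^ (1 / (2 * lambda)).
Proof.
move=> al n0 g0 l0 SB; have S0 : 0 <= dual_sum alpha gamma n z d pred0 - 1.
  by rewrite subr_ge0 dual_sum_ge1.
rewrite -powR12_sqrt// [X in X <= _](_ : _ =
    ((dual_sum alpha gamma n z d pred0 - 1) `^ lambda) `^ (1 / (2 * lambda))).
  apply: ge0_ler_powR => //; last by rewrite nnegrE (le_trans _ SB)// powR_ge0.
    by rewrite divr_ge0// mulr_ge0// ltW.
  by rewrite nnegrE powR_ge0.
rewrite -powRrM; congr (_ `^ _); field; lra.
Qed.

Lemma zeta_ge0 (x : R) : 1 < x -> 0 <= zeta x.
Proof.
move=> x1; have x2 : 1 / 2 < x / 2 by lra.
have := korobov_kernel0_ge0 x2; rewrite korobov_kernelE0// (_ : 2 * (x / 2) = x); first by lra.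
by field.
Qed.

(** By 1 + x <= e^x and monotonicity of the partial sums; the bound is uniform in d. *)
Lemma prodr_le_expR_lim (u : nat -> R) (a : R) d : 0 <= a -> (forall j, 0 <= u j) ->
  cvgn (series u) -> \prod_(j < d) (1 + a * u j) <= expR (a * limn (series u)).
Proof.
move=> a0 u0 cu; apply: (@le_trans _ _ (\prod_(j < d) expR (a * u j))).
  by apply: ler_prod => j _; rewrite addr_ge0 ?mulr_ge0//= expR_ge1Dx.
rewrite -expR_sum ler_expR -mulr_sumr ler_wpM2l//.
have := @nondecreasing_cvgn_le _ (series u) _ cu d.
rewrite /series /= big_mkord; apply; exact: (nondecreasing_series (P := predT)).
Qed.

(** The factor 2 comes from n <= 2 (n - 1) for n >= 2. *)
Lemma powR_invr_pred_le (c p : R) n : 0 <= c -> 0 <= p -> (1 < n)%N ->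
  (n.-1%:R^-1 * c) `^ p <= (2 * c) `^ p * n%:R `^ (- p).
Proof.
move=> c0 p0 n1; have np : 0 < n%:R :> R by rewrite ltr0n ltnW.
have mp : 0 < n.-1%:R :> R by rewrite ltr0n -ltnS prednK// ltnW.
have -> : n%:R `^ (- p) = (n%:R^-1 : R) `^ p.
  by rewrite -powR_inv1 ?ltW// -powRrM mulN1r.
rewrite -powRM ?mulr_ge0 ?invr_ge0 ?(ltW np)//.
apply: ge0_ler_powR => //; rewrite ?nnegrE ?mulr_ge0 ?invr_ge0 ?(ltW np) ?(ltW mp)//.
rewrite mulrC [leRHS]mulrAC [leRHS]mulrC ler_wpM2l// ler_pdivlMr// mulrC ler_pdivrMr//.
by rewrite -natrM ler_nat; lia.
Qed.

End error_bounds.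

Theorem corollary1 (R : realType) :
  exists p : cmd,
  let z := cbc_output (R := R) p in
  let err_tent alpha gamma n d :=
    wce (cosine_space alpha gamma d) (tent_lattice_rule n (z alpha gamma n d)) in
  let err_lat alpha gamma n d :=
    wce (korobov_space alpha gamma d) (lattice_rule n (z alpha gamma n d)) in
  (exists c : R, forall (alpha : R) (gamma : nat -> R) (n d : nat),
    1 / 2 < alpha -> admissible_weights gamma -> prime n -> (0 < d)%N ->
    (cbc_cost p alpha gamma n d)%:R <= c * (d%:R * n%:R * ln n%:R))
  /\
  forall (alpha : R) (gamma : nat -> R),
    1 / 2 < alpha -> admissible_weights gamma ->
    [/\ forall n d : nat, prime n -> (0 < d)%N ->
          is_cbc alpha gamma n d (z alpha gamma n d) /\
          forall lambda : R, 1 / (2 * alpha) < lambda <= 1 ->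
            (err_tent alpha gamma n d <= err_lat alpha gamma n d <=
             (((n.-1)%:R^-1 *
               (\prod_(j < d)
                  (1 + 2 * zeta (2 * alpha * lambda) * gamma j `^ lambda) - 1))
              `^ (1 / (2 * lambda)))%:E)%E,
        forall (lambda : R) (d : nat), 1 / (2 * alpha) < lambda <= 1 -> (0 < d)%N ->
          exists c : R, forall n : nat, prime n ->
            (err_tent alpha gamma n d <= err_lat alpha gamma n d <=
             (c * n%:R `^ (- (1 / (2 * lambda))))%:E)%E,
        forall lambda : R, 1 / (2 * alpha) < lambda <= 1 ->
          cvgn (series (fun j => gamma j `^ lambda)) ->
          exists c : R, forall n d : nat, prime n -> (0 < d)%N ->
            (err_tent alpha gamma n d <= err_lat alpha gamma n d <=
             (c * n%:R `^ (- (1 / (2 * lambda))))%:E)%E,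
        forall (delta : R) (d : nat), 0 < delta -> (0 < d)%N ->
          exists c : R, forall n : nat, prime n ->
            (err_tent alpha gamma n d <= err_lat alpha gamma n d <=
             (c * n%:R `^ (- alpha + delta))%:E)%E
      & forall (beta : R) (d : nat), alpha < beta -> (0 < d)%N ->
          ~ exists (w : forall n : nat, 'I_n -> R[i])
                   (x : forall n : nat, 'I_n -> d.-tuple R),
              (forall n i, cube (x n i)) /\
              exists c : R, \forall n \near \oo,
                (wce (cosine_space alpha gamma d) (linear_rule (w n) (x n)) <=
                 (c * n%:R `^ (- beta))%:E)%E].
Proof.
exists cbc_cmd => z err_tent err_lat; split.
  have [c cc] := @cbc_cost_le R; exists c => alpha gamma n d _ _ pn d0.
  by apply: cc => //; exact: prime_gt1.
move=> alpha gamma al [g01 gdec g0].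
have zmin n d : prime n -> cbc_minimal alpha gamma n d (z alpha gamma n d).
  by move=> pn; apply: greedy_cbc_minimal => //; exact: run_cbc.
have ratio lambda : 1 / (2 * alpha) < lambda <= 1 -> 0 < lambda /\ 1 < 2 * alpha * lambda.
  move=> /andP[l0 _]; have a0 : 0 < 2 * alpha by lra.
  split; first by apply: lt_trans l0; rewrite divr_gt0.
  by rewrite mulrC -ltr_pdivrMr.
pose Z lambda := 2 * zeta (2 * alpha * lambda).
have Z0 lambda : 1 / (2 * alpha) < lambda <= 1 -> 0 <= Z lambda.
  by move=> /ratio[_ l1]; rewrite mulr_ge0// zeta_ge0.
have bound n d lambda : prime n -> 1 / (2 * alpha) < lambda <= 1 ->
    (err_tent alpha gamma n d <= err_lat alpha gamma n d <=
     ((n.-1%:R^-1 * (\prod_(j < d) (1 + Z lambda * gamma j `^ lambda) - 1))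
       `^ (1 / (2 * lambda)))%:E)%E.
  move=> pn lam; have n0 := prime_gt0 pn; have [l0 _] := ratio _ lam.
  rewrite /err_tent /err_lat wce_korobov// wce_tent_le//= lee_fin.
  apply: sqrt_dual_sum_le => //; case/andP: lam => la lb.
  by apply: cbc_minimal_bound => //; exact: zmin.
(* Any upper bound c of the product minus 1 gives the rate: that quantity itself when d is fixed,
   its exponential bound when the weights are summable. *)
have rate lambda (c : R) n d : prime n -> 1 / (2 * alpha) < lambda <= 1 ->
    \prod_(j < d) (1 + Z lambda * gamma j `^ lambda) - 1 <= c ->
    (err_tent alpha gamma n d <= err_lat alpha gamma n d <=
     ((2 * c) `^ (1 / (2 * lambda)) * n%:R `^ (- (1 / (2 * lambda))))%:E)%E.
  move=> pn lam cle; have /andP[-> lat] := bound n d _ pn lam; apply: (le_trans lat).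
  have [l0 _] := ratio _ lam; have p0 : 0 <= 1 / (2 * lambda).
    by rewrite divr_ge0// mulr_ge0// ltW.
  have P1 : 0 <= \prod_(j < d) (1 + Z lambda * gamma j `^ lambda) - 1.
    rewrite subr_ge0; elim/big_ind: _ => // [x y x1 y1|j _]; first by rewrite mulr_ege1.
    by rewrite lerDl mulr_ge0 ?powR_ge0 ?Z0.
  rewrite lee_fin; apply: le_trans (powR_invr_pred_le (le_trans P1 cle) p0 (prime_gt1 pn)).
  apply: ge0_ler_powR => //; rewrite ?nnegrE ?mulr_ge0 ?(le_trans P1 cle)//.
  by rewrite ler_wpM2l.
split.
- move=> n d pn d0; split=> [|lambda lam]; last exact: bound.
  by apply: cbc_minimal_is_cbc => //; [exact: prime_gt0 | exact: zmin].
- move=> lambda d lam d0.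
  by eexists => n pn; apply: rate => //; exact: lexx.
- move=> lambda lam cg.
  exists ((2 * (expR (Z lambda * limn (series (fun j => gamma j `^ lambda))) - 1))
    `^ (1 / (2 * lambda))) => n d pn d0; apply: rate => //.
  by rewrite lerD2r prodr_le_expR_lim ?Z0// => j; exact: powR_ge0.
- move=> delta d de d0.
  (* The choice lambda = 1 / (2 (alpha - delta)) gives the rate alpha - delta exactly and is
     admissible if alpha - delta > 1/2; otherwise lambda = 1 already gives the sufficient rate
     1/2. *)
  have [lambda lam lde] : exists2 lambda : R, 1 / (2 * alpha) < lambda <= 1 &
      - (1 / (2 * lambda)) <= - alpha + delta.
    have [small|big] := lerP (alpha - delta) (1 / 2).
      by exists 1; rewrite ?lexx ?andbT ?ltr_pdivrMr; lra.
    exists (1 / (2 * (alpha - delta))); last first.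
      by rewrite (_ : 1 / (2 * (1 / _)) = alpha - delta); [lra | field; lra].
    apply/andP; split; last by rewrite ler_pdivrMr; lra.
    by rewrite !div1r ltf_pV2 ?posrE; lra.
  exists ((2 * (\prod_(j < d) (1 + Z lambda * gamma j `^ lambda) - 1))
    `^ (1 / (2 * lambda))) => n pn.
  have /andP[-> lat] := rate lambda _ n d pn lam (lexx _); apply: (le_trans lat).
  rewrite lee_fin ler_wpM2l ?powR_ge0// ler_powR// ler1n; exact: prime_gt0.
- move=> beta [//|d] ab _ [w [x [xc [c cbound]]]].
  have al0 : 0 < alpha by lra.
  apply: (@not_powR_bound _ (Num.sqrt (gamma 0%N) / (4 * 4 `^ alpha)) c _ _ _ ab).
    by rewrite divr_gt0 ?sqrtr_gt0 ?mulr_gt0 ?powR_gt0.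
  near=> n; rewrite -lee_fin.
  have n0 : (0 < n)%N by near: n; exact: nbhs_infty_gt.
  apply: le_trans (wce_linear_rule_ge (w n) (x n) al0 _ g0 n0) _; first by rewrite g0 g01.
  by near: n; exact: cbound.
Unshelve. all: by end_near. Qed.
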